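(* Let $n\ge3$, let $(f,\Gamma)$ be an elliptic data and let $g=e^{2\rho}g_0$, $\rho\in C^2(\overline{\mathbb S^n_+})$, be a supersolution to $(f,\Gamma)$ on the closed hemisphere $\overline{\mathbb S^n_+}$, i.e. $$\lambda_g(p)\in\Gamma\quad\text{and}\quad f(\lambda_g(p))\ge1\qquad\text{for all }p\in\mathbb S^n_+ .$$ Assume that the boundary $\partial\mathbb S^n_+$ with the metric induced by $g$ is isometric to $\partial\mathbb S^n_+$ with the metric induced by $g_0$ (the standard unit sphere $\mathbb S^{n-1}$). Then $g=\Phi^*g_0$ on $\overline{\mathbb S^n_+}$ for some conformal diffeomorphism $\Phi$ of $\mathbb S^n$ preserving $\overline{\mathbb S^n_+}$.
   Context: $(\mathbb S^n,g_0)$ is the standard unit round sphere and $\mathbb S^n_+=\{x\in\mathbb S^n\subset\mathbb R^{n+1}: x_{n+1}>0\}$ is the open upper hemisphere. For $n\ge3$, the Schouten tensor of $g$ is $\mathrm{Sch}_g=\frac{1}{n-2}\left(\mathrm{Ric}_g-\frac{R_g}{2(n-1)}g\right)$, and $\lambda_g(p)=(\lambda_1(p),\dots,\lambda_n(p))$ denotes the eigenvalues of $g^{-1}\mathrm{Sch}_g$ at $p$. (So $\mathrm{Sch}_{g_0}=\frac12 g_0$.) Let $\Gamma_n=\{x\in\mathbb R^n: x_i>0,\ i=1,\dots,n\}$ and $\Gamma_1=\{x\in\mathbb R^n: x_1+\cdots+x_n>0\}$. Let $\Gamma\subset\mathbb R^n$ be a symmetric (permutation-invariant) open convex cone and $f\in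 C^1(\Gamma)\cap C^0(\overline\Gamma)$. The pair $(f,\Gamma)$ is an elliptic data if: (1) $\Gamma_n\subset\Gamma\subset\Gamma_1$; (2) $f$ is symmetric; (3) $f>0$ in $\Gamma$; (4) $f|_{\partial\Gamma}=0$; (5) $f$ is homogeneous of degree $1$; (6) $\nabla f(x)\in\Gamma_n$ for all $x\in\Gamma$; (7) $f(1,\dots,1)=2$. No concavity of $f$ is assumed. *)

(* Defs.v *)
From HB Require Import structures.
From mathcomp Require Import all_boot all_order all_algebra all_fingroup.
From mathcomp Require Import all_classical all_reals all_analysis.

Set Implicit Arguments.
Unset Strict Implicit.
Unset Printing Implicit Defensive.

Import Order.TTheory GRing.Theory Num.Theory.
Import numFieldNormedType.Exports.

Local Open Scope classical_set_scope.
Local Open Scope ring_scope.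

Section Calculus.
Context {R : realType}.

(* The norm provided on row vectors by the library is the sup norm, which is
   used for the topology only; lengths are measured with [dotv]. *)
Definition dotv m (u v : 'rV[R]_m) : R := \sum_i u 0 i * v 0 i.

Definition vbasis m (i : 'I_m) : 'rV[R]_m := delta_mx 0 i.

Definition grad m (f : 'rV[R]_m -> R) (x : 'rV[R]_m) : 'rV[R]_m :=
  \row_i 'D_(vbasis i) f x.

(* f is of class C^k on the open set U *)
Fixpoint Ck (k : nat) m (W : normedModType R) (U : set 'rV[R]_m)
    (f : 'rV[R]_m -> W) : Prop :=
  match k with
  | 0 => forall x, U x -> {for x, continuous f}
  | k'.+1 =>
      [/\ forall x, U x -> {for x, continuous f},
          forall i x, U x -> derivable f x (vbasis i)
        & forall i, Ck k' U ('D_(vbasis i) f)]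
  end.

(* Regularity of a map on an arbitrary subset A of R^m (such as the sphere, a
   closed hemisphere or the equator): near every point of A the map is the
   restriction to A of a map of that regularity on an open set of R^m. The
   values of f outside A are irrelevant. *)
Definition locally_extends m (W : normedModType R)
    (P : set 'rV[R]_m -> ('rV[R]_m -> W) -> Prop)
    (A : set 'rV[R]_m) (f : 'rV[R]_m -> W) : Prop :=
  forall x, A x -> exists (U : set 'rV[R]_m) (h : 'rV[R]_m -> W),
    [/\ open U, U x, P U h & forall y, U y -> A y -> h y = f y].

Definition Ck_on (k : nat) m (W : normedModType R) (A : set 'rV[R]_m)
    (f : 'rV[R]_m -> W) : Prop :=
  locally_extends (fun U h => Ck k U h) A f.

Definition smooth_on m (W : normedModType R) (A : set 'rV[R]_m)
    (f : 'rV[R]_m -> W) : Prop :=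
  locally_extends (fun U h => forall k, Ck k U h) A f.

Definition diffeo m (A B : set 'rV[R]_m) (F : 'rV[R]_m -> 'rV[R]_m) : Prop :=
  smooth_on A F /\
  exists G : 'rV[R]_m -> 'rV[R]_m,
    [/\ smooth_on B G,
        (forall x, A x -> B (F x)) /\ (forall y, B y -> A (G y)),
        forall x, A x -> G (F x) = x
      & forall y, B y -> F (G y) = y].

End Calculus.

(* Curvature, in coordinates, of a metric given on an open set of R^n by its
   matrix field G. *)
Section Curvature.
Context {R : realType} {n : nat}.
Implicit Types (G : 'rV[R]_n -> 'M[R]_n) (x : 'rV[R]_n).

(* christoffel G k i j x is Gamma^k_{ij}(x) *)
Definition christoffel G (k i j : 'I_n) x : R :=
  2^-1 * \sum_l invmx (G x) k l *
    ('D_(vbasis i) (fun y => G y j l) x + 'D_(vbasis j) (fun y => G y i l) x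
     - 'D_(vbasis l) (fun y => G y i j) x).

(* riemann G l k i j x is R^l_{kij}(x), the l-th component of
   R(d_i, d_j) d_k = nabla_i nabla_j d_k - nabla_j nabla_i d_k *)
Definition riemann G (l k i j : 'I_n) x : R :=
  'D_(vbasis i) (christoffel G l j k) x - 'D_(vbasis j) (christoffel G l i k) x
  + \sum_m (christoffel G l i m x * christoffel G m j k x
            - christoffel G l j m x * christoffel G m i k x).

Definition ricci G x : 'M[R]_n :=
  \matrix_(j, k) \sum_i riemann G i k i j x.

Definition scalar_curvature G x : R := \tr (invmx (G x) *m ricci G x).

Definition schouten G x : 'M[R]_n :=
  (n%:R - 2)^-1 *:
    (ricci G x - (scalar_curvature G x / (2 * (n%:R - 1))) *: G x).

(* lam lists the eigenvalues of A with multiplicity, in some order *)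
Definition eigenvalues_of (A : 'M[R]_n) (lam : 'rV[R]_n) : Prop :=
  char_poly A = \prod_i ('X - (lam 0 i)%:P).

End Curvature.

(* S^n is the unit sphere of R^(n+1). A Riemannian metric on (part of) S^n is
   given by its values g p u v on tangent vectors u, v at p; its values on other
   arguments are irrelevant. *)
Section Sphere.
Context {R : realType} {n : nat}.
Local Notation point := 'rV[R]_(n + 1).
Local Notation metric := (point -> point -> point -> R).

Definition height (p : point) : R := rsubmx p 0 0.

Definition sphere : set point := [set p | dotv p p = 1].
Definition hemisphere : set point := [set p | sphere p /\ 0 < height p].
Definition closed_hemisphere : set point := [set p | sphere p /\ 0 <= height p].
Definition equator : set point := [set p | sphere p /\ height p = 0].

Definition tangent (p : point) : set point := [set u | dotv p u = 0].
Definition equator_tangent (p : point) : set point :=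
  [set u | tangent p u /\ height u = 0].

Definition round_metric : metric := fun _ u v => dotv u v.

Definition conformal_metric (rho : point -> R) : metric :=
  fun p u v => expR (2 * rho p) * round_metric p u v.

Definition unitize (x : point) : point := (Num.sqrt (dotv x x))^-1 *: x.

(* Differential at p, in the tangent direction u, of a map F defined on the
   sphere or on the equator: the derivative at t = 0 of F along the curve
   t |-> (p + t u) / |p + t u|, which stays in the sphere (in the equator if u
   is tangent to it) and has velocity u at t = 0. *)
Definition sphere_diff (F : point -> point) (p u : point) : point :=
  'D_u (F \o unitize) p.

Definition pullback (F : point -> point) (g : metric) : metric :=
  fun p u v => g (F p) (sphere_diff F p u) (sphere_diff F p v).

Definition conformal_diffeo (Phi : point -> point) : Prop :=
  diffeo sphere sphere Phi /\
  exists omega : point -> R, forall p u v,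
    sphere p -> tangent p u -> tangent p v ->
    pullback Phi round_metric p u v = conformal_metric omega p u v.

(* The metrics induced by g and h on the equator are isometric. *)
Definition equator_isometric (g h : metric) : Prop :=
  exists F : point -> point, diffeo equator equator F /\
    forall p u v, equator p -> equator_tangent p u -> equator_tangent p v ->
      pullback F h p u v = g p u v.

(* Stereographic projection from the south pole and its inverse, which maps the
   open unit ball of R^n onto the open upper hemisphere. *)
Definition stereo (p : point) : 'rV[R]_n := (1 + height p)^-1 *: lsubmx p.
Definition stereo_inv (x : 'rV[R]_n) : point :=
  (1 + dotv x x)^-1 *: row_mx (2 *: x) (1 - dotv x x)%:M.

Definition chart_metric (g : metric) (x : 'rV[R]_n) : 'M[R]_n :=
  \matrix_(i, j) g (stereo_inv x) ('D_(vbasis i) stereo_inv x)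
                                  ('D_(vbasis j) stereo_inv x).

(* Matrix of g^-1 Sch_g at p in the stereographic chart. *)
Definition schouten_operator (g : metric) (p : point) : 'M[R]_n :=
  let G := chart_metric g in
  invmx (G (stereo p)) *m schouten G (stereo p).

End Sphere.

Section Elliptic.
Context {R : realType} {n : nat}.

Definition Gamma_n : set 'rV[R]_n := [set x | forall i, 0 < x 0 i].
Definition Gamma_1 : set 'rV[R]_n := [set x | 0 < \sum_i x 0 i].

Record elliptic_data (f : 'rV[R]_n -> R) (Gam : set 'rV[R]_n) : Prop := {
  ed_cone_sym : forall (s : 'S_n) x, Gam x -> Gam (col_perm s x);
  ed_cone_open : open Gam;
  ed_cone_convex : convex_set Gam;
  ed_cone_scale : forall (t : R) x, 0 < t -> Gam x -> Gam (t *: x);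
  ed_C1 : Ck 1 Gam f;
  ed_C0 : {within closure Gam, continuous f};
  ed_cone_lower : Gamma_n `<=` Gam;
  ed_cone_upper : Gam `<=` Gamma_1;
  ed_sym : forall (s : 'S_n) x, Gam x -> f (col_perm s x) = f x;
  ed_pos : forall x, Gam x -> 0 < f x;
  ed_boundary : forall x, (closure Gam `\` interior Gam) x -> f x = 0;
  ed_homogeneous : forall (t : R) x, 0 < t -> Gam x -> f (t *: x) = t * f x;
  ed_grad : forall x, Gam x -> Gamma_n (grad f x);
  ed_normalized : f (const_mx 1) = 2
}.

Definition supersolution (f : 'rV[R]_n -> R) (Gam : set 'rV[R]_n)
    (g : 'rV[R]_(n + 1) -> 'rV[R]_(n + 1) -> 'rV[R]_(n + 1) -> R) : Prop :=
  forall p, hemisphere p ->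
    exists lam : 'rV[R]_n,
      [/\ eigenvalues_of (schouten_operator g p) lam, Gam lam & 1 <= f lam].

End Elliptic.

(* Main.v *)
(** Write g = v^-2 |dx|^2 in the stereographic chart, which identifies the
    hemisphere with the unit ball; then g^-1 Sch_g = v D^2 v - |Dv|^2 / 2, and
    this equals 1/2 on the quadratics v0 = a (1 + |x|^2) / 2 + b.x with
    a^2 - |b|^2 = 1.

    On the equator, the isometry is a conformal diffeomorphism of a round
    sphere of dimension m = n - 1 >= 2. Read in stereographic charts with poles
    q and F q it is a map of R^m with conformal factor theta; flatness gives
    4 theta Lap theta = (6 - m) |D theta|^2, theta tends to e^(-2 rho(q)) at
    infinity, so theta is constant by the maximum principle. This is the
    identity e^(-rho p) e^(-rho q) (1 - F p . F q) = 1 - p.q, which forces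
    e^(-rho) = a + b.p on the equator, that is, v = v0 on the unit sphere.

    In the ball, a supersolution cannot be touched from above by a strict
    subsolution. Comparison with al v0 + r z, z = (1 - |x|^2) / 2, whose
    Schouten operator is (al^2 - r^2) / 2, is optimal at some point for every
    al > 1, so r^2 <= al^2 - 1; letting al tend to 1, v <= v0. If v < v0
    somewhere, an exponential barrier improves this to v <= v0 - e z, and the
    same comparison with al near 1 would now have r <= - e: contradiction.
    Finally the metric (a + b.p)^-2 g_0 is the pullback of g_0 by a Lorentz
    boost. *)
Require Import Defs.
From HB Require Import structures.
From mathcomp Require Import all_boot all_order all_algebra all_fingroup.
From mathcomp Require Import all_classical all_reals all_analysis.
From mathcomp Require Import ring lra.
Import Order.TTheory GRing.Theory Num.Theory.
Import numFieldNormedType.Exports.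
Local Open Scope classical_set_scope.
Local Open Scope ring_scope.
Import Defs.
Set Implicit Arguments.
Unset Strict Implicit.
Unset Printing Implicit Defensive.

(** * Differential calculus of several variables *)

(** Without concavity of [f] there is no useful linearisation between two solutions, so every
    comparison is with an explicit function [U]. At a contact point the eigenvalues of [v] are at
    most 1/2 + O(e) with sum at most n/2 - e; the partial derivatives of [f] at (1/2, ..., 1/2) are
    equal by symmetry, so the deficit of the sum decides to first order and [f] drops below 1.
    Monotonicity and the first-order behaviour of [f] at this one diagonal point are all that is
    exploited.

    The factor [al > 1] is there because [v] and [v0] agree on the unit sphere, where [z] vanishes:
    it keeps the optimal contact inside the ball, so that [v] only has to be continuous up to the
    boundary. The discriminant al^2 - r^2 does not see the sign of [r]: this is why one computation
    gives both the upper bound on [v] and the final contradiction.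

    On the equator, the behaviour of theta at infinity is read in the chart of the antipodal pole,
    where infinity becomes the origin and differentiability of [F] at [q] gives the limit. *)

Section FirstOrder.
Context {R : realType}.

Lemma dotvC m (u v : 'rV[R]_m) : dotv u v = dotv v u.
Proof. by apply: eq_bigr => i _; rewrite mulrC. Qed.

Lemma dotvE m (u v : 'rV[R]_m) : dotv u v = (u *m v^T) 0 0.
Proof. by rewrite mxE; apply: eq_bigr => i _; rewrite mxE. Qed.

Lemma dotvDl m (u v w : 'rV[R]_m) : dotv (u + v) w = dotv u w + dotv v w.
Proof. by rewrite !dotvE mulmxDl mxE. Qed.

Lemma dotvZl m k (u v : 'rV[R]_m) : dotv (k *: u) v = k * dotv u v.
Proof. by rewrite !dotvE -scalemxAl mxE. Qed.

Lemma dotvDr m (u v w : 'rV[R]_m) : dotv u (v + w) = dotv u v + dotv u w.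
Proof. by rewrite ![dotv u _]dotvC dotvDl. Qed.

Lemma dotvZr m k (u v : 'rV[R]_m) : dotv u (k *: v) = k * dotv u v.
Proof. by rewrite ![dotv u _]dotvC dotvZl. Qed.

Lemma dotvNl m (u v : 'rV[R]_m) : dotv (- u) v = - dotv u v.
Proof. by rewrite -scaleN1r dotvZl mulN1r. Qed.

Lemma dotvNr m (u v : 'rV[R]_m) : dotv u (- v) = - dotv u v.
Proof. by rewrite dotvC dotvNl dotvC. Qed.

Lemma dot0v m (u : 'rV[R]_m) : dotv 0 u = 0.
Proof. by rewrite -(scale0r 0) dotvZl mul0r. Qed.

Lemma dotv_ge0 m (u : 'rV[R]_m) : 0 <= dotv u u.
Proof. by apply: sumr_ge0 => i _; rewrite -expr2 sqr_ge0. Qed.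

Lemma dotv_eq0 m (u : 'rV[R]_m) : (dotv u u == 0) = (u == 0).
Proof.
apply/idP/eqP => [|->]; last by rewrite dot0v.
rewrite psumr_eq0 => [/allP h|i _]; last by rewrite -expr2 sqr_ge0.
apply/rowP => i; rewrite mxE; apply/eqP.
by have := h i; rewrite mem_index_enum mulf_eq0 orbb => /(_ isT).
Qed.

Lemma dotv_gt0 m (u : 'rV[R]_m) : (0 < dotv u u) = (u != 0).
Proof. by rewrite lt_def dotv_ge0 andbT dotv_eq0. Qed.

Lemma dotv_basis m (u : 'rV[R]_m) i : dotv u (vbasis i) = u 0 i.
Proof.
rewrite /dotv (bigD1 i) //= big1 => [|j ji]; rewrite mxE eqxx /=.
  by rewrite eqxx mulr1 addr0.
by rewrite (negbTE ji) mulr0.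
Qed.

Lemma row_sum_basis m (u : 'rV[R]_m) : u = \sum_i u 0 i *: vbasis i.
Proof. exact: row_sum_delta. Qed.

Lemma CauchySchwarz_dotv m (u v : 'rV[R]_m) :
  dotv u v ^+ 2 <= dotv u u * dotv v v.
Proof.
have [->|u0] := eqVneq u 0; first by rewrite !dot0v mul0r expr0n.
have uu : 0 < dotv u u by rewrite dotv_gt0.
have := dotv_ge0 (dotv u u *: v - dotv u v *: u).
rewrite dotvDl !dotvDr !dotvZl !dotvNr !dotvNl !dotvZl !dotvZr (dotvC v u).
set a := dotv u u in uu *; set b := dotv u v; set c := dotv v v => h.
have : 0 <= a * (a * c - b ^+ 2) by apply: le_trans h _; lra.
by rewrite pmulr_rge0 // subr_ge0.
Qed.

Lemma ler_coord_norm m (u : 'rV[R]_m) i : `|u 0 i| <= `|u|.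
Proof.
rewrite [leRHS]/Num.Def.normr/= mx_normrE.
exact: (le_bigmax _ _ (ord0, i)).
Qed.

Lemma norm_le_coord m (u : 'rV[R]_m) e :
  0 <= e -> (forall i, `|u 0 i| <= e) -> `|u| <= e.
Proof.
move=> e0 h; rewrite [leLHS]/Num.Def.normr/= mx_normrE.
by apply: bigmax_le => // -[i j] _ /=; rewrite ord1.
Qed.

Lemma dotv_le_norm m (u : 'rV[R]_m) : dotv u u <= m%:R * `|u| ^+ 2.
Proof.
apply: le_trans (_ : \sum_(i < m) `|u| ^+ 2 <= _).
  apply: ler_sum => i _; rewrite -expr2 -(real_normK (num_real (u 0 i))).
  by rewrite lerXn2r ?nnegrE //; exact: ler_coord_norm.
by rewrite sumr_const card_ord mulr_natl.
Qed.

Lemma norm_le_dotv m (u : 'rV[R]_m) : `|u| ^+ 2 <= dotv u u.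
Proof.
have h i : `|u 0 i| <= Num.sqrt (dotv u u).
  rewrite -sqrtr_sqr ler_wsqrtr // /dotv (bigD1 i) //= -expr2.
  by rewrite lerDl sumr_ge0 // => j _; rewrite -expr2 sqr_ge0.
have := norm_le_coord (sqrtr_ge0 _) h => le.
apply: le_trans (_ : Num.sqrt (dotv u u) ^+ 2 <= _).
  by rewrite lerXn2r // nnegrE ?sqrtr_ge0.
by rewrite sqr_sqrtr // dotv_ge0.
Qed.

Lemma is_derive_line m (W : normedModType R) (f : 'rV[R]_m -> W) x u t :
  derivable f (x + t *: u) u ->
  is_derive t 1 (fun s : R => f (x + s *: u)) ('D_u f (x + t *: u)).
Proof.
move=> df.
have e : (fun h : R => h^-1 *: (((fun s : R => f (x + s *: u)) \o shift t) (h *: 1) - f (x + t *: u)))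
  = (fun h : R => h^-1 *: ((f \o shift (x + t *: u)) (h *: u) - f (x + t *: u))).
  apply/funext => h /=; congr (_ *: (f _ - _)).
  by rewrite [h%:A]mulr1 scalerDl addrCA.
by split; rewrite ?/derivable ?/derive e.
Qed.

Lemma differentiable_rowP m N (F : 'rV[R]_m -> 'rV[R]_N) x :
  differentiable F x <-> forall j, differentiable (fun y => F y 0 j) x.
Proof.
split=> h.
  by move=> j; apply: (differentiable_comp h (differentiable_coord _ _ _)).
have -> : F = \sum_(j < N) (fun y => F y 0 j *: (vbasis j : 'rV[R]_N)).
  by apply/funext => y; rewrite fct_sumE -row_sum_basis.
by apply: differentiable_sum => j; exact: differentiableZl.
Qed.

Lemma derive_comp m N (W : normedModType R) (h : 'rV[R]_N -> W)
    (c : 'rV[R]_m -> 'rV[R]_N) x u :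
  differentiable c x -> differentiable h (c x) ->
  'D_u (h \o c) x = 'D_('D_u c x) h (c x).
Proof.
move=> dc dh; rewrite deriveE; last exact: differentiable_comp.
by rewrite diff_comp //= -(deriveE u dc) -deriveE.
Qed.

Lemma derive_lin m (W : normedModType R) (f : 'rV[R]_m -> W) x u :
  differentiable f x -> 'D_u f x = \sum_i u 0 i *: 'D_(vbasis i) f x.
Proof.
move=> df; rewrite deriveE // {1}(row_sum_basis u) linear_sum.
by apply: eq_bigr => i _; rewrite linearZ /= deriveE.
Qed.

Lemma derive_row m N (F : 'rV[R]_m -> 'rV[R]_N) x u j :
  differentiable F x -> ('D_u F x) 0 j = 'D_u (fun y => F y 0 j) x.
Proof. by move=> df; rewrite derive_mx ?mxE //; exact: diff_derivable. Qed.

(* The increment is telescoped along the coordinate directions and the mean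
   value theorem is applied to each step. *)
Lemma C1_differentiable m (U : set 'rV[R]_m) (f : 'rV[R]_m -> R) :
  open U -> Ck 1 U f -> forall x, U x -> differentiable f x.
Proof.
move=> oU [_ der con] x Ux.
pose L (h : 'rV[R]_m) : R := \sum_i h 0 i * 'D_(vbasis i) f x.
have Llin : linear L.
  move=> k a b; rewrite /L scaler_sumr -big_split /=; apply: eq_bigr => i _.
  by rewrite !mxE mulrDl -mulrA.
pose Lm := GRing.isLinear.Build _ _ _ _ _ Llin.
pose Ll : {linear 'rV[R]_m -> R} := HB.pack L Lm.
have Lc : continuous L.
  move=> y; apply: differentiable_continuous; rewrite /L.
  have -> : (fun h : 'rV[R]_m => \sum_i h 0 i * 'D_(vbasis i) f x) =
    \sum_(i < m) ('D_(vbasis i) f x *: (fun h : 'rV[R]_m => h 0 i : R)).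
    apply/funext => h; rewrite fct_sumE; apply: eq_bigr => i _.
    by rewrite mulrC.
  apply: differentiable_sum => i; apply: differentiableZ.
  exact: differentiable_coord.
have key (e : {posnum R}) : \forall h \near (0 : 'rV[R]_m),
    `|f (h + x) - (f x + L h)| <= e%:num * `|h|.
  (* Each of the [m] coordinate steps will cost [e' * |h|]; dividing by [m + 1] also covers
     dimension 0. *)
  pose e' := e%:num / m.+1%:R.
  have e'0 : 0 < e' by rewrite divr_gt0.
  have [d /= d0 Hd] : exists2 d : R, 0 < d & forall y, `|y - x| < d ->
      U y /\ forall i, `|'D_(vbasis i) f y - 'D_(vbasis i) f x| <= e'.
    have : \forall y \near x, U y /\
        forall i, `|'D_(vbasis i) f y - 'D_(vbasis i) f x| <= e'.
      near=> y; split; first by near: y; exact: open_nbhs_nbhs.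
      near: y; apply: filter_forall => i.
      have /cvgrPdist_le /(_ _ e'0) := con i x Ux.
      by apply: filterS => y; rewrite distrC.
    move=> /nbhs_ballP [d /= d0 H]; exists d => // y yd.
    by apply: H; rewrite -ball_normE /= distrC.
  near=> h.
  have hd : `|h| < d.
    near: h; apply/nbhs_ballP; exists d => //= y.
    by rewrite -ball_normE /= sub0r normrN.
  pose tr (k : nat) : 'rV[R]_m := \row_i (if (i < k)%N then h 0 i else 0).
  have trS (k : 'I_m) : tr k.+1 = tr k + h 0 k *: vbasis k.
    apply/rowP => i; rewrite !mxE eqxx /= ltnS leq_eqVlt.
    have [->|ik] := eqVneq i k; first by rewrite eqxx ltnn /= mulr1 add0r.
    by rewrite (inj_eq val_inj) (negbTE ik) /= mulr0 addr0.
  have step (k : 'I_m) :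
     `|f (x + tr k.+1) - f (x + tr k) - h 0 k * 'D_(vbasis k) f x| <= e' * `|h|.
    (* With the sup norm, the whole broken path stays within distance [|h|] of [x]. *)
    have small (s : R) : `|s| <= `|h 0 k| -> `|x + tr k + s *: vbasis k - x| < d.
      move=> sle; rewrite [x + _]addrC addrAC addrK.
      apply: le_lt_trans hd; apply: norm_le_coord => // i.
      rewrite !mxE eqxx /=.
      have [->|ik] := eqVneq i k.
        by rewrite ltnn add0r mulr1 (le_trans sle) // ler_coord_norm.
      rewrite mulr0 addr0; case: ifP => _; first exact: ler_coord_norm.
      by rewrite normr0.
    pose g (s : R) := f (x + tr k + s *: vbasis k).
    have dg (s : R) : `|s| <= `|h 0 k| ->
        is_derive s 1 g ('D_(vbasis k) f (x + tr k + s *: vbasis k)).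
      move=> sle; apply: is_derive_line; apply: der.
      by have [] := Hd _ (small _ sle).
    have gc (a b : R) : (forall s, s \in `[a, b]%R -> `|s| <= `|h 0 k|) ->
        {within `[a, b], continuous g}.
      move=> ab; apply: derivable_within_continuous => s /ab /dg.
      by case.
    have [c cle ->] : exists2 c, `|c| <= `|h 0 k| &
        f (x + tr k.+1) - f (x + tr k) =
          'D_(vbasis k) f (x + tr k + c *: vbasis k) * h 0 k.
      rewrite trS addrA.
      have -> : f (x + tr k) = g 0 by rewrite /g scale0r addr0.
      rewrite -[f _]/(g (h 0 k)).
      have [h0|h0] := leP 0 (h 0 k).
        have ab s : s \in `[0, h 0 k]%R -> `|s| <= `|h 0 k|.
          by rewrite in_itv /= => /andP[s0 s1]; rewrite !ger0_norm.
        have [|c /ab cle ->] := @MVT_segment _ g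
           (fun s => 'D_(vbasis k) f (x + tr k + s *: vbasis k)) 0 (h 0 k) h0 _ (gc _ _ ab).
          by move=> s; rewrite in_itv /= => /andP[/ltW s0 /ltW s1]; apply: dg;
             apply: ab; rewrite in_itv /= s0.
        by exists c => //; rewrite subr0.
      have h0' := ltW h0.
      have ab s : s \in `[h 0 k, 0]%R -> `|s| <= `|h 0 k|.
        by rewrite in_itv /= => /andP[s0 s1]; rewrite !ler0_norm // lerN2.
      have [|c /ab cle E] := @MVT_segment _ g
         (fun s => 'D_(vbasis k) f (x + tr k + s *: vbasis k)) (h 0 k) 0 h0' _ (gc _ _ ab).
        by move=> s; rewrite in_itv /= => /andP[/ltW s0 /ltW s1]; apply: dg;
           apply: ab; rewrite in_itv /= s0.
      by exists c => //; rewrite -opprB E sub0r mulrN opprK.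
    rewrite [h 0 k * _]mulrC -mulrBl normrM ler_pM //; last exact: ler_coord_norm.
    by have [_ /(_ k)] := Hd _ (small _ cle).
  have trm : tr m = h by apply/rowP => i; rewrite mxE ltn_ord.
  have tr0 : tr 0%N = 0 by apply/rowP => i; rewrite !mxE.
  have tele : f (h + x) - f x = \sum_(k < m) (f (x + tr k.+1) - f (x + tr k)).
    rewrite -(big_mkord xpredT (fun k => f (x + tr k.+1) - f (x + tr k))).
    by rewrite telescope_sumr // trm tr0 addr0 [x + h]addrC.
  rewrite opprD addrA tele.
  rewrite /L -sumrB (le_trans (ler_norm_sum _ _ _)) //.
  apply: le_trans (ler_sum _ (fun k _ => step k)) _.
  rewrite sumr_const card_ord -mulr_natr mulrAC ler_wpM2r //.
  by rewrite /e' mulrAC ler_pdivrMr // ler_pM2l // ler_nat.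
have H : 'd f x = Ll :> (_ -> _).
  apply: diff_unique => //; apply/eqaddoP => _/posnumP[e]; exact: key.
apply/diff_locallyP; rewrite H; split => //.
apply/eqaddoP => _/posnumP[e]; exact: key.
Unshelve. all: by end_near. Qed.

End FirstOrder.

(** * Closure properties of the classes C^k *)

Section CkCalculus.
Context {R : realType} {m : nat}.
Implicit Types (U : set 'rV[R]_m) (f g : 'rV[R]_m -> R).

Lemma Ck_continuous k (W : normedModType R) U (f : 'rV[R]_m -> W) x :
  Ck k U f -> U x -> {for x, continuous f}.
Proof. by case: k => [h|k [h _ _]] Ux; exact: h. Qed.

Lemma CkW k (W : normedModType R) U (f : 'rV[R]_m -> W) : Ck k.+1 U f -> Ck k U f.
Proof.
elim: k f => [|k IH] f [cf df Df] //.
by split=> // i; apply: IH.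
Qed.

Lemma Ck_leq k l (W : normedModType R) U (f : 'rV[R]_m -> W) :
  (k <= l)%N -> Ck l U f -> Ck k U f.
Proof.
move=> /subnK <-; elim: (l - k)%N => [//|j IH] h.
by apply: IH; exact: CkW.
Qed.

Lemma Ck_sub k (W : normedModType R) (U V : set 'rV[R]_m) (f : 'rV[R]_m -> W) :
  V `<=` U -> Ck k U f -> Ck k V f.
Proof.
move=> VU; elim: k f => [|k IH] f; first by move=> h x /VU /h.
by case=> a b c; split=> [x /VU Ux|i x /VU Ux|i]; [exact (a x Ux)|exact (b i x Ux)|exact (IH _ (c i))].
Qed.

Lemma open_near_eq (T : topologicalType) (W : Type) (U : set T) (f g : T -> W) x :
  open U -> U x -> (forall y, U y -> f y = g y) -> \near x, f x = g x.
Proof.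
move=> oU Ux h; near=> y; apply: h; near: y; exact: open_nbhs_nbhs.
Unshelve. all: by end_near. Qed.

(** Derivatives at a point of an open set see only nearby values. This is what allows formulas valid
    on [U] alone to replace total functions with arbitrary values elsewhere. *)
Lemma Ck_ext k (W : normedModType R) U (f g : 'rV[R]_m -> W) :
  open U -> (forall x, U x -> f x = g x) -> Ck k U f -> Ck k U g.
Proof.
move=> oU; have cont (a b : 'rV[R]_m -> W) : (forall x, U x -> a x = b x) ->
    (forall x, U x -> {for x, continuous a}) -> forall x, U x -> {for x, continuous b}.
  move=> ab h x Ux; have := h x Ux; rewrite /prop_for /continuous_at -(ab x Ux) => H.
  have nab := open_near_eq oU Ux ab.
  exact: cvg_trans (near_eq_cvg nab) H.
elim: k f g => [|k IH] f g fg /=; first exact: cont.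
case=> a b c; split; first exact: cont fg a.
  move=> i x Ux; apply: near_eq_derivable (b i x Ux).
  exact: open_near_eq oU Ux fg.
move=> i; apply: IH (c i) => x Ux.
by apply: near_eq_derive; exact: open_near_eq oU Ux fg.
Qed.

Lemma Ck_differentiable k U f x :
  open U -> Ck k.+1 U f -> U x -> differentiable f x.
Proof.
move=> oU h Ux; apply: (C1_differentiable oU _ Ux).
exact: Ck_leq h.
Qed.

(** The induction step shared by the closure properties below: exhibit the partial derivatives on
    [U] and show that the formulas have one order of regularity less. *)
Lemma CkS k U f (g : 'I_m -> 'rV[R]_m -> R) :
  open U -> (forall x, U x -> differentiable f x) ->
  (forall i x, U x -> 'D_(vbasis i) f x = g i x) ->
  (forall i, Ck k U (g i)) -> Ck k.+1 U f.
Proof.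
move=> oU df Dfg Cg; split=> [x Ux|i x Ux|i].
- exact/differentiable_continuous/df.
- exact/diff_derivable/df.
- by apply: Ck_ext (Cg i) => // x Ux; rewrite Dfg.
Qed.

Lemma Ck_cst k (W : normedModType R) U (a : W) : Ck k U (cst a).
Proof.
elim: k a => [|k IH] a; first by move=> x _; apply: differentiable_continuous.
split=> [x _|i x _|i]; first by apply: differentiable_continuous.
  exact: derivable_cst.
have -> : 'D_(vbasis i) (cst a) = (cst (0 : W) : 'rV[R]_m -> W).
  by apply/funext => x; exact: derive_cst.
exact: IH.
Qed.

Arguments Ck_cst k {W} U a.

Lemma CkD k U f g : open U -> Ck k U f -> Ck k U g -> Ck k U (fun x => f x + g x).
Proof.
move=> oU; elim: k f g => [|k IH] f g Cf Cg.
  by move=> x Ux; apply: continuousD; [exact: Cf|exact: Cg].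
have df x Ux := Ck_differentiable (x:=x) oU Cf Ux.
have dg x Ux := Ck_differentiable (x:=x) oU Cg Ux.
apply: (@CkS _ _ _ (fun i x => 'D_(vbasis i) f x + 'D_(vbasis i) g x)) => //.
- by move=> x Ux; exact: differentiableD (df x Ux) (dg x Ux).
- by move=> i x Ux; rewrite (deriveD (diff_derivable (df x Ux)) (diff_derivable (dg x Ux))).
- by move=> i; case: Cf => _ _ Cf; case: Cg => _ _ Cg; exact (IH _ _ (Cf i) (Cg i)).
Qed.

Lemma CkM k U f g : open U -> Ck k U f -> Ck k U g -> Ck k U (fun x => f x * g x).
Proof.
move=> oU; elim: k f g => [|k IH] f g Cf Cg.
  by move=> x Ux; apply: continuousM; [exact: Cf|exact: Cg].
have df x Ux := Ck_differentiable (x:=x) oU Cf Ux.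
have dg x Ux := Ck_differentiable (x:=x) oU Cg Ux.
apply: (@CkS _ _ _ (fun i x => f x * 'D_(vbasis i) g x + g x * 'D_(vbasis i) f x)) => //.
- by move=> x Ux; exact: differentiableM (df x Ux) (dg x Ux).
- by move=> i x Ux; rewrite (deriveM (diff_derivable (df x Ux)) (diff_derivable (dg x Ux))).
- move=> i; have Cf' := CkW Cf; have Cg' := CkW Cg.
  by case: Cf => _ _ Cf; case: Cg => _ _ Cg; exact (CkD oU (IH _ _ Cf' (Cg i)) (IH _ _ Cg' (Cf i))).
Qed.

Lemma CkZ k U (a : R) f : open U -> Ck k U f -> Ck k U (fun x => a * f x).
Proof. by move=> oU Cf; apply: CkM => //; exact: Ck_cst. Qed.

Lemma CkN k U f : open U -> Ck k U f -> Ck k U (fun x => - f x).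
Proof.
by move=> oU Cf; refine (Ck_ext oU _ (CkZ (-1) oU Cf)) => x _; rewrite mulN1r.
Qed.

Lemma CkB k U f g : open U -> Ck k U f -> Ck k U g -> Ck k U (fun x => f x - g x).
Proof. by move=> oU Cf Cg; apply: CkD => //; exact: CkN. Qed.

Lemma Ck_sum (I : finType) k U (F : I -> 'rV[R]_m -> R) : open U ->
  (forall i, Ck k U (F i)) -> Ck k U (fun x => \sum_i F i x).
Proof.
move=> oU h; elim: (index_enum I) => [|i r IH].
  by refine (Ck_ext oU _ (Ck_cst k U 0)) => x _; rewrite big_nil.
by refine (Ck_ext oU _ (CkD oU (h i) IH)) => x _; rewrite big_cons.
Qed.

Lemma CkV k U f : open U -> (forall x, U x -> f x != 0) ->
  Ck k U f -> Ck k U (fun x => (f x)^-1).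
Proof.
move=> oU f0; elim: k => [|k IH] Cf.
  by move=> x Ux; apply: (continuousV (f0 x Ux)); exact: Cf.
have df x Ux := Ck_differentiable (x:=x) oU Cf Ux.
apply: (@CkS _ _ _ (fun i x => - (((f x)^-1 * (f x)^-1) * 'D_(vbasis i) f x))) => //.
- by move=> x Ux; exact: differentiableV (df x Ux) (f0 x Ux).
- move=> i x Ux; rewrite (deriveV (f0 x Ux) (diff_derivable (df x Ux))).
  by rewrite /GRing.scale /= mulNr -expr2 exprVn.
- move=> i; have Ci := IH (CkW Cf); case: Cf => _ _ Cf.
  exact (CkN oU (CkM oU (CkM oU Ci Ci) (Cf i))).
Qed.

Lemma Ck_expR k U f : open U -> Ck k U f -> Ck k U (fun x => expR (f x)).
Proof.
move=> oU; elim: k => [|k IH] Cf.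
  by move=> x Ux; apply: continuous_comp (Cf x Ux) _; exact: continuous_expR.
have df x Ux := Ck_differentiable (x:=x) oU Cf Ux.
have dexp (y : R) : differentiable (expR : R -> R) y by apply/derivable1_diffP; exact: derivable_expR.
apply: (@CkS _ _ _ (fun i x => 'D_(vbasis i) f x * expR (f x))) => //.
- by move=> x Ux; exact: differentiable_comp (df x Ux) (dexp _).
- move=> i x Ux; rewrite deriveE; last exact: differentiable_comp (df x Ux) (dexp _).
  rewrite (diff_comp (df x Ux) (dexp _)) /= -(deriveE _ (df x Ux)).
  have de : 'd (expR : R -> R) (f x) 1 = expR (f x).
    rewrite -(deriveE (1 : R) (dexp (f x))).
    by have [_ ->] := is_derive_expR (f x).
  by rewrite -[X in 'd _ _ X]mulr1 [LHS]linearZ /= de.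
- by move=> i; have Ci := IH (CkW Cf); case: Cf => _ _ Cf; exact (CkM oU (Cf i) Ci).
Qed.

Lemma Ck_coord k U i : open U -> Ck k U (fun x => x 0 i).
Proof.
move=> oU; case: k => [|k]; first by move=> x Ux; exact: coord_continuous.
apply: (@CkS _ _ _ (fun j _ => (vbasis j : 'rV[R]_m) 0 i)) => //.
- by move=> x _; exact: differentiable_coord.
- move=> j x _; rewrite -(derive_row (F := id)) ?derive_id //.
- by move=> j; exact: Ck_cst.
Qed.



End CkCalculus.

Section CkComposition.
Context {R : realType}.

Lemma Ck_rowP k m N (U : set 'rV[R]_m) (F : 'rV[R]_m -> 'rV[R]_N) : open U ->
  Ck k U F <-> forall j, Ck k U (fun x => F x 0 j).
Proof.
move=> oU; elim: k F => [|k IH] F.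
  split=> h; first by move=> j x Ux; exact (continuous_comp (h x Ux) (@coord_continuous R 1 N 0 j (F x))).
  move=> x Ux; apply/(@cvgrPdist_le R 'rV[R]_N _ (nbhs x) _ F (F x)) => e e0.
  near=> y.
  apply: norm_le_coord; first exact: ltW.
  move=> j; rewrite !mxE; move: j; near: y; apply: filter_forall => j.
  have /cvgrPdist_le /(_ e e0) := h j x Ux; exact.
split=> h.
  case: h => a b c j; split.
  - by move=> x Ux; exact (continuous_comp (a x Ux) (@coord_continuous R 1 N 0 j (F x))).
  - by move=> i x Ux; have /derivable_mxP := b i x Ux; apply.
  - move=> i; have /IH/(_ j) Cj := c i; refine (Ck_ext oU _ Cj) => x Ux.
    by rewrite derive_mx ?mxE //; apply: b.
have d i x : U x -> derivable F x (vbasis i).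
  move=> Ux; apply/derivable_mxP => j l; rewrite ord1.
  by case: (h l) => _ + _; apply.
split=> // [x Ux|i].
  have Fd : differentiable F x.
    by apply/differentiable_rowP => j; exact: Ck_differentiable (h j) Ux.
  exact: differentiable_continuous.
apply/IH => j; case: (h j) => _ _ /(_ i) Cj; refine (Ck_ext oU _ Cj) => x Ux.
by rewrite derive_mx ?mxE //; apply: d.
Unshelve. all: by end_near. Qed.

Lemma Ck_comp k m N (U : set 'rV[R]_m) (V : set 'rV[R]_N) (h : 'rV[R]_N -> R)
    (c : 'rV[R]_m -> 'rV[R]_N) :
  open U -> open V -> (forall x, U x -> V (c x)) -> Ck k U c -> Ck k V h ->
  Ck k U (h \o c).
Proof.
move=> oU oV UV; elim: k h => [|k IH] h Cc Ch.
  by move=> x Ux; exact (continuous_comp (Cc x Ux) (Ch _ (UV x Ux))).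
have dc x : U x -> differentiable c x.
  move=> Ux; apply/differentiable_rowP => j.
  by move/(Ck_rowP _ _ oU): Cc => /(_ j) Cj; exact: Ck_differentiable Cj Ux.
have dh x : U x -> differentiable h (c x).
  by move=> Ux; exact: Ck_differentiable oV Ch (UV x Ux).
apply: (@CkS _ _ _ _ _ (fun i x => \sum_j 'D_(vbasis i) (fun y => c y 0 j) x *
      ('D_(vbasis j) h \o c) x)) => //.
- by move=> x Ux; exact: differentiable_comp (dc x Ux) (dh x Ux).
- move=> i x Ux; rewrite (derive_comp _ (dc x Ux) (dh x Ux)) (derive_lin _ (dh x Ux)).
  by apply: eq_bigr => j _; rewrite (derive_row _ _ (dc x Ux)).
- move=> i; have Cc' := CkW Cc; case: Ch => _ _ Ch.
  move/(Ck_rowP _ _ oU): Cc => Cc; apply: (Ck_sum oU) => j.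
  by case: (Cc j) => _ _ Cj; exact (CkM oU (Cj i) (IH _ Cc' (Ch j))).
Qed.

Lemma Ck_comp_row k m N M (U : set 'rV[R]_m) (V : set 'rV[R]_N) (h : 'rV[R]_N -> 'rV[R]_M)
    (c : 'rV[R]_m -> 'rV[R]_N) :
  open U -> open V -> (forall x, U x -> V (c x)) -> Ck k U c -> Ck k V h ->
  Ck k U (h \o c).
Proof.
move=> oU oV UV Cc /(Ck_rowP _ _ oV) Ch; apply/Ck_rowP => // j.
exact: Ck_comp oU oV UV Cc (Ch j).
Qed.

Lemma Ck_row_differentiable k m N (U : set 'rV[R]_m) (F : 'rV[R]_m -> 'rV[R]_N) x :
  open U -> Ck k.+1 U F -> U x -> differentiable F x.
Proof.
move=> oU /(Ck_rowP _ _ oU) CF Ux; apply/differentiable_rowP => j.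
exact: Ck_differentiable (CF j) Ux.
Qed.

Lemma Ck_dotv k m N (U : set 'rV[R]_m) (F G : 'rV[R]_m -> 'rV[R]_N) : open U ->
  Ck k U F -> Ck k U G -> Ck k U (fun x => dotv (F x) (G x)).
Proof.
move=> oU /(Ck_rowP _ _ oU) CF /(Ck_rowP _ _ oU) CG.
by apply: (Ck_sum oU) => j; exact (CkM oU (CF j) (CG j)).
Qed.

Lemma Ck_id k m (U : set 'rV[R]_m) : open U -> Ck k U id.
Proof. by move=> oU; apply/Ck_rowP => // j; exact: Ck_coord. Qed.

Lemma Ck_scale k m N (U : set 'rV[R]_m) (a : 'rV[R]_m -> R) (F : 'rV[R]_m -> 'rV[R]_N) :
  open U -> Ck k U a -> Ck k U F -> Ck k U (fun x => a x *: F x).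
Proof.
move=> oU Ca /(Ck_rowP _ _ oU) CF; apply/Ck_rowP => // j.
by refine (Ck_ext oU _ (CkM oU Ca (CF j))) => x _; rewrite mxE.
Qed.

Lemma Ck_addv k m N (U : set 'rV[R]_m) (F G : 'rV[R]_m -> 'rV[R]_N) :
  open U -> Ck k U F -> Ck k U G -> Ck k U (fun x => F x + G x).
Proof.
move=> oU /(Ck_rowP _ _ oU) CF /(Ck_rowP _ _ oU) CG; apply/Ck_rowP => // j.
by refine (Ck_ext oU _ (CkD oU (CF j) (CG j))) => x _; rewrite mxE.
Qed.

Lemma Ck_mulmx k m N M (U : set 'rV[R]_m) (F : 'rV[R]_m -> 'rV[R]_N) (A : 'M[R]_(N, M)) :
  open U -> Ck k U F -> Ck k U (fun x => F x *m A).
Proof.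
move=> oU /(Ck_rowP _ _ oU) CF; apply/Ck_rowP => // j.
have := Ck_sum oU (fun l => CkM oU (CF l) (@Ck_cst _ _ k R U (A l j))).
by move=> h; refine (Ck_ext oU _ h) => x _; rewrite mxE.
Qed.

End CkComposition.

(** * Second derivatives: symmetry and the test at a maximum *)

Section SecondOrder.
Context {R : realType} {m : nat}.
Implicit Types (U : set 'rV[R]_m) (f : 'rV[R]_m -> R).

Lemma mvt_line f x u (s : R) : 0 < s ->
  (forall a, 0 <= a <= s -> derivable f (x + a *: u) u) ->
  exists2 a, 0 < a < s & f (x + s *: u) - f x = s * 'D_u f (x + a *: u).
Proof.
move=> s0 df.
have dg a : 0 <= a <= s ->
    is_derive a 1 (fun b : R => f (x + b *: u)) ('D_u f (x + a *: u)).
  by move=> /df; exact: is_derive_line.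
have [||a a0s] := @MVT R (fun b => f (x + b *: u)) (fun a => 'D_u f (x + a *: u)) 0 s s0.
- move=> a; rewrite in_itv /= => /andP[/ltW a0 /ltW a1].
  by apply: dg; rewrite a0 a1.
- apply: derivable_within_continuous => a; rewrite in_itv /= => /dg.
  by case.
rewrite scale0r addr0 subr0 mulrC => ->; exists a => //.
Qed.

Lemma derivable_shiftv f w y u : derivable f (y + w) u ->
  derivable (fun z => f (z + w)) y u /\ 'D_u (fun z => f (z + w)) y = 'D_u f (y + w).
Proof.
move=> df.
have e : (fun h : R => h^-1 *: (((fun z => f (z + w)) \o shift y) (h *: u) - f (y + w)))
  = (fun h : R => h^-1 *: ((f \o shift (y + w)) (h *: u) - f (y + w))).
  by apply/funext => h /=; rewrite addrA.
by split; rewrite ?/derivable ?/derive e.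
Qed.

(** The mean value theorem is used twice: along [u] for the increment of [f] by [s *: v], then along
    [v] for ['D_u f]. The left side is symmetric in [u] and [v], the right side is not. *)
Lemma second_difference f x u v (s : R) : 0 < s ->
  (forall a b, 0 <= a <= s -> 0 <= b <= s ->
     derivable f (x + a *: u + b *: v) u /\
     derivable ('D_u f) (x + a *: u + b *: v) v) ->
  exists a b, [/\ 0 <= a <= s, 0 <= b <= s &
    f (x + s *: u + s *: v) - f (x + s *: u) - f (x + s *: v) + f x =
    s ^+ 2 * 'D_v ('D_u f) (x + a *: u + b *: v)].
Proof.
move=> s0 H.
have s00 : 0 <= s <= s by rewrite lexx ltW.
have z00 : 0 <= (0 : R) <= s by rewrite lexx ltW.
pose F y := f (y + s *: v) - f y.
have D1 a : 0 <= a <= s -> derivable (fun z => f (z + s *: v)) (x + a *: u) u /\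
   'D_u (fun z => f (z + s *: v)) (x + a *: u) = 'D_u f (x + a *: u + s *: v).
  by move=> as0; case: (H a s as0 s00) => d _; exact (derivable_shiftv d).
have D2 a : 0 <= a <= s -> derivable f (x + a *: u) u.
  by move=> as0; case: (H a 0 as0 z00); rewrite scale0r addr0.
have [a ha|a ha Ha] := @mvt_line F x u s s0.
  have [d1 _] := D1 a ha; exact (derivableB d1 (D2 a ha)).
have ha' : 0 <= a <= s by case/andP: ha => /ltW -> /ltW ->.
have [b hb|b hb Hb] := @mvt_line ('D_u f) (x + a *: u) v s s0.
  by case: (H a b ha' hb).
have hb' : 0 <= b <= s by case/andP: hb => /ltW -> /ltW ->.
exists a, b; split => //.
rewrite expr2 -mulrA -Hb.
have [d1 E1] := D1 a ha'.
have := deriveB d1 (D2 a ha'); rewrite -[X in derive X]/F E1 => <-.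
by rewrite -Ha /F; ring.
Qed.

Lemma Ck_derive k U f u : open U -> Ck k.+1 U f -> Ck k U ('D_u f).
Proof.
move=> oU Cf.
have : Ck k U (fun x => \sum_i u 0 i * 'D_(vbasis i) f x).
  case: (Cf) => _ _ Cf'.
  by apply: (Ck_sum oU) => i; exact (CkZ (u 0 i) oU (Cf' i)).
move=> C; refine (Ck_ext oU _ C) => x Ux.
by rewrite [RHS](derive_lin u (Ck_differentiable oU Cf Ux)).
Qed.

Lemma nbhs_box U x u v : open U -> U x ->
  exists2 s0 : R, 0 < s0 & forall a b, 0 <= a <= s0 -> 0 <= b <= s0 ->
    U (x + a *: u + b *: v).
Proof.
move=> oU Ux; have /nbhs_ballP [d /= d0 Hd] : nbhs x U by exact: open_nbhs_nbhs.
pose c : R := `|u| + `|v| + 1.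
have c0 : 0 < c by rewrite /c ltr_wpDl ?addr_ge0.
exists (d / (c + 1)) => [|a b /andP[a0 a1] /andP[b0 b1]].
  by rewrite divr_gt0 // addr_gt0.
apply: Hd; rewrite -ball_normE /= opprD opprD addrA addrA subrr sub0r -opprD normrN.
apply: le_lt_trans (ler_normD _ _) _; rewrite !normrZ !ger0_norm //.
apply: le_lt_trans (_ : d / (c + 1) * (`|u| + `|v|) < d).
  by rewrite mulrDr lerD // ler_wpM2r.
rewrite -mulrA gtr_pMr // mulrC ltr_pdivrMr; last exact: addr_gt0.
by rewrite mul1r /c -addrA ltrDl addr_gt0.
Qed.

Lemma ler_dist_half (e p q r : R) : `|p - r| < e / 2 -> `|q - r| < e / 2 -> p <= e + q.
Proof. by rewrite !ltr_norml => /andP[_ h1] /andP[h2 _]; lra. Qed.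

(** Both iterated derivatives, taken at points near [x], equal the same second difference divided by
    [t ^+ 2]; continuity brings the points back to [x]. As the directions are arbitrary, one
    inequality suffices. *)
Lemma derive_sym U f x u v : open U -> Ck 2 U f -> U x ->
  'D_v ('D_u f) x = 'D_u ('D_v f) x.
Proof.
move=> oU Cf Ux.
have Cuv w z : Ck 0 U ('D_w ('D_z f)) by apply: Ck_derive => //; exact: Ck_derive.
have dd z y : U y -> derivable f y z.
  by move=> Uy; apply: diff_derivable; exact: Ck_differentiable oU Cf Uy.
have ddd w z y : U y -> derivable ('D_z f) y w.
  move=> Uy; apply: diff_derivable.
  exact: Ck_differentiable oU (Ck_derive z oU Cf) Uy.
apply/eqP; rewrite eq_le; apply/andP.
suff main w z : 'D_w ('D_z f) x <= 'D_z ('D_w f) x by split; exact: main.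
apply/ler_addgt0Pl => e e0.
pose V := [set y | U y /\ (`|'D_w ('D_z f) x - 'D_w ('D_z f) y| < e / 2 /\
  `|'D_z ('D_w f) x - 'D_z ('D_w f) y| < e / 2)].
have e2 : 0 < e / 2 by rewrite divr_gt0.
have Nc w' z' : nbhs x [set y | `|'D_w' ('D_z' f) x - 'D_w' ('D_z' f) y| < e / 2].
  by have /(@cvgrPdist_lt _ _ _ (nbhs x)) := Cuv w' z' x Ux; apply.
have Vx : nbhs x V.
  apply: filterI; first exact: open_nbhs_nbhs.
  exact (filterI (Nc w z) (Nc z w)).
have Vx' : V^° x by [].
have [s s0 Hs] := nbhs_box z w (@open_interior _ V) Vx'.
have [s' s'0 Hs'] := nbhs_box w z (@open_interior _ V) Vx'.
pose t := Num.min s s'.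
have t0 : 0 < t by rewrite lt_min s0.
have [ts ts'] : t <= s /\ t <= s' by split; rewrite ge_min lexx ?orbT.
have H1 a b : 0 <= a <= t -> 0 <= b <= t -> V (x + a *: z + b *: w).
  move=> /andP[a0 a1] /andP[b0 b1]; apply: interior_subset; apply: Hs.
    by rewrite a0 (le_trans a1).
  by rewrite b0 (le_trans b1).
have H2 a b : 0 <= a <= t -> 0 <= b <= t -> V (x + a *: w + b *: z).
  move=> /andP[a0 a1] /andP[b0 b1]; apply: interior_subset; apply: Hs'.
    by rewrite a0 (le_trans a1).
  by rewrite b0 (le_trans b1).
have [a b ha hb|a [b [ha hb E1]]] := @second_difference f x z w t t0.
  by have [Uy _] := H1 a b ha hb; split; [exact: dd|exact: ddd].
have [a' b' ha' hb'|a' [b' [ha' hb' E2]]] := @second_difference f x w z t t0.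
  by have [Uy _] := H2 a' b' ha' hb'; split; [exact: dd|exact: ddd].
have [_ [V1 _]] := H1 a b ha hb; have [_ [_ V2]] := H2 a' b' ha' hb'.
have E : 'D_w ('D_z f) (x + a *: z + b *: w) = 'D_z ('D_w f) (x + a' *: w + b' *: z).
  apply: (@mulfI _ (t ^+ 2)); first by rewrite expf_neq0 // gt_eqF.
  by apply: etrans (esym E1) (etrans _ E2); rewrite [x + t *: w + t *: z]addrAC; congr (_ + _); exact: addrAC.
exact (ler_dist_half (eq_ind _ (fun r => `|_ - r| < e / 2) V1 _ E) V2).
Unshelve. all: by end_near. Qed.

(** A positive derivative at [x] would stay positive on a short segment starting at [x], and the
    mean value theorem would produce a larger value. Applying the first-order part to [- z] gives
    equality; the second-order part is the same argument for ['D_u f], which vanishes at [x]. *)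
Lemma local_max_test U f x u : open U -> Ck 2 U f -> U x ->
  (forall y, U y -> f y <= f x) -> 'D_u f x = 0 /\ 'D_u ('D_u f) x <= 0.
Proof.
move=> oU Cf Ux mx.
have d1 z y : U y -> derivable f y z.
  by move=> Uy; apply: diff_derivable; exact: Ck_differentiable oU Cf Uy.
have d2 w z y : U y -> derivable ('D_z f) y w.
  move=> Uy; apply: diff_derivable.
  exact: Ck_differentiable oU (Ck_derive z oU Cf) Uy.
have C1 z : Ck 0 U ('D_z f) by apply: CkW; exact: Ck_derive.
have C2 w z : Ck 0 U ('D_w ('D_z f)) by apply: Ck_derive => //; exact: Ck_derive.
have segment V z : open V -> V x -> exists2 s : R, 0 < s & forall a, 0 <= a <= s -> V (x + a *: z).
  move=> oV Vx; have [s s0 H] := nbhs_box z 0 oV Vx; exists s => // a ha.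
  by have := H a 0 ha; rewrite scaler0 addr0; apply; rewrite lexx ltW.
have pos (g : 'rV[R]_m -> R) z : Ck 0 U g -> 0 < g x -> exists2 s : R, 0 < s &
    forall a, 0 <= a <= s -> U (x + a *: z) /\ 0 < g (x + a *: z).
  move=> Cg gx; pose V := [set y | U y /\ 0 < g y].
  have Vx : nbhs x V.
    near=> y; split; first by near: y; exact: open_nbhs_nbhs.
    have : `|g x - g y| < g x.
      by near: y; have /(@cvgrPdist_lt _ _ _ (nbhs x)) := Cg x Ux; apply.
    by rewrite ltr_norml => /andP[_]; lra.
  have Vx' : V^° x by [].
  have [s s0 H] := segment _ z (@open_interior _ V) Vx'.
  by exists s => // a /H; exact: interior_subset.
have le0 z : 'D_z f x <= 0.
  rewrite leNgt; apply/negP => gt0.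
  have [s s0 H] := pos _ z (C1 z) gt0.
  have [a /H[Uy _]|a /andP[/ltW a0 /ltW a1] E] := @mvt_line f x z s s0; first exact: d1 Uy.
  have ha : 0 <= a <= s by rewrite a0.
  have [_ g0] := H a ha.
  have ss : 0 <= s <= s by rewrite lexx ltW.
  have [/mx le _] := H s ss; move: le; rewrite -subr_le0 E.
  by rewrite (pmulr_rle0 _ s0) leNgt g0.
have D0 z : 'D_z f x = 0.
  apply/eqP; rewrite eq_le le0 /=; have := le0 (- z).
  have df := Ck_differentiable oU Cf Ux.
  by rewrite !(deriveE _ df) linearN oppr_le0.
split; first exact: D0.
rewrite leNgt; apply/negP => gt0.
have [s s0 H] := pos _ u (C2 u u) gt0.
have [a /H[Uy _]|a /andP[a0 a1] E] := @mvt_line f x u s s0; first exact: d1 Uy.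
have H' b : 0 <= b <= a -> U (x + b *: u).
  move=> /andP[b0 b1]; have hb : 0 <= b <= s by rewrite b0 (le_trans b1) // ltW.
  by have [] := H b hb.
have [b /H' Uy|b /andP[/ltW b0 /ltW b1] E'] := @mvt_line ('D_u f) x u a a0; first exact: d2 Uy.
have hb : 0 <= b <= s by rewrite b0 (le_trans b1) // ltW.
have [_ g0] := H b hb.
have ss : 0 <= s <= s by rewrite lexx ltW.
have [/mx le _] := H s ss; move: le; rewrite -subr_le0 E (pmulr_rle0 _ s0).
have -> : 'D_u f (x + a *: u) = 'D_u f (x + a *: u) - 'D_u f x.
  by rewrite (D0 u) subr0.
by rewrite E' (pmulr_rle0 _ a0) leNgt g0.
Unshelve. all: by end_near. Qed.

End SecondOrder.

(** * The elliptic data near (1/2, ..., 1/2) *)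

Section Ellipticity.
Context {R : realType} {n : nat} (f : 'rV[R]_n -> R) (Gam : set 'rV[R]_n).
Hypothesis ed : elliptic_data f Gam.
Implicit Types x y : 'rV[R]_n.

Lemma cone_add x y : Gam x -> Gam y -> Gam (x + y).
Proof.
move=> Gx Gy.
have h0 : 0 <= 2^-1 :> R by lra.
have h1 : 2^-1 <= 1 :> R by lra.
have := ed_cone_convex ed (x := x) (y := y) (Itv01 h0 h1).
rewrite !inE => /(_ Gx Gy); rewrite /conv /= => G.
have := ed_cone_scale ed (t := 2) (ltr0n _ 2) G.
rewrite scalerDr !scalerA divff ?pnatr_eq0 // scale1r.
have -> : 2 * (1 - 2^-1) = 1 :> R by lra.
by rewrite scale1r.
Qed.

(** Some coordinates of [y - x] may vanish, so openness is used to subtract a small constant vector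
    from [x] first; the difference then lies in the positive cone, and [Gam] is closed under
    sums. *)
Lemma cone_le x y : Gam x -> (forall i, x 0 i <= y 0 i) -> Gam y.
Proof.
move=> Gx xy; have /nbhs_ballP [d /= d0 Hd] : nbhs x Gam.
  by apply: open_nbhs_nbhs; split => //; exact: ed_cone_open ed.
pose w : 'rV[R]_n := const_mx (d / 2).
have Gw : Gam (x - w).
  apply: Hd; rewrite -ball_normE /= opprB addrC subrK.
  apply: (@le_lt_trans _ _ (d / 2)); last by rewrite gtr_pMr // invf_lt1 ?ltr0n ?ltr1n.
  have d2 : 0 <= d / 2 by rewrite divr_ge0 // ltW.
  by apply: norm_le_coord => // i; rewrite mxE ger0_norm.
have -> : y = (x - w) + (y - x + w) by apply/rowP => i; rewrite !mxE; ring.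
apply: (cone_add Gw); apply: (ed_cone_lower ed) => i; rewrite !mxE.
by rewrite ltr_wpDl ?subr_ge0 // divr_gt0.
Qed.

Lemma elliptic_differentiable x : Gam x -> differentiable f x.
Proof. exact: C1_differentiable (ed_cone_open ed) (ed_C1 ed) x. Qed.

Lemma elliptic_mvt x y : Gam x -> Gam y ->
  exists2 a, 0 < a < 1 & f y - f x = 'D_(y - x) f (x + a *: (y - x)) /\
     Gam (x + a *: (y - x)).
Proof.
move=> Gx Gy; have seg a : 0 <= a <= 1 -> Gam (x + a *: (y - x)).
  move=> /andP[a0 a1].
  have -> : x + a *: (y - x) = a *: y + (1 - a) *: x.
    by apply/rowP => i; rewrite !mxE; ring.
  have := ed_cone_convex ed (x := y) (y := x) (Itv01 a0 a1).
  by rewrite !inE; apply.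
have [a as0|a /andP[a0 a1] E] := @mvt_line R n f x (y - x) 1 ltr01.
  exact: diff_derivable (elliptic_differentiable (seg a as0)).
exists a; rewrite ?a0 //; split; last by apply: seg; rewrite (ltW a0) (ltW a1).
by move: E; rewrite scale1r mul1r [x + (y - x)]addrC subrK.
Qed.

Lemma elliptic_mono x y : Gam x -> (forall i, x 0 i <= y 0 i) -> f x <= f y.
Proof.
move=> Gx xy; have Gy := cone_le Gx xy.
have [a _ [E G]] := elliptic_mvt Gx Gy; rewrite -subr_ge0 E.
rewrite derive_lin; last exact: elliptic_differentiable.
apply: sumr_ge0 => i _; apply: mulr_ge0; first by rewrite !mxE subr_ge0.
by have := ed_grad ed G i; rewrite mxE => /ltW.
Qed.

(** A diagonal point is fixed by the transposition of [i] and [j], so the chain rule for [f]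
    composed with it exchanges the two derivatives. *)
Lemma partials_const (c : R) i j : Gam (const_mx c) ->
  'D_(vbasis i) f (const_mx c) = 'D_(vbasis j) f (const_mx c).
Proof.
move=> Gc; pose P := col_perm (tperm i j) : 'rV[R]_n -> 'rV[R]_n.
have Pc k : (fun y => P y 0 k) = (fun y : 'rV[R]_n => y 0 (tperm i j k)).
  by apply/funext => y; rewrite mxE.
have dP : differentiable P (const_mx c).
  by apply/differentiable_rowP => k; rewrite Pc; exact: differentiable_coord.
have -> : 'D_(vbasis i) f (const_mx c) = 'D_(vbasis i) (f \o P) (const_mx c).
  apply: near_eq_derive; apply: (open_near_eq (U := Gam)) => //.
    exact: ed_cone_open ed.
  by move=> y Gy; rewrite /= (ed_sym ed).
have PC : P (const_mx c) = const_mx c by rewrite /P col_perm_const.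
have dfc : differentiable f (P (const_mx c)) by rewrite PC; exact: elliptic_differentiable.
rewrite (derive_comp _ dP dfc) PC.
congr ('D_ _ f _); apply/rowP => k; rewrite derive_row // Pc.
have -> : 'D_(vbasis i) (fun y : 'rV[R]_n => y 0 (tperm i j k)) (const_mx c) = vbasis i 0 (tperm i j k).
  by rewrite -(derive_row (F := id)) ?derive_id.
rewrite !mxE eqxx /=; congr (_%:R); congr (nat_of_bool _).
by rewrite (can2_eq (tpermK i j) (tpermK i j)) tpermL.
Qed.

Lemma elliptic_half : f (const_mx 2^-1) = 1.
Proof.
have -> : const_mx 2^-1 = 2^-1 *: const_mx 1 :> 'rV[R]_n.
  by apply/rowP => i; rewrite !mxE mulr1.
rewrite (ed_homogeneous ed) ?invr_gt0 ?ltr0n //.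
  by rewrite (ed_normalized ed) mulVf // pnatr_eq0.
by apply: (ed_cone_lower ed) => i; rewrite mxE.
Qed.

(** If no coordinate is raised, the hypothesis on the sum is used. Otherwise a raised coordinate
    contributes [- M' * e] and the others together at most [n * M * e]: the value of [M'] leaves
    exactly [- e]. *)
Lemma truncated_sum_le (M M' e : R) (mu : 'rV[R]_n) :
  0 <= M -> 0 < e -> M' = n%:R * M + 1 ->
  (forall i, mu 0 i <= 2^-1 + M * e) ->
  \sum_i mu 0 i <= n%:R / 2 - e ->
  \sum_i (Num.max (mu 0 i) (2^-1 - M' * e) - 2^-1) <= - e.
Proof.
move=> M0 e0 EM mule sumle.
have [/forallP all|] := boolP [forall i, 2^-1 - M' * e <= mu 0 i].
  rewrite sumrB (eq_bigr (fun i => mu 0 i)) => [|i _]; last exact/max_l/all.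
  rewrite sumr_const card_ord -mulr_natr; lra.
rewrite negb_forall => /existsP[i0]; rewrite -ltNge => hi0.
rewrite (bigD1 i0) //= (max_r (ltW hi0)).
apply: (@le_trans _ _ (- (M' * e) + n%:R * (M * e))); last by rewrite EM; nra.
apply: lerD; first by lra.
apply: (@le_trans _ _ (\sum_(i < n | i != i0) (M * e))).
  apply: ler_sum => i _; rewrite lerBlDl ge_max mule /= -subr_ge0.
  have n0 : 0 <= n%:R * M :> R by rewrite mulr_ge0.
  nra.
have Me : 0 <= M * e by rewrite mulr_ge0 // ltW.
rewrite mulr_natl -[X in _ <= _ *+ X](card_ord n) -sumr_const [leRHS](bigD1 i0) //=.
by rewrite lerDr.
Qed.

(* The eigenvalues far below 1/2 are raised to 1/2 - M' e, which keeps the sum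
   below n/2 - e; then f is estimated to first order at (1/2, ..., 1/2), where
   its partial derivatives all coincide. *)
Lemma elliptic_lt1 (M : R) : (0 < n)%N -> 0 <= M -> exists2 d : R, 0 < d &
  forall e mu, 0 < e <= d -> Gam mu -> (forall i, mu 0 i <= 2^-1 + M * e) ->
    \sum_i mu 0 i <= n%:R / 2 - e -> f mu < 1.
Proof.
move=> n0 M0; pose h : 'rV[R]_n := const_mx 2^-1.
have Gh : Gam h by apply: (ed_cone_lower ed) => i; rewrite mxE.
pose i0 := Ordinal n0; pose c := 'D_(vbasis i0) f h.
have c0 : 0 < c by have := ed_grad ed Gh i0; rewrite mxE.
pose M' := n%:R * M + 1.
have M'1 : 1 <= M' by rewrite /M' lerDr mulr_ge0.
have M'0 : 0 < M' by exact: lt_le_trans ltr01 M'1.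
have MM' : M <= M'.
  rewrite /M'; apply: (@le_trans _ _ (n%:R * M)); last by rewrite lerDl.
  by rewrite ler_peMl // ler1n.
(* The variation of the partial derivatives costs at most [n * eta * M' * e], that is [c * e / 2]:
   half of the gain [c * e] coming from the deficit of the sum. *)
pose eta := c / (2 * n%:R * M').
have nR : 0 < n%:R :> R by rewrite ltr0n.
have eta0 : 0 < eta by rewrite divr_gt0 // !mulr_gt0.
have [r /= r0 Hr] : exists2 r : R, 0 < r & forall y, `|y - h| < r ->
    Gam y /\ forall i, `|'D_(vbasis i) f y - c| <= eta.
  have : \forall y \near h, Gam y /\ forall i, `|'D_(vbasis i) f y - c| <= eta.
    have oG : open_nbhs h Gam by split => //; exact: ed_cone_open ed.
    near=> y; split; first by near: y; exact: open_nbhs_nbhs.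
    near: y; apply: filter_forall => i.
    have [_ _ Ci] := ed_C1 ed.
    have /(@cvgrPdist_le _ _ _ (nbhs h)) /(_ _ eta0) := Ci i h Gh.
    by apply: filterS => y; rewrite distrC (partials_const i i0 Gh).
  move=> /nbhs_ballP [r /= r0 H]; exists r => // y yr.
  by apply: H; rewrite -ball_normE /= distrC.
exists (r / 2 / M') => [|e mu /andP[e0 ed'] Gmu mule sumle]; first by rewrite !divr_gt0.
have Mer : M' * e <= r / 2 by rewrite mulrC -ler_pdivlMr.
pose nu : 'rV[R]_n := \row_i Num.max (mu 0 i) (2^-1 - M' * e).
have munu i : mu 0 i <= nu 0 i by rewrite mxE le_max lexx.
apply: le_lt_trans (elliptic_mono Gmu munu) _.
have Gnu := cone_le Gmu munu.
have nuh i : `|(nu - h) 0 i| <= M' * e.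
  have Me0 : 0 <= M' * e by rewrite mulr_ge0 // ltW.
  have MeM : M * e <= M' * e by rewrite ler_wpM2r // ltW.
  rewrite !mxE ler_distl le_max lexx orbT /= ge_max (le_trans (mule i)) ?lerD2l //=.
  by clear -Me0; move: (M' * e) Me0 => t t0; lra.
have [a /andP[a0 a1] [E _]] := elliptic_mvt Gh Gnu.
pose xi := h + a *: (nu - h).
have xir : `|xi - h| < r.
  rewrite /xi addrC addKr normrZ gtr0_norm //.
  apply: (@le_lt_trans _ _ (1 * (M' * e))).
    have Me0 : 0 <= M' * e by rewrite mulr_ge0 // ltW.
    by apply: ler_pM => //; [exact: ltW|exact: ltW|exact: norm_le_coord nuh].
  by rewrite mul1r (le_lt_trans Mer) // gtr_pMr // invf_lt1 ?ltr0n ?ltr1n.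
have [Gxi Hxi] := Hr xi xir.
rewrite -subr_lt0 -elliptic_half E derive_lin; last exact: elliptic_differentiable.
apply: (@le_lt_trans _ _ (\sum_i (c * (nu - h) 0 i + eta * (M' * e)))).
  apply: ler_sum => i _; rewrite -lerBlDl [c * _]mulrC -mulrBr.
  apply: le_trans (ler_norm _) _; rewrite normrM mulrC.
  by apply: ler_pM => //; exact: Hxi.
rewrite big_split /= -mulr_sumr sumr_const card_ord -mulr_natr.
have -> : eta * (M' * e) * n%:R = c * e / 2.
  by rewrite /eta; field; rewrite !gt_eqF.
have S : \sum_i (nu - h) 0 i <= - e.
  apply: le_trans (truncated_sum_le M0 e0 (erefl M') mule sumle).
  by apply: ler_sum => i _; rewrite !mxE.
apply: (@le_lt_trans _ _ (c * - e + c * e / 2)).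
  by rewrite lerD2r ler_pM2l.
have : 0 < c * e by rewrite mulr_gt0.
by rewrite mulrN; move: (c * e) => ce; lra.
Unshelve. all: by end_near. Qed.

End Ellipticity.

(** * The Schouten tensor of a conformally flat metric *)

Section DeltaSums.
Context {R : realType} {n : nat}.
Implicit Types (F p : 'I_n -> R).

Lemma sum_delta k F : \sum_i (i == k)%:R * F i = F k.
Proof.
rewrite (bigD1 k) //= eqxx mul1r big1 ?addr0 // => i /negbTE ->.
by rewrite mul0r.
Qed.

Lemma sum_delta_sym k F : \sum_i (k == i)%:R * F i = F k.
Proof. by rewrite -[RHS]sum_delta; apply: eq_bigr => i _; rewrite eq_sym. Qed.

(** The Christoffel symbols of exp(2 phi) |dx|^2 when [p] is the gradient of phi; below phi = - log
    v. Being linear in [p], the same expression also gives the derivatives of the symbols. *)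
Definition conf_gamma p (l i j : 'I_n) : R :=
  (l == j)%:R * p i + (l == i)%:R * p j - (i == j)%:R * p l.

Lemma conf_gamma_trace p i m : conf_gamma p i i m = p m.
Proof. by rewrite /conf_gamma eqxx mul1r addrAC subrr add0r. Qed.

Lemma sum_conf_gamma p j k :
  \sum_m p m * conf_gamma p m j k = 2 * (p j * p k) - (j == k)%:R * \sum_m p m ^+ 2.
Proof.
transitivity (\sum_m ((m == k)%:R * (p j * p m) + (m == j)%:R * (p k * p m)
   - (j == k)%:R * p m ^+ 2)).
  by apply: eq_bigr => m _; rewrite /conf_gamma; ring.
by rewrite sumrB big_split /= !sum_delta mulr_sumr; ring.
Qed.

Lemma sum_conf_gamma_sq p j k :
  \sum_i \sum_m conf_gamma p i j m * conf_gamma p m i k =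
  (n%:R + 2) * (p j * p k) - 2 * ((j == k)%:R * \sum_m p m ^+ 2).
Proof.
transitivity (\sum_i (p j * conf_gamma p i i k + (i == j)%:R *
   (\sum_m p m * conf_gamma p m i k) - p i * conf_gamma p j i k)).
  apply: eq_bigr => i _.
  rewrite -[X in p j * X](sum_delta_sym i (fun m => conf_gamma p m i k)).
  rewrite -[X in p i * X](sum_delta_sym j (fun m => conf_gamma p m i k)).
  rewrite !mulr_sumr -big_split -sumrB; apply: eq_bigr => m _ /=.
  by rewrite /(conf_gamma p i j m); ring.
rewrite sumrB big_split /= sum_delta sum_conf_gamma.
rewrite (eq_bigr (fun=> p j * p k)) => [|i _]; last by rewrite conf_gamma_trace.
rewrite sumr_const card_ord -mulr_natl.
have -> : \sum_i p i * conf_gamma p j i k = (j == k)%:R * \sum_m p m ^+ 2.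
  transitivity (\sum_i ((j == k)%:R * p i ^+ 2 + (j == i)%:R * (p k * p i)
     - (i == k)%:R * (p j * p i))).
    by apply: eq_bigr => i _; rewrite /conf_gamma; ring.
  by rewrite sumrB big_split /= sum_delta sum_delta_sym -mulr_sumr; ring.
ring.
Qed.

(** The Ricci tensor of a conformally flat metric as pure algebra, [d i j] standing for the
    derivative of [p j] in direction [i]. [d k j] and [d j k] are kept apart until the symmetry of
    second derivatives is brought in. *)
Lemma conf_ricci_sum p (d : 'I_n -> 'I_n -> R) j k :
  \sum_i (conf_gamma (d i) i j k - conf_gamma (d j) i i k
    + \sum_m (conf_gamma p i i m * conf_gamma p m j k
              - conf_gamma p i j m * conf_gamma p m i k)) =
  d k j + d j k - (j == k)%:R * (\sum_i d i i) - n%:R * d j k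
  + (n%:R - 2) * (p j * p k - (j == k)%:R * \sum_m p m ^+ 2).
Proof.
rewrite big_split sumrB /=.
have -> : \sum_i conf_gamma (d i) i j k = d k j + d j k - (j == k)%:R * (\sum_i d i i).
  rewrite /conf_gamma sumrB big_split /= sum_delta mulr_sumr.
  by rewrite (sum_delta j (fun i => d i k)).
have -> : \sum_i conf_gamma (d j) i i k = n%:R * d j k.
  rewrite (eq_bigr (fun=> d j k)) => [|i _]; last exact: conf_gamma_trace.
  by rewrite sumr_const card_ord mulr_natl.
have -> : \sum_i \sum_m (conf_gamma p i i m * conf_gamma p m j k
              - conf_gamma p i j m * conf_gamma p m i k) =
    n%:R * (2 * (p j * p k) - (j == k)%:R * \sum_m p m ^+ 2)
    - \sum_i \sum_m conf_gamma p i j m * conf_gamma p m i k.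
  rewrite (eq_bigr (fun i => (2 * (p j * p k) - (j == k)%:R * \sum_m p m ^+ 2)
     - \sum_m conf_gamma p i j m * conf_gamma p m i k)) => [|i _].
    by rewrite sumrB sumr_const card_ord -[_ *+ n]mulr_natl.
  rewrite sumrB -sum_conf_gamma; congr (_ - _); apply: eq_bigr => m _.
  by rewrite conf_gamma_trace.
rewrite sum_conf_gamma_sq; ring.
Qed.

End DeltaSums.

Section ConformallyFlat.
Context {R : realType} {n : nat}.
Variables (U : set 'rV[R]_n) (v : 'rV[R]_n -> R) (G : 'rV[R]_n -> 'M[R]_n).
Hypotheses (oU : open U) (Cv : Ck 2 U v) (v0 : forall x, U x -> 0 < v x).
Hypothesis GE : forall x, U x -> G x = ((v x)^-1 ^+ 2)%:M.

Let p (i : 'I_n) (x : 'rV[R]_n) : R := - ('D_(vbasis i) v x * (v x)^-1).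

Lemma christoffel_conf x k i j : U x ->
  christoffel G k i j x = conf_gamma (p^~ x) k i j.
Proof using oU Cv v0 GE.
move=> Ux; have vx0 : v x != 0 by rewrite gt_eqF // v0.
have dv u : derivable v x u by apply: diff_derivable; exact: Ck_differentiable oU Cv Ux.
have dG a b c : 'D_(vbasis a) (fun y => G y b c) x =
    (b == c)%:R * (2 * (v x)^-1 ^+ 2 * p a x).
  have -> : 'D_(vbasis a) (fun y => G y b c) x =
      'D_(vbasis a) ((b == c)%:R *: (fun y => (v y)^-1 * (v y)^-1)) x.
    apply: near_eq_derive; apply: (open_near_eq oU Ux) => y Uy.
    rewrite (GE Uy) mxE -[RHS]/((b == c)%:R * ((v y)^-1 * (v y)^-1)) -expr2.
    by case: (b == c); rewrite ?mulr1n ?mul1r ?mulr0n ?mul0r.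
  have dq : derivable (fun y => (v y)^-1) x (vbasis a) by exact: derivableV.
  rewrite (deriveZ _ (derivableM dq dq)) (deriveM dq dq) (deriveV vx0 (dv _)).
  rewrite /GRing.scale /= /p; move: ('D_(vbasis a) v x) => t.
  congr (_ * _); field; exact: vx0.
rewrite /christoffel (GE Ux) invmx_scalar.
rewrite (eq_bigr (fun l => (k == l)%:R * ((v x) ^+ 2 *
    ((j == l)%:R * (2 * (v x)^-1 ^+ 2 * p i x)
    + (i == l)%:R * (2 * (v x)^-1 ^+ 2 * p j x)
    - (i == j)%:R * (2 * (v x)^-1 ^+ 2 * p l x))))) => [|l _]; last first.
  rewrite !dG mxE -exprVn invrK; case: (k == l); rewrite ?mulr1n ?mul1r ?mulr0n ?mul0r //.
rewrite sum_delta_sym /conf_gamma (eq_sym k j) (eq_sym k i).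
move: (p i x) (p j x) (p k x) => a b c; field; exact: vx0.
Qed.

Lemma derivable_logderiv x k u : U x -> derivable (p k) x u.
Proof using oU Cv v0.
move=> Ux; apply: diff_derivable.
have vx0 : v x != 0 by rewrite gt_eqF // v0.
have dv := Ck_differentiable oU Cv Ux.
have dDv : differentiable ('D_(vbasis k) v) x.
  exact: Ck_differentiable oU (Ck_derive _ oU Cv) Ux.
by apply: differentiableN; apply: differentiableM => //; exact: differentiableV.
Qed.

Lemma derive_christoffel_conf x l i j u : U x ->
  'D_u (christoffel G l i j) x = conf_gamma (fun k => 'D_u (p k) x) l i j.
Proof using oU Cv v0 GE.
move=> Ux.
have -> : 'D_u (christoffel G l i j) x =
   'D_u ((l == j)%:R *: p i + (l == i)%:R *: p j - (i == j)%:R *: p l) x.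
  apply: near_eq_derive; apply: (open_near_eq oU Ux) => y Uy.
  by rewrite (christoffel_conf _ _ _ Uy).
have d a k := is_deriveZ a (derivableP (derivable_logderiv (k := k) (u := u) Ux)).
by have [_ ->] := is_deriveB (is_deriveD (d (l == j)%:R i) (d (l == i)%:R j)) (d (i == j)%:R l).
Qed.

Lemma ricci_conf x j k : U x ->
  ricci G x j k =
  'D_(vbasis k) (p j) x + 'D_(vbasis j) (p k) x
  - (j == k)%:R * (\sum_i 'D_(vbasis i) (p i) x) - n%:R * 'D_(vbasis j) (p k) x
  + (n%:R - 2) * (p j x * p k x - (j == k)%:R * \sum_m p m x ^+ 2).
Proof using oU Cv v0 GE.
move=> Ux; rewrite mxE -(conf_ricci_sum (p^~ x) (fun i m => 'D_(vbasis i) (p m) x)).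
apply: eq_bigr => i _; rewrite /riemann !(derive_christoffel_conf _ _ _ _ Ux).
congr (_ + _); apply: eq_bigr => m _.
by rewrite !(christoffel_conf _ _ _ Ux).
Qed.

Lemma derive_logderiv x i j : U x ->
  'D_(vbasis i) (p j) x =
  - ('D_(vbasis i) ('D_(vbasis j) v) x / v x)
  + 'D_(vbasis i) v x * 'D_(vbasis j) v x / v x ^+ 2.
Proof using oU Cv v0.
move=> Ux; have vx0 : v x != 0 by rewrite gt_eqF // v0.
have dv : derivable v x (vbasis i).
  by apply: diff_derivable; exact: Ck_differentiable oU Cv Ux.
have dDv : derivable ('D_(vbasis j) v) x (vbasis i).
  by apply: diff_derivable; exact: Ck_differentiable oU (Ck_derive _ oU Cv) Ux.
have dq : derivable (fun y => (v y)^-1) x (vbasis i) by exact (derivableV vx0 dv).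
rewrite (deriveN (derivableM dDv dq)) (deriveM dDv dq) (deriveV vx0 dv).
rewrite /GRing.scale /=.
move: ('D_(vbasis i) ('D_(vbasis j) v) x) ('D_(vbasis j) v x) ('D_(vbasis i) v x) => a b c.
field; exact: vx0.
Qed.

(** With phi = - log v the Schouten tensor is - D^2 phi + dphi dphi - |dphi|^2 / 2 times the
    identity. The terms dv dv / v^2 of the first two summands cancel, leaving D^2 v / v, and the
    factor v^2 of the inverse metric clears the denominators. *)
Lemma schouten_conformally_flat x : (3 <= n)%N -> U x ->
  invmx (G x) *m schouten G x =
  \matrix_(j, k) (v x * 'D_(vbasis j) ('D_(vbasis k) v) x
    - (j == k)%:R * (2^-1 * \sum_i 'D_(vbasis i) v x ^+ 2)).
Proof using oU Cv v0 GE.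
move=> n3 Ux; have vx0 : v x != 0 by rewrite gt_eqF // v0.
have n1 : n%:R - 1 != 0 :> R by rewrite subr_eq0 pnatr_eq1; case: n n3 => [|[|]].
have n2 : n%:R - 2 != 0 :> R by rewrite subr_eq0 eqr_nat; case: n n3 => [|[|[|]]].
have inv : invmx (G x) = (v x ^+ 2)%:M by rewrite (GE Ux) invmx_scalar -exprVn invrK.
pose D := \sum_i 'D_(vbasis i) (p i) x; pose P := \sum_m p m x ^+ 2.
have scal : scalar_curvature G x =
    v x ^+ 2 * (- (2 * (n%:R - 1)) * D - (n%:R - 1) * (n%:R - 2) * P).
  rewrite /scalar_curvature inv mul_scalar_mx mxtraceZ; congr (_ * _).
  rewrite /mxtrace (eq_bigr (fun j => (2 - n%:R) * 'D_(vbasis j) (p j) x - D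
     + (n%:R - 2) * p j x ^+ 2 - (n%:R - 2) * P)) => [|j _]; last first.
    rewrite (ricci_conf _ _ Ux) eqxx !mul1r -/D -/P.
    by move: ('D_(vbasis j) (p j) x) (p j x) => a b; ring.
  rewrite !sumrB big_split /= -!mulr_sumr sumrB -mulr_sumr -/D -/P.
  by rewrite !sumr_const card_ord -(mulr_natl D) -(mulr_natl P); clearbody D P; clear; ring.
have PE : P = (\sum_i 'D_(vbasis i) v x ^+ 2) / v x ^+ 2.
  rewrite mulr_suml; apply: eq_bigr => i _.
  by rewrite /p sqrrN exprMn exprVn.
rewrite inv mul_scalar_mx /schouten scal; apply/matrixP => j k.
rewrite !mxE -/(ricci G x j k).
have := ricci_conf j k Ux; rewrite mxE => ->.
rewrite (GE Ux) mxE -/D -/P.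
rewrite (derive_logderiv k j Ux) (derive_logderiv j k Ux).
rewrite (derive_sym (vbasis j) (vbasis k) oU Cv Ux) PE /p.
move: ('D_(vbasis j) ('D_(vbasis k) v) x) ('D_(vbasis j) v x) ('D_(vbasis k) v x).
move: (\sum_i _) => S a b c.
by case: (j == k) => /=; rewrite ?mulr1n ?mulr0n; field; rewrite vx0 n2 n1.
Qed.

End ConformallyFlat.

(** * Touching and comparison in the ball *)

Section Touching.
Context {R : realType} {n : nat}.
Implicit Types (x u : 'rV[R]_n) (v U : 'rV[R]_n -> R).

Definition gradsq v x : R := \sum_i 'D_(vbasis i) v x ^+ 2.
Definition laplacian v x : R := \sum_i 'D_(vbasis i) ('D_(vbasis i) v) x.

(* g^-1 Sch_g in flat coordinates, for the metric g = v^-2 |dx|^2. *)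
Definition conf_schouten v x : 'M[R]_n :=
  \matrix_(j, k) (v x * 'D_(vbasis j) ('D_(vbasis k) v) x
    - (j == k)%:R * (2^-1 * gradsq v x)).

Lemma derive2_lin (W : set 'rV[R]_n) v x u : open W -> Ck 2 W v -> W x ->
  'D_u ('D_u v) x = \sum_j \sum_k u 0 j * (u 0 k * 'D_(vbasis j) ('D_(vbasis k) v) x).
Proof.
move=> oW Cv Wx.
rewrite (derive_lin u (Ck_differentiable oW (Ck_derive u oW Cv) Wx)).
apply: eq_bigr => j _; rewrite (derive_sym u (vbasis j) oW Cv Wx).
rewrite (derive_lin u (Ck_differentiable oW (Ck_derive (vbasis j) oW Cv) Wx)).
rewrite [LHS]mulr_sumr; apply: eq_bigr => k _.
by rewrite (derive_sym (vbasis j) (vbasis k) oW Cv Wx).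
Qed.

Lemma conf_schouten_form (W : set 'rV[R]_n) v x u : open W -> Ck 2 W v -> W x ->
  dotv (u *m conf_schouten v x) u =
  v x * 'D_u ('D_u v) x - 2^-1 * gradsq v x * dotv u u.
Proof.
move=> oW Cv Wx; rewrite (derive2_lin u oW Cv Wx).
rewrite exchange_big /= [v x * _]mulr_sumr [_ * dotv u u]mulr_sumr -sumrB; apply: eq_bigr => k _.
rewrite mxE mulr_suml.
rewrite (eq_bigr (fun j => v x * (u 0 j * (u 0 k * 'D_(vbasis j) ('D_(vbasis k) v) x))
   - (j == k)%:R * (2^-1 * gradsq v x * (u 0 j * u 0 k)))) => [|j _].
  by rewrite sumrB sum_delta -mulr_sumr.
by rewrite mxE; move: ('D_(vbasis j) _ x) => d; ring.
Qed.

Lemma conf_schouten_trace v x :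
  \tr (conf_schouten v x) = v x * laplacian v x - n%:R / 2 * gradsq v x.
Proof.
rewrite /mxtrace (eq_bigr (fun i => v x * 'D_(vbasis i) ('D_(vbasis i) v) x
   - 2^-1 * gradsq v x)) => [|i _]; last by rewrite mxE eqxx mul1r.
by rewrite sumrB -[X in X - _ = _]mulr_sumr sumr_const card_ord -(mulr_natl (2^-1 * gradsq v x)) mulrA.
Qed.

Lemma eigenvalue_bound (A : 'M[R]_n) lam c : eigenvalues_of A lam ->
  (forall u, dotv (u *m A) u <= c * dotv u u) -> forall i, lam 0 i <= c.
Proof.
move=> E H i.
have /eigenvalueP [u uA u0] : eigenvalue A (lam 0 i).
  by rewrite eigenvalue_root_char E /root horner_prod (bigD1 i) //= hornerXsubC subrr mul0r.
have := H u; rewrite uA dotvZl ler_pM2r // dotv_gt0 //.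
Qed.

Lemma eigenvalues_sum (A : 'M[R]_n) lam : (0 < n)%N -> eigenvalues_of A lam ->
  \sum_i lam 0 i = \tr A.
Proof.
move=> n0 E; apply: oppr_inj; rewrite -char_poly_trace // E.
have -> : \prod_i ('X - (lam 0 i)%:P) = \prod_(z <- [seq lam 0 i | i <- enum 'I_n]) ('X - z%:P).
  by rewrite big_map enumT.
have := @coefPn_prod_XsubC R [seq lam 0 i | i <- enum 'I_n].
rewrite size_map size_enum_ord => ->; last by rewrite -lt0n.
by rewrite big_map enumT.
Qed.

Lemma derive2_le (W : set 'rV[R]_n) v U p u : open W -> Ck 2 W v -> Ck 2 W U -> W p ->
  (forall y, W y -> v y <= U y) -> v p = U p ->
  'D_u v p = 'D_u U p /\ 'D_u ('D_u v) p <= 'D_u ('D_u U) p.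
Proof.
move=> oW Cv CU Wp vU vUp.
have C := CkB oW Cv CU.
have mx y : W y -> v y - U y <= v p - U p.
  by move=> Wy; rewrite vUp subrr subr_le0; exact: vU.
have [D1 D2] := local_max_test u oW C Wp mx.
have dd y : W y -> 'D_u (fun z => v z - U z) y = 'D_u v y - 'D_u U y.
  move=> Wy; apply: (deriveB (f := v) (g := U)); apply: diff_derivable.
    exact: Ck_differentiable oW Cv Wy.
  exact: Ck_differentiable oW CU Wy.
split; first by apply/eqP; rewrite -subr_eq0 -(dd p Wp) D1.
rewrite -subr_le0; apply: le_trans D2.
have -> : 'D_u ('D_u (fun z => v z - U z)) p = 'D_u ('D_u v - 'D_u U) p.
  by apply: near_eq_derive; apply: (open_near_eq oW Wp) => y /dd ->.
rewrite (deriveB (f := 'D_u v) (g := 'D_u U)) //; apply: diff_derivable.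
  exact: Ck_differentiable oW (Ck_derive u oW Cv) Wp.
exact: Ck_differentiable oW (Ck_derive u oW CU) Wp.
Qed.

Variables (f : 'rV[R]_n -> R) (Gam : set 'rV[R]_n).
Hypotheses (n0 : (0 < n)%N) (ed : elliptic_data f Gam).

Definition conf_supersolution v x := exists lam,
  [/\ eigenvalues_of (conf_schouten v x) lam, Gam lam & 1 <= f lam].

(** At the contact point [v] and [U] share value and gradient, and the Hessian of [v] is the smaller
    one; as [v p > 0], the bounds on the quadratic form and on the trace pass from [U] to the
    eigenvalues of [v], which lie in [Gam] by assumption. [d] depends on [M] only, so that [e] can
    be chosen afterwards. *)
Lemma no_touching (M : R) : 0 <= M -> exists2 d : R, 0 < d &
  forall e (W : set 'rV[R]_n) v U p, 0 < e <= d -> open W -> Ck 2 W v -> Ck 2 W U ->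
  W p -> 0 < v p -> (forall y, W y -> v y <= U y) -> v p = U p ->
  conf_supersolution v p ->
  (forall u, U p * 'D_u ('D_u U) p - 2^-1 * gradsq U p * dotv u u
     <= (2^-1 + M * e) * dotv u u) ->
  U p * laplacian U p - n%:R / 2 * gradsq U p <= n%:R / 2 - e -> False.
Proof using n0 ed.
move=> M0; have [d d0 H] := elliptic_lt1 ed n0 M0; exists d => //.
move=> e W v U p ed' oW Cv CU Wp vp0 vU vUp [lam [E Glam flam]] q t.
have D u := derive2_le u oW Cv CU Wp vU vUp.
have gE : gradsq v p = gradsq U p.
  by apply: eq_bigr => i _; have [-> _] := D (vbasis i).
suff : f lam < 1 by rewrite ltNge flam.
apply: (H e) => //.
  apply: (eigenvalue_bound E) => u; apply: le_trans (q u).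
  rewrite (conf_schouten_form u oW Cv Wp) gE -vUp lerD2r.
  exact (ler_wpM2l (ltW vp0) (D u).2).
rewrite (eigenvalues_sum n0 E) conf_schouten_trace gE; apply: le_trans t.
rewrite -vUp lerD2r; apply: (ler_wpM2l (ltW vp0)); apply: ler_sum => i _.
exact (D (vbasis i)).2.
Qed.

End Touching.

(** * Quadratic functions, the model solutions *)

Section Quadratics.
Context {R : realType} {n : nat}.
Implicit Types (x u b : 'rV[R]_n).

Definition quadr (a c : R) b x : R := a / 2 * dotv x x + dotv b x + c.

Lemma Ck_quadr k (W : set 'rV[R]_n) a c b : open W -> Ck k W (quadr a c b).
Proof.
move=> oW; apply: (CkD oW _ (Ck_cst k W c)); apply: (CkD oW).
  by apply: (CkZ _ oW); apply: (Ck_dotv oW); exact: Ck_id.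
by apply: (Ck_dotv oW); [exact: Ck_cst|exact: Ck_id].
Qed.

Lemma is_derive_dotvl b x u : is_derive x u (dotv b) (dotv b u).
Proof.
have C : Ck 1 setT (dotv b).
  by apply: (Ck_dotv openT); [exact: Ck_cst|exact: (Ck_id 1 openT)].
have lin : linear (dotv b).
  by move=> k y z; rewrite dotvDr dotvZr.
pose L : {linear 'rV[R]_n -> R} := HB.pack (dotv b) (GRing.isLinear.Build _ _ _ _ _ lin).
have dL : differentiable L x by exact: Ck_differentiable openT C I.
have cL : continuous L.
  move=> y; apply: differentiable_continuous.
  exact: Ck_differentiable openT C I.
apply: DeriveDef; first exact: diff_derivable.
by rewrite [LHS](deriveE u dL) (diff_lin _ cL).
Qed.

Lemma is_derive_dotvv x u : is_derive x u (fun y => dotv y y) (2 * dotv x u).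
Proof.
have C : Ck 1 setT (fun y : 'rV[R]_n => dotv y y).
  by apply: (Ck_dotv openT); exact: (Ck_id 1 openT).
apply: DeriveDef; first by apply: diff_derivable; exact: Ck_differentiable openT C I.
have d i : is_derive x u (fun y : 'rV[R]_n => y 0 i * y 0 i) (2 * (x 0 i * u 0 i)).
  have di : is_derive x u (fun y : 'rV[R]_n => y 0 i) (u 0 i).
    apply: DeriveDef; first by apply: diff_derivable; exact: differentiable_coord.
    by rewrite -(derive_row (F := id)) ?derive_id.
  apply: is_derive_eq (is_deriveM di di) _.
  by rewrite /GRing.scale /=; ring.
have -> : (fun y : 'rV[R]_n => dotv y y) = \sum_(i < n) (fun y : 'rV[R]_n => y 0 i * y 0 i).
  by apply/funext => y; rewrite fct_sumE.
by have [_ ->] := is_derive_sum d; rewrite -mulr_sumr.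
Qed.

Lemma is_derive_quadr a c b x u :
  is_derive x u (quadr a c b) (a * dotv x u + dotv b u).
Proof.
have := is_deriveD (is_deriveD (is_deriveZ (a / 2) (is_derive_dotvv x u))
  (is_derive_dotvl b x u)) (is_derive_cst c x u).
by move=> h; apply: is_derive_eq h _; rewrite /GRing.scale /= addr0; field.
Qed.

Lemma derive_quadr a c b x u : 'D_u (quadr a c b) x = a * dotv x u + dotv b u.
Proof. by have [_ ->] := is_derive_quadr a c b x u. Qed.

Lemma derive2_quadr a c b x u w : 'D_w ('D_u (quadr a c b)) x = a * dotv w u.
Proof.
have -> : 'D_u (quadr a c b) = quadr 0 (dotv b u) (a *: u).
  by apply/funext => y; rewrite derive_quadr /quadr dotvZl dotvC; ring.
by rewrite derive_quadr mul0r add0r dotvZl dotvC.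
Qed.

Lemma gradsq_quadr a c b x : gradsq (quadr a c b) x = dotv (a *: x + b) (a *: x + b).
Proof.
by apply: eq_bigr => i _; rewrite derive_quadr !dotv_basis !mxE expr2.
Qed.

Lemma laplacian_quadr a c b x : laplacian (quadr a c b) x = n%:R * a.
Proof.
rewrite /laplacian (eq_bigr (fun=> a)) => [|i _].
  by rewrite sumr_const card_ord mulr_natl.
by rewrite derive2_quadr dotv_basis mxE !eqxx mulr1.
Qed.

(* v D^2 v - |Dv|^2 / 2 is constant on quadratics: it is half the discriminant. *)
Lemma quadr_discr a c b x :
  quadr a c b x * a - 2^-1 * gradsq (quadr a c b) x = a * c - 2^-1 * dotv b b.
Proof.
rewrite gradsq_quadr dotvDl !dotvDr !dotvZl !dotvZr (dotvC x b) /quadr.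
by move: (dotv x x) (dotv b x) => s t; field.
Qed.

End Quadratics.

(** * Extrema on compact sets and the unit ball *)

Section CompactMax.
Context {R : realType} {n : nat}.
Implicit Types (A : set 'rV[R]_n) (f g : 'rV[R]_n -> R).

Lemma within_continuous A f :
  (forall x, A x -> {for x, continuous f}) -> {within A, continuous f}.
Proof.
move=> h; apply/subspace_continuousP => x Ax.
by apply: cvg_within_filter; exact: h.
Qed.

Lemma within_continuousB A f g : {within A, continuous f} ->
  {within A, continuous g} -> {within A, continuous (fun x => f x - g x)}.
Proof.
move=> /subspace_continuousP cf /subspace_continuousP cg.
apply/subspace_continuousP => x Ax; apply: cvgB; [exact: cf|exact: cg].
Qed.

Lemma compact_ge0 A f : compact A -> {within A, continuous f} ->
  compact (A `&` [set x | 0 <= f x]).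
Proof.
move=> cA cf; have clA : closed A by apply: compact_closed.
apply: (subclosed_compact _ cA) => [|x []//].
move=> x xcl; have Ax : A x by apply: clA => B /xcl [y [[Ay _] By]]; exists y.
split=> //=; rewrite leNgt; apply/negP => fx0.
have /subspace_continuousP/(_ x Ax) := cf.
have nf : nbhs (f x) [set y | y < 0] by apply: open_nbhs_nbhs; split => //; exact: open_lt.
move=> /(_ _ nf); rewrite /within /= => nx.
have [y [[Ay fy0] yneg]] := xcl _ nx.
by have := yneg Ay; rewrite /= ltNge fy0.
Qed.

Lemma compact_max A f : compact A -> A !=set0 -> {within A, continuous f} ->
  exists2 p, A p & forall x, A x -> f x <= f p.
Proof.
move=> cA A0 cf; have [p pA H] := EVT_max_rV A0 cA cf.
exists p; first by rewrite inE in pA.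
by move=> x Ax; apply: H; rewrite inE.
Qed.

Lemma compact_upper_bound A f : compact A -> (forall x, A x -> {for x, continuous f}) ->
  exists2 M, 0 < M & forall x, A x -> f x <= M.
Proof.
move=> cA cf; have [A0|A0] := pselect (A !=set0); last first.
  by exists 1 => // x Ax; case: A0; exists x.
have [p _ H] := compact_max cA A0 (within_continuous cf).
exists (`|f p| + 1) => [|x /H le]; first by rewrite ltr_wpDl.
by rewrite (le_trans le) // (le_trans (ler_norm _)) // lerDl.
Qed.

Lemma compact_pos A f : compact A -> (forall x, A x -> {for x, continuous f}) ->
  (forall x, A x -> 0 < f x) -> exists2 c, 0 < c & forall x, A x -> c <= f x.
Proof.
move=> cA cf f0; have [A0|A0] := pselect (A !=set0); last first.
  by exists 1 => // x Ax; case: A0; exists x.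
have [p pA H] := EVT_min_rV A0 cA (within_continuous cf).
rewrite inE in pA; exists (f p); first exact: f0.
by move=> x Ax; apply: H; rewrite inE.
Qed.

Definition unit_ball : set 'rV[R]_n := [set x | dotv x x < 1].
Definition closed_unit_ball : set 'rV[R]_n := [set x | dotv x x <= 1].

Lemma continuous_dotvv x : {for x, continuous (fun y : 'rV[R]_n => dotv y y)}.
Proof.
apply: (@Ck_continuous _ _ 0 _ setT) => //.
by apply: (Ck_dotv openT); exact: (Ck_id 0 openT).
Qed.

Lemma open_lt_fun f g : (forall x, {for x, continuous f}) ->
  (forall x, {for x, continuous g}) -> open [set x | f x < g x].
Proof.
move=> cf cg.
have -> : [set x | f x < g x] = (fun x => f x - g x) @^-1` [set y | y < 0].
  by apply/seteqP; split=> x /=; rewrite subr_lt0.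
apply: open_comp; last exact: open_lt.
by move=> x _; apply: (continuousB (f := f) (g := g)).
Qed.

Lemma open_unit_ball : open unit_ball.
Proof.
apply: open_lt_fun => x; first exact: continuous_dotvv.
by apply: differentiable_continuous.
Qed.

Lemma compact_unit_ball : compact closed_unit_ball.
Proof.
apply: bounded_closed_compact.
  exists 1; split => // M M1 x /= x1; apply: le_trans (ltW M1).
  rewrite -(@ler_pXn2r _ 2) ?nnegrE // expr1n.
  exact: le_trans (norm_le_dotv x) x1.
have -> : closed_unit_ball = ~` [set x | 1 < dotv x x].
  by apply/seteqP; split=> x /=; rewrite /closed_unit_ball /= leNgt => /negP.
apply: open_closedC; apply: open_lt_fun => x; last exact: continuous_dotvv.
by apply: differentiable_continuous.
Qed.

Lemma unit_ballW : unit_ball `<=` closed_unit_ball.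
Proof. by move=> x /ltW. Qed.

Lemma unit_ball_or_sphere x : closed_unit_ball x -> unit_ball x \/ dotv x x = 1.
Proof. by rewrite /closed_unit_ball /= le_eqVlt => /orP[/eqP|]; [right|left]. Qed.

Lemma continuous_quadr a c b x : {for x, continuous (@quadr R n a c b)}.
Proof. exact: (@Ck_continuous _ _ 0 _ setT _ _ (Ck_quadr 0 a c b openT)). Qed.

End CompactMax.

(** For al = 1 + t^2 one has al^2 - 1 = 2 t^2 + t^4 <= 3 t^2. Writing [al] in this form avoids
    square roots. *)
Lemma slope_bound (R : realType) (t r : R) : 0 < t -> t <= 1 ->
  r ^+ 2 <= (1 + t ^+ 2) ^+ 2 - 1 -> r <= 2 * t.
Proof.
move=> t0 t1 r2; rewrite leNgt; apply/negP => h.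
have h2 : 0 <= 2 * t by rewrite mulr_ge0 // ltW.
have : (2 * t) ^+ 2 < r ^+ 2.
  by rewrite ltr_pXn2r // nnegrE // ltW // (le_lt_trans h2).
have tt0 : 0 < t ^+ 2 by rewrite exprn_gt0.
have tt1 : t ^+ 2 <= 1 by rewrite expr_le1 // ltW.
rewrite exprMn; move: r2; move: (t ^+ 2) (r ^+ 2) tt0 tt1 => T S T0 T1; nra.
Qed.

(** * Sliding comparison with the blends [al * v0 + r * z] *)

Section BallComparison.
Context {R : realType} {n : nat}.
Variables (f : 'rV[R]_n -> R) (Gam : set 'rV[R]_n).
Hypotheses (n0 : (0 < n)%N) (ed : elliptic_data f Gam).
Variables (v : 'rV[R]_n -> R) (a : R) (b : 'rV[R]_n).
Hypotheses (Cv : Ck 2 unit_ball v) (contv : {within closed_unit_ball, continuous v}).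
Hypothesis v_pos : forall x, closed_unit_ball x -> 0 < v x.
Hypotheses (a_pos : 0 < a) (ab : a ^+ 2 - dotv b b = 1).
Hypothesis super : forall x, unit_ball x -> conf_supersolution f Gam v x.

Let v0 : 'rV[R]_n -> R := quadr a (a / 2) b.
Let z : 'rV[R]_n -> R := quadr (-1) 2^-1 0.
Hypothesis vbd : forall x, dotv x x = 1 -> v x = v0 x.

Lemma quadr_z x : z x = (1 - dotv x x) / 2.
Proof using. by rewrite /z /quadr dot0v; field. Qed.

Lemma z_ge0 x : closed_unit_ball x -> 0 <= z x.
Proof using. by move=> x1; rewrite quadr_z divr_ge0 // subr_ge0. Qed.

Lemma z_gt0 x : unit_ball x -> 0 < z x.
Proof using. by move=> x1; rewrite quadr_z divr_gt0 // subr_gt0. Qed.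

(** Put c = a / 2 and s = |x|^2. If [v0 x <= 0], Cauchy-Schwarz and |b|^2 = 4 c^2 - 1 give (c s +
    c)^2 <= (4 c^2 - 1) s, that is c^2 (1 - s)^2 + s <= 0, which is impossible. *)
Lemma v0_pos x : 0 < v0 x.
Proof using a_pos ab.
have := CauchySchwarz_dotv b x; have := dotv_ge0 x; rewrite /v0 /quadr.
have -> : dotv b b = a ^+ 2 - 1 by rewrite -ab; ring.
move: (dotv x x) (dotv b x) => s t s0 ts.
have c0 : 0 < a / 2 by rewrite divr_gt0.
have aE : a = 2 * (a / 2) by field.
rewrite {1}aE in ts; move: (a / 2) c0 ts => c c0 ts.
rewrite ltNge; apply/negP => le.
have h : 0 <= c * s + c by rewrite addr_ge0 ?mulr_ge0 // ltW.
have : (c * s + c) ^+ 2 <= t ^+ 2.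
  by rewrite -[t ^+ 2]sqrrN; apply: lerXn2r; rewrite ?nnegrE; lra.
have : 0 < c ^+ 2 * (1 - s) ^+ 2 + s.
  have [->|sp] := eqVneq s 0; first by rewrite subr0 expr1n mulr1 addr0 exprn_gt0.
  apply: ltr_wpDl; first by rewrite mulr_ge0 ?sqr_ge0.
  by rewrite lt_def sp.
by move: ts; lra.
Qed.

Lemma blend_quadr al r x :
  al * v0 x + r * z x = quadr (al * a - r) ((al * a + r) / 2) (al *: b) x.
Proof using.
by rewrite /v0 /z /quadr dotvZl dot0v; move: (dotv x x) (dotv b x) => s t; field.
Qed.

Lemma no_blend_touching al r p : unit_ball p ->
  (forall x, unit_ball x -> v x <= al * v0 x + r * z x) ->
  v p = al * v0 p + r * z p -> 1 <= al ^+ 2 - r ^+ 2.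
Proof using n0 ed Cv v_pos ab super.
move=> Bp vU vUp; rewrite leNgt; apply/negP => lt1.
have [d d0 H] := no_touching n0 ed (lexx 0).
pose k := al ^+ 2 - r ^+ 2.
(* The eigenvalues of the blend all equal [k / 2 < 1 / 2], so [no_touching] applies with [M = 0];
   the deficit of the trace is [n / 2 * (1 - k)], cut down to the admissible size [d]. *)
pose e := Num.min d (n%:R / 2 * (1 - k)).
have nR : 0 < n%:R / 2 :> R by rewrite divr_gt0 // ltr0n.
have k1 : 0 < 1 - k by rewrite subr_gt0.
have e0 : 0 < e by rewrite lt_min d0 mulr_gt0.
have ed' : 0 < e <= d by rewrite e0 ge_min lexx.
pose U := quadr (al * a - r) ((al * a + r) / 2) (al *: b).
have vU' y : unit_ball y -> v y <= U y by move=> /vU; rewrite blend_quadr.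
have vUp' : v p = U p by rewrite vUp blend_quadr.
have disc : U p * (al * a - r) - 2^-1 * gradsq U p = k / 2.
  rewrite quadr_discr dotvZl dotvZr.
  have -> : dotv b b = a ^+ 2 - 1 by rewrite -ab; ring.
  by rewrite /k; field.
have CU : Ck 2 unit_ball U by exact: Ck_quadr open_unit_ball.
apply: (H e unit_ball v U p ed' open_unit_ball Cv CU Bp (v_pos (unit_ballW Bp)) vU' vUp' (super Bp)).
- move=> u; rewrite derive2_quadr mulrA -mulrBl disc mul0r addr0.
  by apply: ler_wpM2r; [exact: dotv_ge0|lra].
- rewrite laplacian_quadr.
  have -> : U p * (n%:R * (al * a - r)) - n%:R / 2 * gradsq U p =
    n%:R * (U p * (al * a - r) - 2^-1 * gradsq U p) by field.
  rewrite disc.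
  have : e <= n%:R / 2 * (1 - k) by rewrite ge_min lexx orbT.
  by move: (n%:R) => N; lra.
Qed.

(* The maximum of the ratio (v - al v0) / z is attained in the open ball since
   v < al v0 on the unit sphere. *)
Lemma blend_attained al : 1 < al -> exists r p,
  [/\ unit_ball p, forall x, closed_unit_ball x -> v x <= al * v0 x + r * z x
    & v p = al * v0 p + r * z p].
Proof using Cv contv a_pos ab vbd.
move=> al1; pose q x := (v x - al * v0 x) / z x.
have B0 : unit_ball (0 : 'rV[R]_n) by rewrite /unit_ball /= dot0v.
pose g x := v x - (al * v0 x + q 0 * z x).
have qz x : unit_ball x -> v x = al * v0 x + q x * z x.
  by move=> Bx; rewrite /q divfK ?gt_eqF ?z_gt0 // addrC subrK.
(* Inside the ball this is the set where [q x >= q 0]. Since [al > 1] it misses the unit sphere,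
   where [q] is a division by zero, so the ratio can be maximised on a compact set where it is
   continuous. *)
pose K := closed_unit_ball `&` [set x | 0 <= g x].
have cK : compact K.
  apply: (compact_ge0 compact_unit_ball); apply: within_continuousB => //.
  apply: within_continuous => x _.
  have -> : (fun x => al * v0 x + q 0 * z x) = quadr (al * a - q 0) ((al * a + q 0) / 2) (al *: b).
    by apply/funext => y; exact: blend_quadr.
  exact: continuous_quadr.
have KB x : K x -> unit_ball x.
  move=> [Dx gx]; have [//|x1] := unit_ball_or_sphere Dx.
  move: gx; rewrite /= /g (vbd x1) quadr_z x1 subrr mul0r mulr0 addr0 subr_ge0.
  by rewrite ger_pMl ?v0_pos // leNgt al1.
have K0 : K !=set0.
  exists 0; split; first exact: unit_ballW.
  by rewrite /= /g -(qz 0 B0) subrr.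
have cq : {within K, continuous q}.
  apply: within_continuous => x /KB Bx.
  have cvx := Ck_continuous Cv Bx.
  apply: continuousM.
    apply: continuousB => //; apply: continuousM; last exact: continuous_quadr.
    by apply: differentiable_continuous.
  by apply: continuousV; [rewrite gt_eqF // z_gt0|exact: continuous_quadr].
have [p Kp H] := compact_max cK K0 cq.
have Bp := KB p Kp; exists (q p), p; split => //; last exact: qz.
have q0 : q 0 <= q p.
  apply: H; split; first exact: unit_ballW.
  by rewrite /= /g -(qz 0 B0) subrr.
move=> x Dx; have zx := z_ge0 Dx; have [gx|gx] := leP 0 (g x).
  have Kx : K x by [].
  by rewrite (qz x (KB x Kx)) lerD2l ler_wpM2r // H.
have : v x < al * v0 x + q 0 * z x by rewrite -subr_lt0.
by move=> /ltW /le_trans -> //; rewrite lerD2l ler_wpM2r.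
Qed.

Lemma blend_slope al : 1 < al -> exists r p,
  [/\ unit_ball p, forall x, closed_unit_ball x -> v x <= al * v0 x + r * z x,
      v p = al * v0 p + r * z p & r ^+ 2 <= al ^+ 2 - 1].
Proof using n0 ed Cv contv v_pos a_pos ab super vbd.
move=> al1; have [r [p [Bp H E]]] := blend_attained al1.
exists r, p; split => //.
have := no_blend_touching Bp (fun x Bx => H x (unit_ballW Bx)) E.
by lra.
Qed.

Lemma solution_le_v0 x : closed_unit_ball x -> v x <= v0 x.
Proof using n0 ed Cv contv v_pos a_pos ab super vbd.
move=> Dx; rewrite leNgt; apply/negP => lt.
pose g := v x - v0 x; have g0 : 0 < g by rewrite subr_gt0.
have v00 := v0_pos x.
(* The comparison allows [v x - v0 x] to be at most t^2 v0 + 2 t z, hence at most t v0 + 2 t, which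
   this choice makes smaller than [g]. *)
pose t := Num.min 1 (g / (2 * (v0 x + 1))).
have t0 : 0 < t by rewrite lt_min ltr01 divr_gt0 // mulr_gt0 // addr_gt0.
have t1 : t <= 1 by rewrite ge_min lexx.
have tg : t * (2 * (v0 x + 1)) <= g.
  by rewrite -ler_pdivlMr ?ge_min ?lexx ?orbT // mulr_gt0 // addr_gt0.
have al1 : 1 < 1 + t ^+ 2 by rewrite ltrDl exprn_gt0.
have [r [p [_ /(_ x Dx) H _ r2]]] := blend_slope al1.
have zx0 := z_ge0 Dx.
have zx : z x <= 1 by rewrite quadr_z; have := dotv_ge0 x; move: (dotv x x) => s; lra.
have r2t := slope_bound t0 t1 r2.
move: H; have -> : v x = v0 x + g by rewrite /g; ring.
move: (z x) (v0 x) zx zx0 v00 tg => Z V Z1 Z0 V0 tg H.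
have : r * Z <= 2 * t * Z by rewrite ler_wpM2r.
clearbody g t => H2.
have : t * t <= t by rewrite ger_pMl.
have : t * Z <= t by rewrite ger_pMr.
nra.
Qed.

(** At the contact point of the blend, [v0 - e * z] lies above [al * v0 + r * z], which forces
    [r <= - e]; but [slope_bound], applied to [- r], gives [- r <= 2 * t <= e / 2]. *)
Lemma no_negative_slope e : 0 < e ->
  (forall x, closed_unit_ball x -> v x <= v0 x - e * z x) -> False.
Proof using n0 ed Cv contv v_pos a_pos ab super vbd.
move=> e0 H; pose t := Num.min 1 (e / 4).
have t0 : 0 < t by rewrite lt_min ltr01 divr_gt0.
have t1 : t <= 1 by rewrite ge_min lexx.
have te : t <= e / 4 by rewrite ge_min lexx orbT.
have al1 : 1 < 1 + t ^+ 2 by rewrite ltrDl exprn_gt0.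
have [r [p [Bp _ E r2]]] := blend_slope al1.
have := H p (unit_ballW Bp); rewrite E => le.
have zp := z_gt0 Bp; have vp := v0_pos p.
have re : r <= - e.
  have t2 : 0 < t ^+ 2 by rewrite exprn_gt0.
  have tv : 0 < t ^+ 2 * v0 p by rewrite mulr_gt0.
  have : (r + e) * z p <= 0.
    by move: (z p) (v0 p) (t ^+ 2) tv le => Z V T; lra.
  by rewrite pmulr_lle0 //; lra.
have : (- r) ^+ 2 <= (1 + t ^+ 2) ^+ 2 - 1 by rewrite sqrrN.
by move=> /(slope_bound t0 t1) h; lra.
Qed.

End BallComparison.

(** * A barrier of Hopf type *)

Section ExponentialBarrier.
Context {R : realType} {n : nat}.
Variables (S : set 'rV[R]_n) (phi : 'rV[R]_n -> R) (k : R).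
Hypotheses (oS : open S) (Cphi : Ck 2 S phi).

(** The Hopf barrier: it vanishes where [phi] is 1, and for large [k] the term k^2 |D phi|^2
    dominates in its Laplacian away from the critical points of [phi]. *)
Definition exp_barrier (x : 'rV[R]_n) : R := expR (- (k * phi x)) - expR (- k).

Definition graddot (v w : 'rV[R]_n -> R) x : R :=
  \sum_i 'D_(vbasis i) v x * 'D_(vbasis i) w x.

Lemma Ck_exp_barrier : Ck 2 S exp_barrier.
Proof using oS Cphi.
apply: (CkB oS _ (Ck_cst 2 S (expR (- k)))); apply: (Ck_expR oS).
by apply: (CkN oS); exact: CkZ.
Qed.

Lemma derive_exp_barrier x u : S x ->
  'D_u exp_barrier x = - k * (expR (- (k * phi x)) * 'D_u phi x).
Proof using oS Cphi.
move=> Sx; pose q y : R := - (k * phi y).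
have Cq : Ck 2 S q by apply: (CkN oS); exact: CkZ.
have dphi := Ck_differentiable oS Cphi Sx.
have dq := Ck_differentiable oS Cq Sx.
have dexp (y : R) : differentiable (expR : R -> R) y.
  by apply/derivable1_diffP; exact: derivable_expR.
have Dq : 'D_u q x = - k * 'D_u phi x.
  have [_ ->] := is_deriveN (is_deriveZ k (derivableP (diff_derivable (v := u) dphi))).
  by rewrite mulNr.
have dq1 : derivable (expR \o q) x u.
  by apply: diff_derivable; exact: differentiable_comp dq (dexp _).
have -> : 'D_u exp_barrier x = 'D_u (expR \o q) x.
  have [_ ->] := is_deriveB (derivableP dq1) (is_derive_cst (expR (- k)) x u).
  by rewrite subr0.
rewrite (deriveE u (differentiable_comp dq (dexp _))) (diff_comp dq (dexp _)) /=.
rewrite -(deriveE u dq).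
have de : 'd (expR : R -> R) (q x) 1 = expR (q x).
  rewrite -(deriveE (1 : R) (dexp (q x))).
  by have [_ ->] := is_derive_expR (q x).
by rewrite -[X in 'd _ _ X]mulr1 [LHS]linearZ /= de Dq [LHS]mulrC mulrCA.
Qed.

Lemma laplacian_exp_barrier x : S x ->
  laplacian exp_barrier x =
  k * expR (- (k * phi x)) * (k * gradsq phi x - laplacian phi x).
Proof using oS Cphi.
move=> Sx; rewrite mulrBr [k * gradsq _ _]mulr_sumr !mulr_sumr -sumrB.
apply: eq_bigr => i _.
have -> : 'D_(vbasis i) ('D_(vbasis i) exp_barrier) x =
  'D_(vbasis i) (- k *: ((exp_barrier + cst (expR (- k))) * 'D_(vbasis i) phi)) x.
  apply: near_eq_derive; apply: (open_near_eq oS Sx) => y Sy.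
  rewrite (derive_exp_barrier _ Sy) /GRing.scale /=; congr (_ * (_ * _)).
  by rewrite -[RHS]/(exp_barrier y + expR (- k)) subrK.
have db := derivableP (diff_derivable (v := vbasis i) (Ck_differentiable oS Ck_exp_barrier Sx)).
have dD := derivableP (diff_derivable (v := vbasis i)
   (Ck_differentiable oS (Ck_derive (vbasis i) oS Cphi) Sx)).
have [_ ->] := is_deriveZ (- k)
  (is_deriveM (is_deriveD db (is_derive_cst (expR (- k)) x (vbasis i))) dD).
rewrite (derive_exp_barrier _ Sx) /GRing.scale /= -[X in X * _ + _]/(exp_barrier x + expR (- k)) subrK.
move: ('D_(vbasis i) ('D_(vbasis i) phi) x) ('D_(vbasis i) phi x) (expR _) => A B C.
ring.
Qed.

Lemma graddot_exp_barrier w x : S x ->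
  graddot w exp_barrier x = - k * expR (- (k * phi x)) * graddot w phi x.
Proof using oS Cphi.
move=> Sx; rewrite [RHS]mulr_sumr; apply: eq_bigr => i _.
rewrite (derive_exp_barrier _ Sx).
by move: ('D_(vbasis i) w x) ('D_(vbasis i) phi x) => A B; ring.
Qed.

End ExponentialBarrier.

Section BallGauge.
Context {R : realType} {n : nat}.
Variable y : 'rV[R]_n.
Hypothesis By : unit_ball y.
Implicit Types x : 'rV[R]_n.

(* phi = |x - y|^2 / (1 + |y|^2 - 2 x.y) equals 1 on the unit sphere and has y
   as its only critical point in the ball. *)
Let den : 'rV[R]_n -> R := quadr 0 (1 + dotv y y) (- 2 *: y).
Let num : 'rV[R]_n -> R := quadr 2 (dotv y y) (- 2 *: y).
Definition gauge_dom : set 'rV[R]_n := [set x | 0 < den x].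
Definition gauge x : R := num x * (den x)^-1.

Lemma gauge_denE x : den x = 1 + dotv y y - 2 * dotv x y.
Proof using. by rewrite /den /quadr dotvZl (dotvC y); ring. Qed.

Lemma gauge_numE x : num x = dotv (x - y) (x - y).
Proof using.
rewrite dotvDl !dotvDr !dotvNl !dotvNr /num /quadr dotvZl (dotvC y).
by move: (dotv x x) (dotv x y) => s t; field.
Qed.

Lemma gauge_num_den x : num x = den x - (1 - dotv x x).
Proof using.
by rewrite gauge_denE gauge_numE dotvDl !dotvDr !dotvNl !dotvNr (dotvC y x); ring.
Qed.

Lemma open_gauge_dom : open gauge_dom.
Proof using.
apply: open_lt_fun => x; last exact: continuous_quadr.
by apply: differentiable_continuous.
Qed.

Lemma dotv_lt1 x : closed_unit_ball x -> dotv x y < 1 /\ 0 < den x /\ den x <= 4.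
Proof using By.
move=> Dx; rewrite gauge_denE; have := CauchySchwarz_dotv x y.
move: Dx By (dotv_ge0 x) (dotv_ge0 y); rewrite /closed_unit_ball /unit_ball /=.
move: (dotv x x) (dotv y y) (dotv x y) => s r t s1 r1 s0 r0 ts.
have tr : t ^+ 2 <= r by apply: le_trans ts _; rewrite ler_piMl.
have t1 : t ^+ 2 < 1 by exact: le_lt_trans tr r1.
have tlt : `|t| < 1.
  by rewrite -(@ltr_pXn2r _ 2) ?nnegrE // expr1n real_normK // num_real.
move: tlt; rewrite ltr_norml => /andP[tl tu]; split => //; split; last by lra.
rewrite subr_gt0; have [t0|t0] := leP t 0; first by lra.
have : 0 < (1 - t) ^+ 2 by rewrite exprn_gt0 // subr_gt0.
by nra.
Qed.

Lemma unit_ball_gauge_dom : closed_unit_ball `<=` gauge_dom.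
Proof using By. by move=> x /dotv_lt1 [_ []]. Qed.

Lemma Ck_gauge k : Ck k gauge_dom gauge.
Proof using.
have oS := open_gauge_dom; apply: (CkM oS); first exact: Ck_quadr.
by apply: (CkV oS); [move=> x Sx; rewrite gt_eqF|exact: Ck_quadr].
Qed.

Lemma gaugeE x : closed_unit_ball x -> gauge x = 1 - (1 - dotv x x) / den x.
Proof using By.
move=> /dotv_lt1 [_ [dx _]]; rewrite /gauge gauge_num_den mulrBl divff //.
by rewrite gt_eqF.
Qed.

Lemma gauge_le1 x : closed_unit_ball x -> gauge x <= 1.
Proof using By.
move=> Dx; rewrite (gaugeE Dx) lerBlDr lerDl divr_ge0 ?subr_ge0 //.
by have [_ [/ltW]] := dotv_lt1 Dx.
Qed.

Lemma gauge_ge0 x : closed_unit_ball x -> 0 <= gauge x.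
Proof using By.
move=> Dx; rewrite /gauge gauge_numE divr_ge0 ?dotv_ge0 //.
by have [_ [/ltW]] := dotv_lt1 Dx.
Qed.

(** The derivative of [gauge] in the direction [x - y] equals 2 num (1 - x.y) / den^2, which is
    positive. *)
Lemma gradsq_gauge_gt0 x : closed_unit_ball x -> x != y -> 0 < gradsq gauge x.
Proof using By.
move=> Dx xy; have [xy1 [dx _]] := dotv_lt1 Dx.
have Sx : gauge_dom x by [].
rewrite lt_def sumr_ge0 ?andbT => [|i _]; last exact: sqr_ge0.
apply/eqP => g0.
have D0 i : 'D_(vbasis i) gauge x = 0.
  apply/eqP; rewrite -sqrf_eq0; apply/eqP; move: i.
  have /psumr_eq0P h := g0; move=> i; apply: (h _ i) => // j _; exact: sqr_ge0.
have : 'D_(x - y) gauge x = 0.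
  rewrite (derive_lin _ (Ck_differentiable open_gauge_dom (Ck_gauge 1) Sx)).
  by rewrite big1 // => i _; rewrite D0 scaler0.
have dd : derivable den x (x - y) by case: (is_derive_quadr 0 (1 + dotv y y) (- 2 *: y) x (x - y)).
have dn : derivable num x (x - y) by case: (is_derive_quadr 2 (dotv y y) (- 2 *: y) x (x - y)).
have dx0 : den x != 0 by rewrite gt_eqF.
have dv := derivableV dx0 dd.
rewrite -[gauge]/(num * (fun z => (den z)^-1)) (deriveM dn dv) (deriveV dx0 dd).
rewrite (derive_quadr 0) (derive_quadr 2) /GRing.scale /=.
have -> : 2 * dotv x (x - y) + dotv (- 2 *: y) (x - y) = 2 * num x.
  by rewrite gauge_numE dotvZl dotvDl dotvNl; ring.
have -> : 0 * dotv x (x - y) + dotv (- 2 *: y) (x - y) = 2 * den x - 2 * (1 - dotv x y).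
  by rewrite gauge_denE dotvZl !dotvDr !dotvNr (dotvC y x); ring.
have nx : 0 < num x by rewrite gauge_numE dotv_gt0 subr_eq0.
have dx2 : 0 < den x ^- 2 by rewrite invr_gt0 exprn_gt0.
have -> : num x * (- den x ^- 2 * (2 * den x - 2 * (1 - dotv x y))) + (den x)^-1 * (2 * num x)
  = 2 * num x * den x ^- 2 * (1 - dotv x y).
  by move: (num x) (dotv x y) => N T; field.
by apply/eqP; rewrite gt_eqF // !mulr_gt0 // subr_gt0.
Qed.

End BallGauge.

Section Barrier.
Context {R : realType} {n : nat}.
Implicit Types (S : set 'rV[R]_n) (v w h : 'rV[R]_n -> R).

Lemma Ck_graddot k S v w : open S -> Ck k.+1 S v -> Ck k.+1 S w -> Ck k S (graddot v w).
Proof.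
move=> oS Cv Cw; apply: (Ck_sum oS) => i.
exact (CkM oS (Ck_derive (vbasis i) oS Cv) (Ck_derive (vbasis i) oS Cw)).
Qed.

Lemma gradsqE v : gradsq v = graddot v v.
Proof. by apply/funext => x; apply: eq_bigr => i _; rewrite expr2. Qed.

Lemma Ck_laplacian k S v : open S -> Ck k.+2 S v -> Ck k S (laplacian v).
Proof.
move=> oS Cv; apply: (Ck_sum oS) => i.
exact (Ck_derive (vbasis i) oS (Ck_derive (vbasis i) oS Cv)).
Qed.

(** A majorant of the norm of the Hessian built from 1 + t^2 >= |t|, so that its continuity follows
    from that of sums and products. *)
Definition hess_bound h x : R :=
  \sum_j \sum_k (1 + 'D_(vbasis j) ('D_(vbasis k) h) x * 'D_(vbasis j) ('D_(vbasis k) h) x).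

Lemma hess_bound_ge0 h x : 0 <= hess_bound h x.
Proof.
apply: sumr_ge0 => j _; apply: sumr_ge0 => k _.
by rewrite addr_ge0 // -expr2 sqr_ge0.
Qed.

Lemma Ck_hess_bound S h : open S -> Ck 2 S h -> Ck 0 S (hess_bound h).
Proof.
move=> oS Ch; apply: (Ck_sum oS) => j; apply: (Ck_sum oS) => k.
apply: (CkD oS (Ck_cst 0 S (1 : R))).
have C := Ck_derive (vbasis j) oS (Ck_derive (vbasis k) oS Ch).
exact (CkM oS C C).
Qed.

Lemma hess_boundP S h x u : open S -> Ck 2 S h -> S x ->
  `|'D_u ('D_u h) x| <= hess_bound h x * dotv u u.
Proof.
move=> oS Ch Sx; rewrite (derive2_lin u oS Ch Sx).
apply: le_trans (ler_norm_sum _ _ _) _; rewrite mulr_suml; apply: ler_sum => j _.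
apply: le_trans (ler_norm_sum _ _ _) _; rewrite mulr_suml; apply: ler_sum => k _.
move: ('D_(vbasis j) ('D_(vbasis k) h) x) => t.
have sq i : u 0 i ^+ 2 <= dotv u u.
  rewrite /dotv (bigD1 i) //= -expr2 lerDl sumr_ge0 // => l _.
  by rewrite -expr2 sqr_ge0.
have jk : `|u 0 j * u 0 k| <= dotv u u.
  have := sq j; have := sq k; rewrite normrM.
  rewrite -(real_normK (num_real (u 0 j))) -(real_normK (num_real (u 0 k))).
  have := sqr_ge0 (`|u 0 j| - `|u 0 k|); move: `|u 0 j| `|u 0 k| (dotv u u) => p q d.
  by nra.
rewrite mulrA normrM mulrC; apply: ler_pM => //.
have [t0|t0] := leP 0 t; first by rewrite ger0_norm //; nra.
by rewrite ltr0_norm //; nra.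
Qed.

(** The operator in the last clause is the linearisation at w of the trace w Lap w - n |Dw|^2 / 2,
    without its term of order zero, whose sign is favourable when [h] is subtracted. A ball around
    [y] is left out because [y] is critical for the gauge. *)
Lemma barrier_exists (y : 'rV[R]_n) (r a c : R) (b : 'rV[R]_n) : unit_ball y -> 0 < r ->
  (forall x, 0 < quadr a c b x) ->
  exists S h e k, [/\ open S, closed_unit_ball `<=` S & Ck 2 S h] /\
   [/\ 0 < e, 0 < k, forall x, dotv x x = 1 -> h x = 0,
      forall x, closed_unit_ball x -> h x <= 1 /\ e * ((1 - dotv x x) / 2) <= h x
    & forall x, closed_unit_ball x -> r <= dotv (x - y) (x - y) ->
      k <= quadr a c b x * laplacian h x - n%:R * graddot (quadr a c b) h x].
Proof.
move=> By r0 v0; pose S := gauge_dom y; pose phi := gauge y; pose w := quadr a c b.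
have oS : open S by exact: open_gauge_dom.
have Cphi : Ck 2 S phi by exact: Ck_gauge.
have Cw : Ck 2 S w by exact: Ck_quadr.
have DS : closed_unit_ball `<=` S by exact: unit_ball_gauge_dom.
pose K := closed_unit_ball `&` [set x | 0 <= dotv (x - y) (x - y) - r].
have cK : compact K.
  apply: (compact_ge0 compact_unit_ball); apply: within_continuous => x _.
  apply: (@Ck_continuous _ _ 0 _ setT) => //.
  apply: (CkB openT _ (Ck_cst 0 setT r)).
  have C : Ck 0 setT (fun x : 'rV[R]_n => x - y).
    by apply: (Ck_addv openT (Ck_id 0 openT) (Ck_cst 0 setT (- y))).
  exact (Ck_dotv openT C C).
have KS x : K x -> S x by move=> [/DS].
have [c1 c10 P] : exists2 c1, 0 < c1 & forall x, K x -> c1 <= w x * gradsq phi x.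
  apply: (compact_pos cK) => [x /KS Sx|x [Dx xr]].
    apply: (Ck_continuous (k := 0) _ Sx); rewrite gradsqE.
    exact (CkM oS (Ck_leq (leq0n 2) Cw) (CkW (Ck_graddot oS Cphi Cphi))).
  apply: mulr_gt0; first exact: v0.
  apply: (gradsq_gauge_gt0 By Dx); apply/eqP => xy.
  by move: xr; rewrite /= xy subrr dot0v sub0r oppr_ge0 leNgt r0.
have [M M0 Q] : exists2 M, 0 < M & forall x, K x ->
    w x * laplacian phi x - n%:R * graddot w phi x <= M.
  apply: (compact_upper_bound (f := fun x => w x * laplacian phi x - n%:R * graddot w phi x) cK) => x /KS Sx.
  apply: (Ck_continuous (k := 0) _ Sx).
  apply: (CkB oS (CkM oS (Ck_leq (leq0n 2) Cw) (Ck_laplacian oS Cphi))).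
  exact (CkZ _ oS (CkW (Ck_graddot oS Cw Cphi))).
(* On the barrier the operator equals k F (k w |D phi|^2 - (w Lap phi - n Dw.D phi)) with F = exp(-
   k phi); with this [k] the bracket is at least k c1 - M = 1. *)
pose k := (M + 1) / c1; have k0 : 0 < k by rewrite divr_gt0 // addr_gt0.
(* Convexity of the exponential gives h >= exp(- k) k (1 - phi), and 1 - phi >= (1 - |x|^2) / 4
   since [den <= 4]: this is the first constant. The second comes from F >= exp(- k), as phi <=
   1. *)
exists S, (exp_barrier phi k), (expR (- k) * k / 2), (k * expR (- k)); split.
  by split; [exact oS|exact DS|exact (Ck_exp_barrier k oS Cphi)].
have E0 := expR_gt0 (- k).
split.
- by rewrite divr_gt0 // mulr_gt0.
- by rewrite mulr_gt0.
- move=> x x1; rewrite /exp_barrier /phi gaugeE ?x1 /closed_unit_ball /= ?x1 //.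
  by rewrite subrr mul0r subr0 mulr1 subrr.
- move=> x Dx; have [_ [d0 d4]] := dotv_lt1 By Dx; rewrite /exp_barrier; split.
    have : expR (- (k * phi x)) <= 1.
      by rewrite -expR0 ler_expR oppr_le0 (mulr_ge0 (ltW k0) (gauge_ge0 By Dx)).
    by move=> F1; rewrite lerBlDr (le_trans F1) // lerDl ltW.
  have -> : expR (- (k * phi x)) = expR (- k) * expR (k * (1 - phi x)).
    by rewrite -expRD; congr expR; ring.
  have := expR_ge1Dx (k * (1 - phi x)).
  have s0 : 0 <= 1 - dotv x x by rewrite subr_ge0.
  have : (1 - dotv x x) / 4 <= 1 - phi x.
    rewrite /phi (gaugeE By Dx) opprB addrCA subrr addr0.
    by apply: ler_wpM2l => //; rewrite lef_pV2 ?posrE.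
  move: E0; move: (dotv x x) s0 (expR (- k)) (phi x) (expR (k * (1 - phi x))).
  move=> s s0 E p F E0 h1 h2.
  have h3 : k * ((1 - s) / 4) <= k * (1 - p) by rewrite ler_pM2l.
   have h4 : E * (k * ((1 - s) / 4)) <= E * (F - 1)  by rewrite ler_pM2l // (le_trans h3) // lerBrDl. 
  have -> : E * k / 2 * ((1 - s) / 2) = E * (k * ((1 - s) / 4)) by field.
  by move: h4; rewrite mulrBr mulr1.
- move=> x Dx xr; have Kx : K x by split; rewrite //= subr_ge0.
  have Sx := DS x Dx.
  rewrite (laplacian_exp_barrier k oS Cphi Sx) (graddot_exp_barrier k oS Cphi w Sx).
  have := Q x Kx; have := P x Kx.
  have : expR (- k) <= expR (- (k * phi x)).
    by rewrite ler_expR lerN2 ger_pMr // gauge_le1.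
  have kE : k * c1 = M + 1 by rewrite divfK // gt_eqF.
  move: E0; rewrite -/w.
  move: (w x) (gradsq phi x) (laplacian phi x) (graddot w phi x) (expR (- (k * phi x))) (expR (- k)).
  move=> V g L gd F E E0 EF h1 h2.
  have h3 : 1 <= k * (V * g) - (V * L - n%:R * gd).
    have : k * c1 <= k * (V * g) by rewrite ler_pM2l.
    by rewrite kE; lra.
  have -> : V * (k * F * (k * g - L)) - n%:R * (- k * F * gd) =
     k * F * (k * (V * g) - (V * L - n%:R * gd)) by ring.
  apply: (@le_trans _ _ (k * F)); first by rewrite ler_pM2l.
  rewrite ler_peMr // mulr_ge0 //; first exact: ltW.
  exact: ltW (lt_le_trans E0 EF).
Qed.

Lemma derive_perturbation S v h (e m : R) x u : open S -> Ck 2 S v -> Ck 2 S h -> S x ->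
  'D_u (fun y => v y - e * h y + m) x = 'D_u v x - e * 'D_u h x.
Proof.
move=> oS Cv Ch Sx.
have dv := derivableP (diff_derivable (v := u) (Ck_differentiable oS Cv Sx)).
have dh := derivableP (diff_derivable (v := u) (Ck_differentiable oS Ch Sx)).
have [_ ->] := is_deriveD (is_deriveB dv (is_deriveZ e dh)) (is_derive_cst m x u).
by rewrite addr0.
Qed.

Lemma derive2_perturbation S v h (e m : R) x u : open S -> Ck 2 S v -> Ck 2 S h -> S x ->
  'D_u ('D_u (fun y => v y - e * h y + m)) x = 'D_u ('D_u v) x - e * 'D_u ('D_u h) x.
Proof.
move=> oS Cv Ch Sx.
have -> : 'D_u ('D_u (fun y => v y - e * h y + m)) x = 'D_u ('D_u v - e *: 'D_u h) x.
  apply: near_eq_derive; apply: (open_near_eq oS Sx) => y Sy.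
  by rewrite (derive_perturbation e m u oS Cv Ch Sy).
have dv := derivableP (diff_derivable (v := u) (Ck_differentiable oS (Ck_derive u oS Cv) Sx)).
have dh := derivableP (diff_derivable (v := u) (Ck_differentiable oS (Ck_derive u oS Ch) Sx)).
by have [_ ->] := is_deriveB dv (is_deriveZ e dh).
Qed.

Lemma gradsq_perturbation S v h (e m : R) x : open S -> Ck 2 S v -> Ck 2 S h -> S x ->
  gradsq (fun y => v y - e * h y + m) x =
  gradsq v x - 2 * e * graddot v h x + e ^+ 2 * gradsq h x.
Proof.
move=> oS Cv Ch Sx; rewrite [_ * graddot v h x]mulr_sumr [_ * gradsq h x]mulr_sumr.
rewrite -sumrB -big_split /=; apply: eq_bigr => i _.
rewrite (derive_perturbation e m (vbasis i) oS Cv Ch Sx).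
by move: ('D_(vbasis i) v x) ('D_(vbasis i) h x) => A B; ring.
Qed.

Lemma laplacian_perturbation S v h (e m : R) x : open S -> Ck 2 S v -> Ck 2 S h -> S x ->
  laplacian (fun y => v y - e * h y + m) x = laplacian v x - e * laplacian h x.
Proof.
move=> oS Cv Ch Sx; rewrite [e * laplacian h x]mulr_sumr -sumrB.
by apply: eq_bigr => i _; rewrite (derive2_perturbation e m (vbasis i) oS Cv Ch Sx).
Qed.

(** The Schouten form of [U = v0 - e h + m] at the contact point, where [U = V - e * eta]: [X] is
    the second derivative of [h] along the test vector, [gd] is Dv0.Dh, and [g0], [gh] are the
    squared gradients of [v0] and [h]. The terms in [a] and [gh] have the good sign; [M] collects
    the other terms of order [e]. *)
Lemma perturbed_form (V a g0 H X gd gh eta e M uu : R) :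
  V * a - 2^-1 * g0 = 2^-1 -> 0 <= V -> 0 <= a -> 0 <= H -> 0 <= gh -> 0 <= uu ->
  `|X| <= H * uu -> 0 <= eta -> eta <= 1 -> 0 < e -> e <= 1 ->
  V * H + (1 + gd * gd) + H <= M ->
  (V - e * eta) * (a * uu - e * X) - 2^-1 * (g0 - 2 * e * gd + e ^+ 2 * gh) * uu
    <= (2^-1 + M * e) * uu.
Proof.
move=> disc V0 a0 H0 gh0 uu0 XH eta0 eta1 e0 e1 HM.
have g0E : 2^-1 * g0 = V * a - 2^-1 by lra.
have -> : (V - e * eta) * (a * uu - e * X) - 2^-1 * (g0 - 2 * e * gd + e ^+ 2 * gh) * uu =
  2^-1 * uu + e * (- (V * X) + (e * eta) * X + gd * uu - (eta * a * uu + 2^-1 * e * gh * uu)).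
  have -> : 2^-1 * (g0 - 2 * e * gd + e ^+ 2 * gh) = (V * a - 2^-1) - e * gd + 2^-1 * e ^+ 2 * gh.
    by rewrite -g0E; field.
  by field.
have -> : (2^-1 + M * e) * uu = 2^-1 * uu + e * (M * uu) by ring.
rewrite lerD2l ler_pM2l //.
have p1 : 0 <= eta * a * uu + 2^-1 * e * gh * uu.
  by rewrite addr_ge0 // ?mulr_ge0 // ltW.
have p2 : - (V * X) <= V * H * uu.
  rewrite -mulrN -mulrA ler_wpM2l // (le_trans _ XH) //.
  by rewrite -normrN ler_norm.
have p3 : (e * eta) * X <= H * uu.
  have ee : 0 <= e * eta by rewrite mulr_ge0 // ltW.
  have e11 : e * eta <= 1 by rewrite mulr_ile1 // ltW.
  apply: le_trans (ler_norm _) _; rewrite normrM (ger0_norm ee).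
  by apply: le_trans XH; rewrite ler_piMl.
have p4 : gd * uu <= (1 + gd * gd) * uu by rewrite ler_wpM2r //; nra.
have p5 : (V * H + (1 + gd * gd) + H) * uu <= M * uu by rewrite ler_wpM2r.
lra.
Qed.

(** Same notation, with [L] the Laplacian of [h]. The linearised operator gains at least [k]; the
    only harmful term is [eta * (e * L)] inside the bracket, and it uses up at most half of the
    gain. *)
Lemma perturbed_trace (N V a g0 L gd gh eta e k : R) :
  V * a - 2^-1 * g0 = 2^-1 -> 0 <= N -> 0 <= a -> 0 <= gh ->
  0 <= eta -> eta <= 1 -> 0 < e -> k <= V * L - N * gd -> e * `|L| <= k / 2 ->
  (V - e * eta) * (N * a - e * L) - N / 2 * (g0 - 2 * e * gd + e ^+ 2 * gh)
    <= N / 2 - e * (k / 2).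
Proof.
move=> disc N0 a0 gh0 eta0 eta1 e0 kL eL.
have g0E : 2^-1 * g0 = V * a - 2^-1 by lra.
have -> : (V - e * eta) * (N * a - e * L) - N / 2 * (g0 - 2 * e * gd + e ^+ 2 * gh) =
  N / 2 - e * ((V * L - N * gd) + eta * N * a + 2^-1 * e * N * gh - eta * (e * L)).
  have -> : N / 2 * (g0 - 2 * e * gd + e ^+ 2 * gh) =
     N * (V * a - 2^-1) - N * e * gd + 2^-1 * e ^+ 2 * N * gh.
    by rewrite -g0E; field.
  by field.
rewrite lerD2l lerN2 ler_pM2l //.
have p1 : 0 <= eta * N * a by rewrite !mulr_ge0.
have p2 : 0 <= 2^-1 * e * N * gh by rewrite !mulr_ge0 // ltW.
have p3 : eta * (e * L) <= k / 2.
  apply: le_trans eL; apply: le_trans (ler_norm _) _.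
  rewrite !normrM (ger0_norm eta0) (gtr0_norm e0).
  by rewrite ler_piMl // mulr_ge0 // ltW.
lra.
Qed.

End Barrier.

Lemma ler_norm1D_sqr (R : realType) (t : R) : `|t| <= 1 + t * t.
Proof.
have [t0|t0] := leP 0 t; first by rewrite ger0_norm //; nra.
by rewrite ltr0_norm //; nra.
Qed.

(** * Rigidity in the ball *)

Section BallRigidity.
Context {R : realType} {n : nat}.
Variables (f : 'rV[R]_n -> R) (Gam : set 'rV[R]_n).
Hypotheses (n0 : (0 < n)%N) (ed : elliptic_data f Gam).
Variables (v : 'rV[R]_n -> R) (a : R) (b : 'rV[R]_n).
Hypotheses (Cv : Ck 2 unit_ball v) (contv : {within closed_unit_ball, continuous v}).
Hypothesis v_pos : forall x, closed_unit_ball x -> 0 < v x.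
Hypotheses (a_pos : 0 < a) (ab : a ^+ 2 - dotv b b = 1).
Hypothesis super : forall x, unit_ball x -> conf_supersolution f Gam v x.
Let v0 : 'rV[R]_n -> R := quadr a (a / 2) b.
Hypothesis vbd : forall x, dotv x x = 1 -> v x = v0 x.

(* Strong maximum principle and Hopf boundary lemma at once. *)
Lemma hopf_slope y : unit_ball y -> v y < v0 y -> exists2 e, 0 < e &
  forall x, closed_unit_ball x -> v x <= v0 x - e * quadr (-1) 2^-1 0 x.
Proof using n0 ed Cv contv v_pos a_pos ab super vbd.
move=> By vy; have oB : open (unit_ball : set 'rV[R]_n) := open_unit_ball.
have le0 x := solution_le_v0 n0 ed Cv contv v_pos a_pos ab super vbd (x := x).
have v0p x : 0 < v0 x by exact: v0_pos.
pose dl := (v0 y - v y) / 2; have dl0 : 0 < dl by rewrite divr_gt0 // subr_gt0.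
(* Near [y] the gap [v0 - v] exceeds [dl], while [e * h <= e <= dl]: no contact can occur in the
   region where the barrier gives no control. *)
have [r r0 hole] : exists2 r, 0 < r &
    forall x, dotv (x - y) (x - y) < r -> dl < v0 x - v x.
  have cu : {for y, continuous (fun x => v0 x - v x)}.
    apply: continuousB; [exact: continuous_quadr|exact: Ck_continuous Cv By].
  have /(@cvgrPdist_lt _ _ _ (nbhs y)) /(_ _ dl0) := cu.
  move=> /nbhs_ballP [d /= d0 Hd]; exists (d ^+ 2) => [|x xr]; first by rewrite exprn_gt0.
  have xyd : `|x - y| < d.
    rewrite -(@ltr_pXn2r _ 2) ?nnegrE // ?ltW //.
    exact: le_lt_trans (norm_le_dotv _) xr.
  have := Hd x; rewrite -ball_normE /= distrC => /(_ xyd).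
  rewrite ltr_norml => /andP[_]; rewrite /dl.
  by move: (v0 y - v y) (v0 x - v x) => s t; lra.
have [S [h [e0 [k [[oS DS Ch] [e00 k0 hbd hD Lh]]]]]] :=
  barrier_exists By r0 v0p.
have Cv0 : Ck 2 S v0 by exact: Ck_quadr.
have BS x : unit_ball x -> S x by move=> /unit_ballW /DS.
have Cgd := CkW (Ck_graddot oS Cv0 Ch).
have CH := Ck_hess_bound oS Ch.
pose Mf x := v0 x * hess_bound h x + (1 + graddot v0 h x * graddot v0 h x) + hess_bound h x.
have [M M0 HM] : exists2 M, 0 < M & forall x, closed_unit_ball x -> Mf x <= M.
  apply: (compact_upper_bound (f := Mf) compact_unit_ball) => x /DS Sx.
  apply: (Ck_continuous (k := 0) _ Sx).
  apply: (CkD oS _ CH); apply: (CkD oS (CkM oS (Ck_leq (leq0n 2) Cv0) CH)).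
  exact (CkD oS (Ck_cst 0 S (1 : R)) (CkM oS Cgd Cgd)).
have [N N0 HN] : exists2 N, 0 < N & forall x, closed_unit_ball x -> 
    laplacian h x * laplacian h x <= N.
  apply: (compact_upper_bound (f := fun x => laplacian h x * laplacian h x) compact_unit_ball) => x /DS Sx.
  apply: (Ck_continuous (k := 0) _ Sx).
  have CL := Ck_laplacian oS Ch; exact (CkM oS CL CL).
(* The trace deficit will be [e * (k / 2)], which plays the small parameter of [no_touching];
   measured in it, the excess [M * e] has coefficient [2 * M / k]. *)
have M'0 : 0 <= 2 * M / k by rewrite divr_ge0 ?mulr_ge0 // ltW.
have [d d0 touch] := no_touching n0 ed M'0.
(* In this order: [perturbed_form] wants [e <= 1], the hole wants [e <= dl], [no_touching] wants
   [e * (k / 2) <= d], and [perturbed_trace] wants e |Lap h| <= k / 2, through |t| <= 1 + t^2. *)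
pose e := Num.min (Num.min 1 dl) (Num.min (2 * d / k) (k / 2 / (1 + N))).
have N1 : 0 < 1 + N by rewrite addr_gt0.
have [e1 [edl [ed' eN]]] : e <= 1 /\ e <= dl /\ e * (k / 2) <= d /\ e * (1 + N) <= k / 2.
  split; first by rewrite !ge_min lexx.
  split; first by rewrite !ge_min lexx orbT.
  split.
    have : e <= 2 * d / k by rewrite !ge_min lexx !orbT.
    by rewrite ler_pdivlMr //; lra.
  by rewrite -ler_pdivlMr // !ge_min lexx !orbT.
have ep : 0 < e by rewrite !lt_min ltr01 dl0 !divr_gt0 // mulr_gt0.
suff main x : closed_unit_ball x -> v x - v0 x + e * h x <= 0.
  exists (e * e0) => [|x Dx]; first by rewrite mulr_gt0.
  have [_ h2] := hD x Dx.
  rewrite quadr_z -mulrA; have := main x Dx.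
  have : e * (e0 * ((1 - dotv x x) / 2)) <= e * h x by rewrite ler_pM2l.
  by move: (e * (e0 * _)) (e * h x) (v x) (v0 x) => A B C D; lra.
have cF : {within closed_unit_ball, continuous (fun x => v x - (v0 x - e * h x))}.
  apply: within_continuousB => //; apply: within_continuous => z /DS Sz.
  apply: (Ck_continuous (k := 0) _ Sz).
  exact (CkB oS (Ck_leq (leq0n 2) Cv0) (CkZ e oS (Ck_leq (leq0n 2) Ch))).
have D0 : (closed_unit_ball : set 'rV[R]_n) !=set0 by exists y; exact: unit_ballW.
have [p Dp mx] := compact_max compact_unit_ball D0 cF.
pose m := v p - (v0 p - e * h p).
have FE z : v z - v0 z + e * h z = v z - (v0 z - e * h z) by rewrite opprB addrA addrAC.
rewrite FE => Dx; apply: le_trans (mx x Dx) _; rewrite leNgt; apply/negP => m0.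
have hp := hD p Dp.
have Bp : unit_ball p.
  have [//|p1] := unit_ball_or_sphere Dp.
  by move: m0; rewrite (vbd p1) (hbd p p1) mulr0 subr0 subrr ltxx.
have ehe : e * h p <= e by rewrite ger_pMr //; case: hp.
have pr : r <= dotv (p - y) (p - y).
  rewrite leNgt; apply/negP => /hole hole'; move: m0 hole' ehe edl.
  by move: (v p) (v0 p) (e * h p) => A B C; lra.
have Sp := DS p Dp; have lep : v p <= v0 p := le0 p Dp.
have m0' : 0 < m by [].
have mh : m <= e * h p by rewrite /m; move: lep; move: (v p) (v0 p) (e * h p) => A B C; lra.
(* Raising [v0 - e * h] by the positive maximum [m] makes it touch [v] from above at [p]. Because
   [v p <= v0 p] is already known, [m <= e * h p], so the value there is [v0 p - e * eta] with
   [0 <= eta <= 1]. *)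
pose eta := h p - m / e.
have eE : e * eta = e * h p - m by rewrite mulrBr mulrCA divff ?gt_eqF // mulr1.
have eta0 : 0 <= eta by rewrite subr_ge0 ler_pdivrMr // mulrC.
have eta1 : eta <= 1.
  have me : 0 <= m / e by rewrite divr_ge0 // ltW.
  by case: hp => h1 _; rewrite /eta lerBlDr (le_trans h1) // lerDl.
pose U z := v0 z - e * h z + m.
have CU : Ck 2 unit_ball U.
  apply: (Ck_sub BS); apply: (CkD oS _ (Ck_cst 2 S m)).
  exact (CkB oS Cv0 (CkZ e oS Ch)).
have vU z : unit_ball z -> v z <= U z.
  by move=> /unit_ballW /mx; rewrite lerBlDl.
have vUp : v p = U p by rewrite /U /m [RHS]addrC subrK.
have UpE : U p = v0 p - e * eta.
  by rewrite /U eE; ring.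
have ek : 0 < e * (k / 2) <= d by rewrite ed' mulr_gt0 // divr_gt0.
have disc : v0 p * a - 2^-1 * gradsq v0 p = 2^-1.
  by rewrite quadr_discr; move: ab => E; lra.
have gh0 : 0 <= gradsq h p by apply: sumr_ge0 => i _; exact: sqr_ge0.
have MEe : 2 * M / k * (e * (k / 2)) = M * e by field; rewrite gt_eqF.
apply: (touch (e * (k / 2)) unit_ball v U p ek oB Cv CU Bp (v_pos Dp) vU vUp (super Bp)).
  move=> u; rewrite (derive2_perturbation e m u oS Cv0 Ch Sp).
  rewrite (gradsq_perturbation e m oS Cv0 Ch Sp) derive2_quadr UpE MEe.
  apply: (perturbed_form disc (ltW (v0p p)) (ltW a_pos) (hess_bound_ge0 h p) gh0
    (dotv_ge0 u) (hess_boundP u oS Ch Sp) eta0 eta1 ep e1).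
  exact (HM p Dp).
rewrite (laplacian_perturbation e m oS Cv0 Ch Sp) (gradsq_perturbation e m oS Cv0 Ch Sp).
rewrite laplacian_quadr UpE.
apply: (perturbed_trace disc (ler0n _ _) (ltW a_pos) gh0 eta0 eta1 ep (Lh p Dp pr)).
apply: le_trans eN; rewrite ler_pM2l //.
by apply: le_trans (ler_norm1D_sqr _) _; rewrite lerD2l; exact: HN.
Qed.

Lemma ball_rigidity x : closed_unit_ball x -> v x = v0 x.
Proof using n0 ed Cv contv v_pos a_pos ab super vbd.
move=> Dx; have [Bx|x1] := unit_ball_or_sphere Dx; last exact: vbd.
apply/eqP; rewrite eq_le (solution_le_v0 n0 ed Cv contv v_pos a_pos ab super vbd Dx) /=.
rewrite leNgt; apply/negP => lt.
have [e e0 H] := hopf_slope Bx lt.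
exact (no_negative_slope n0 ed Cv contv v_pos a_pos ab super vbd e0 H).
Qed.

End BallRigidity.

(** * Stereographic charts *)

Section RowDerivatives.
Context {R : realType} {m : nat}.
Implicit Types (x u : 'rV[R]_m).

Lemma is_derive_rowP N (F : 'rV[R]_m -> 'rV[R]_N) x u (dF : 'rV[R]_N) :
  (forall j, is_derive x u (fun y => F y 0 j) (dF 0 j)) -> is_derive x u F dF.
Proof.
move=> h; have d : derivable F x u.
  by apply/derivable_mxP => i j; rewrite ord1; case: (h j).
apply: DeriveDef => //; rewrite derive_mx //; apply/rowP => j; rewrite mxE.
by case: (h j).
Qed.

Lemma is_derive_coord_row N (F : 'rV[R]_m -> 'rV[R]_N) x u (dF : 'rV[R]_N) j :
  is_derive x u F dF -> is_derive x u (fun y => F y 0 j) (dF 0 j).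
Proof.
case=> d <-; apply: DeriveDef; first by move/derivable_mxP: d; apply.
by rewrite derive_mx // mxE.
Qed.

Lemma is_derive_scale N (k : 'rV[R]_m -> R) (F : 'rV[R]_m -> 'rV[R]_N) x u dk dF :
  is_derive x u k dk -> is_derive x u F dF ->
  is_derive x u (fun y => k y *: F y) (dk *: F x + k x *: dF).
Proof.
move=> hk hF; apply: is_derive_rowP => j.
have -> : (fun y => (k y *: F y) 0 j) = k * (fun y => F y 0 j).
  by apply/funext => y; rewrite mxE.
apply: is_derive_eq (is_deriveM hk (is_derive_coord_row j hF)) _.
by rewrite !mxE addrC [_ *: dk]mulrC.
Qed.

Lemma is_derive_mulmx N M (F : 'rV[R]_m -> 'rV[R]_N) (A : 'M[R]_(N, M)) x u dF :
  is_derive x u F dF -> is_derive x u (fun y => F y *m A) (dF *m A).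
Proof.
move=> hF; apply: is_derive_rowP => j.
have -> : (fun y => (F y *m A) 0 j) = \sum_(i < N) (A i j *: (fun y => F y 0 i)).
  by apply/funext => y; rewrite fct_sumE mxE; apply: eq_bigr => i _; rewrite mulrC.
apply: is_derive_eq (is_derive_sum (fun i => is_deriveZ (A i j) (is_derive_coord_row i hF))) _.
by rewrite mxE; apply: eq_bigr => i _; rewrite mulrC.
Qed.

Lemma is_derive_dotv N (F G : 'rV[R]_m -> 'rV[R]_N) x u dF dG :
  is_derive x u F dF -> is_derive x u G dG ->
  is_derive x u (fun y => dotv (F y) (G y)) (dotv dF (G x) + dotv (F x) dG).
Proof.
move=> hF hG.
have -> : (fun y => dotv (F y) (G y)) = \sum_(i < N) ((fun y => F y 0 i) * (fun y => G y 0 i)).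
  by apply/funext => y; rewrite fct_sumE.
have := is_derive_sum (fun i => is_deriveM (is_derive_coord_row i hF) (is_derive_coord_row i hG)).
move=> h; apply: is_derive_eq h _.
by rewrite /dotv -big_split /=; apply: eq_bigr => i _; rewrite addrC [_ *: dF 0 i]mulrC.
Qed.

End RowDerivatives.

Section ConformalChart.
Context {R : realType} {m N : nat}.
Variables (E : 'M[R]_(m, N)) (q : 'rV[R]_N).
Hypotheses (EE : E *m E^T = 1%:M) (qE : q *m E^T = 0) (qq : dotv q q = 1).
Implicit Types x u w : 'rV[R]_m.

(* Inverse stereographic projection from q onto the unit sphere of the span of
   q and the rows of E. *)
Definition chart x : 'rV[R]_N :=
  (1 + dotv x x)^-1 *: (2 *: (x *m E) + (dotv x x - 1) *: q).

Lemma dotv_mulE x u : dotv (x *m E) (u *m E) = dotv x u.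
Proof using EE. by rewrite !dotvE trmx_mul mulmxA -(mulmxA x) EE mulmx1. Qed.

Lemma dotv_mulEq x : dotv (x *m E) q = 0.
Proof using qE. by rewrite dotvC dotvE trmx_mul mulmxA qE mul0mx mxE. Qed.

Lemma chart_den_gt0 x : 0 < 1 + dotv x x.
Proof using. by rewrite ltr_pwDl // dotv_ge0. Qed.

Lemma chart_sphere x : dotv (chart x) (chart x) = 1.
Proof using EE qE qq.
have d0 := chart_den_gt0 x; rewrite /chart dotvZl dotvZr.
rewrite dotvDl !dotvDr !dotvZl !dotvZr dotv_mulE (dotvC q) !dotv_mulEq qq.
by move: (dotv x x) d0 => s d0; field; rewrite gt_eqF.
Qed.

Lemma chart_dotq x : dotv (chart x) q = (dotv x x - 1) / (1 + dotv x x).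
Proof using qE qq.
by rewrite /chart dotvZl dotvDl !dotvZl dotv_mulEq qq mulr0 add0r mulr1 mulrC.
Qed.

Lemma one_sub_chart_dotq x : 1 - dotv (chart x) q = 2 / (1 + dotv x x).
Proof using qE qq.
have d0 := chart_den_gt0 x; rewrite chart_dotq.
by move: (dotv x x) d0 => s d0; field; rewrite gt_eqF.
Qed.

Lemma chart_dotE x u : dotv (chart x) (u *m E) = 2 * dotv x u / (1 + dotv x x).
Proof using EE qE.
rewrite /chart dotvZl dotvDl !dotvZl dotv_mulE (dotvC q) dotv_mulEq mulr0 addr0.
by rewrite mulrC.
Qed.

Lemma Ck_chart k : Ck k setT chart.
Proof using.
have Cs : Ck k setT (fun x : 'rV[R]_m => dotv x x).
  by apply: (Ck_dotv openT); exact: (Ck_id k openT).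
apply: (Ck_scale openT).
  apply: (CkV openT) => [x _|]; first by rewrite gt_eqF // chart_den_gt0.
  exact (CkD openT (Ck_cst k setT (1 : R)) Cs).
apply: (Ck_addv openT); apply: (Ck_scale openT).
- exact: Ck_cst.
- exact (Ck_mulmx E openT (Ck_id k openT)).
- exact (CkB openT Cs (Ck_cst k setT (1 : R))).
- exact: Ck_cst.
Qed.

Lemma differentiable_chart x : differentiable chart x.
Proof using. exact: Ck_row_differentiable openT (Ck_chart 1) I. Qed.

(** The derivative is expressed through [chart x] itself, so that conformality and tangency reduce
    to the products of this point with itself, with [q] and with [u *m E]. *)
Lemma derive_chart x u :
  'D_u chart x = (2 / (1 + dotv x x)) *: (u *m E + dotv x u *: q - dotv x u *: chart x).
Proof using.
have d0 := chart_den_gt0 x.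
have d0' : 1 + dotv x x != 0 by rewrite gt_eqF.
have hs := is_derive_dotvv x u.
have h1 : is_derive x u (fun y : 'rV[R]_m => 1 + dotv y y) (2 * dotv x u).
  by apply: is_derive_eq (is_deriveD (is_derive_cst (1 : R) x u) hs) _; rewrite add0r.
have hV : is_derive x u (fun y : 'rV[R]_m => (1 + dotv y y)^-1)
    (- (1 + dotv x x) ^- 2 * (2 * dotv x u)).
  pose g (y : 'rV[R]_m) : R := 1 + dotv y y.
  case: h1 => dd de; apply: DeriveDef; first exact (derivableV (f := g) d0' dd).
  by rewrite (deriveV (f := g) d0' dd) de.
have hB := is_deriveB hs (is_derive_cst (1 : R) x u).
have hE := is_derive_scale (is_derive_cst (2 : R) x u) (is_derive_mulmx E (is_derive_id x u)).
have hq := is_derive_scale hB (is_derive_cst q x u).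
have [_ ->] := is_derive_scale hV (is_deriveD hE hq).
rewrite /chart /cst; apply/rowP => j; rewrite !mxE.
rewrite -[(_ - _) x]/(dotv x x - 1).
move: (dotv x x) (dotv x u) d0' (\sum_(k < m) x 0 k * E k j) (\sum_(k < m) u 0 k * E k j) (q 0 j).
by move=> s t d1 A B C; rewrite /GRing.scale /=; field.
Qed.

Lemma chart_conformal x u w :
  dotv ('D_u chart x) ('D_w chart x) = (2 / (1 + dotv x x)) ^+ 2 * dotv u w.
Proof using EE qE qq.
have d0 : 1 + dotv x x != 0 by rewrite gt_eqF // chart_den_gt0.
have Ps := chart_sphere x; have PE := chart_dotE x; have Pq := chart_dotq x.
rewrite !derive_chart dotvZl dotvZr mulrA -expr2; congr (_ * _).
move: (chart x) Ps PE Pq => P Ps PE Pq.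
rewrite !dotvDl !dotvDr !dotvNl !dotvNr !dotvZl !dotvZr dotv_mulE.
rewrite (dotvC q (w *m E)) !dotv_mulEq qq Ps (dotvC (u *m E) P) !PE (dotvC q P) Pq.
by move: (dotv x x) (dotv x u) (dotv x w) (dotv u w) d0 => s t r y d0; field.
Qed.

Lemma chart_tangent x u : dotv (chart x) ('D_u chart x) = 0.
Proof using EE qE qq.
have d0 : 1 + dotv x x != 0 by rewrite gt_eqF // chart_den_gt0.
have Ps := chart_sphere x; have PE := chart_dotE x; have Pq := chart_dotq x.
rewrite derive_chart; move: (chart x) Ps PE Pq => P Ps PE Pq.
rewrite dotvZr !dotvDr dotvNr !dotvZr Ps PE Pq.
by move: (dotv x x) (dotv x u) d0 => s t d0; field.
Qed.

End ConformalChart.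

Section HemisphereChart.
Context {R : realType} {n : nat}.
Local Notation point := 'rV[R]_(n + 1).
Implicit Types (p : point) (x : 'rV[R]_n).

Lemma dotv_row_mx k l (a c : 'rV[R]_k) (b d : 'rV[R]_l) :
  dotv (row_mx a b) (row_mx c d) = dotv a c + dotv b d.
Proof. by rewrite !dotvE tr_row_mx mul_row_col mxE. Qed.

Lemma dotv_submx p r :
  dotv p r = dotv (lsubmx p) (lsubmx r) + height p * height r.
Proof.
by rewrite -{1}[p]hsubmxK -{1}[r]hsubmxK dotv_row_mx [X in _ + X]/dotv big_ord1.
Qed.

Lemma row_mx_height p : p = row_mx (lsubmx p) (height p)%:M.
Proof.
rewrite -{1}[p]hsubmxK; congr row_mx; apply/rowP => i.
by rewrite !ord1 [RHS]mxE eqxx mulr1n.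
Qed.

Definition north_frame : 'M[R]_(n, n + 1) := row_mx 1%:M 0.
Definition south_pole : point := row_mx 0 (-1)%:M.

Lemma north_frame_orth : north_frame *m north_frame^T = 1%:M.
Proof. by rewrite tr_row_mx mul_row_col trmx1 trmx0 mulmx1 mul0mx addr0. Qed.

Lemma south_pole_frame : south_pole *m north_frame^T = 0.
Proof. by rewrite tr_row_mx mul_row_col trmx1 trmx0 mulmx1 mulmx0 addr0. Qed.

Lemma south_pole_unit : dotv south_pole south_pole = 1.
Proof. by rewrite dotv_row_mx dot0v add0r /dotv big_ord1 mxE eqxx mulr1n mulrNN mulr1. Qed.

Lemma stereo_invE : @stereo_inv R n = chart north_frame south_pole.
Proof.
apply/funext => x; rewrite /stereo_inv /chart; congr (_ *: _).
rewrite mul_mx_row mulmx1 mulmx0 !scale_row_mx add_row_mx !scaler0 addr0 add0r.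
by rewrite scale_scalar_mx mulrN1 opprB.
Qed.

Lemma stereo_inv_sphere x : sphere (stereo_inv x).
Proof.
rewrite stereo_invE; exact: (chart_sphere north_frame_orth south_pole_frame south_pole_unit).
Qed.

Lemma height_stereo_inv x : height (stereo_inv x) = (1 - dotv x x) / (1 + dotv x x).
Proof. by rewrite /stereo_inv /height linearZ /= row_mxKr !mxE eqxx mulr1n mulrC. Qed.

Lemma lsubmx_stereo_inv x : lsubmx (stereo_inv x) = (2 / (1 + dotv x x)) *: x.
Proof. by rewrite /stereo_inv linearZ /= row_mxKl scalerA mulrC. Qed.

Lemma stereo_invK x : stereo (stereo_inv x) = x.
Proof.
rewrite /stereo height_stereo_inv lsubmx_stereo_inv scalerA -[RHS]scale1r.
have := dotv_ge0 x; move: (dotv x x) => s s0; congr (_ *: _).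
by field; rewrite !gt_eqF //; lra.
Qed.

Lemma dotv_stereo p : sphere p -> 0 <= height p ->
  dotv (stereo p) (stereo p) = (1 - height p) / (1 + height p).
Proof.
rewrite /sphere /= dotv_submx => pp h0; rewrite /stereo dotvZl dotvZr.
have -> : dotv (lsubmx p) (lsubmx p) = 1 - height p ^+ 2.
  by rewrite -pp expr2 addrK.
by move: (height p) h0 => h h0; field; rewrite gt_eqF //; lra.
Qed.

Lemma stereoK p : closed_hemisphere p -> stereo_inv (stereo p) = p.
Proof.
move=> [pp h0]; rewrite /stereo_inv (dotv_stereo pp h0) /stereo.
rewrite [RHS]row_mx_height scale_row_mx !scalerA scale_scalar_mx.
have h1 : 1 + height p != 0 by rewrite gt_eqF // ltr_pwDl.
move: (height p) h0 h1 => h h0 h1; congr row_mx.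
  by rewrite -[RHS]scale1r; congr (_ *: _); field; rewrite h1 /= gt_eqF //; lra.
by congr (_%:M); field; rewrite h1 /= gt_eqF //; lra.
Qed.

Lemma stereo_inv_hemisphere x : unit_ball x -> hemisphere (stereo_inv x).
Proof.
move=> x1; split; first exact: stereo_inv_sphere.
by rewrite height_stereo_inv divr_gt0 ?subr_gt0 // chart_den_gt0.
Qed.

Lemma stereo_inv_closed_hemisphere x : closed_unit_ball x -> closed_hemisphere (stereo_inv x).
Proof.
move=> x1; split; first exact: stereo_inv_sphere.
by rewrite height_stereo_inv divr_ge0 ?subr_ge0 // ltW // chart_den_gt0.
Qed.

Lemma stereo_inv_equator x : dotv x x = 1 -> equator (stereo_inv x).
Proof.
move=> x1; split; first exact: stereo_inv_sphere.
by rewrite height_stereo_inv x1 subrr mul0r.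
Qed.

Lemma stereo_closed_ball p : closed_hemisphere p -> closed_unit_ball (stereo p).
Proof.
move=> [pp h0]; rewrite /closed_unit_ball /= (dotv_stereo pp h0).
by rewrite ler_pdivrMr ?ltr_pwDl // mul1r; lra.
Qed.

End HemisphereChart.

(** [Ck] constrains the total function [g] at each point separately, so it passes to unions of
    sets. *)
Lemma Ck_local (R : realType) k m (W : normedModType R) (U : set 'rV[R]_m)
    (g : 'rV[R]_m -> W) :
  (forall x, U x -> exists2 V, V x & Ck k V g) -> Ck k U g.
Proof.
elim: k g => [|k IH] g h.
  by move=> x /h [V Vx]; apply.
split=> [x /h [V Vx [c _ _]]|i x /h [V Vx [_ d _]]|i].
- exact (c x Vx).
- exact (d i x Vx).
- by apply: IH => x /h [V Vx [_ _ D]]; exists V; [exact Vx|exact (D i)].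
Qed.

(** * Transfer of the ball rigidity to the hemisphere *)

Section HemisphereRigidity.
Context {R : realType} {n : nat}.
Variables (f : 'rV[R]_n -> R) (Gam : set 'rV[R]_n) (rho : 'rV[R]_(n + 1) -> R).
Hypotheses (n3 : (3 <= n)%N) (ed : elliptic_data f Gam).
Hypotheses (Crho : Ck_on 2 closed_hemisphere rho)
  (super : supersolution f Gam (conformal_metric rho)).
Implicit Types (x : 'rV[R]_n).

(* The metric g is v^-2 |dx|^2 in the stereographic chart. *)
Definition conf_factor x : R :=
  expR (- rho (stereo_inv x)) * ((1 + dotv x x) / 2).

Lemma conf_factor_gt0 x : 0 < conf_factor x.
Proof using. by rewrite mulr_gt0 ?expR_gt0 // divr_gt0 // chart_den_gt0. Qed.

Lemma Ck_stereo_inv k : Ck k setT (@stereo_inv R n).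
Proof using. by rewrite stereo_invE; exact: Ck_chart. Qed.

Lemma Ck_conf_extension k (V : set 'rV[R]_n) Q (h : 'rV[R]_(n + 1) -> R) :
  open V -> open Q -> (forall y, V y -> Q (stereo_inv y)) -> Ck k Q h ->
  Ck k V (fun y => expR (- h (stereo_inv y)) * ((1 + dotv y y) / 2)).
Proof using.
move=> oV oO VO Ch; apply: (CkM oV).
  apply: (Ck_expR oV); apply: (CkN oV).
  exact: (Ck_comp oV oO VO (Ck_sub (@subsetT _ V) (Ck_stereo_inv k)) Ch).
apply: (CkM oV _ (Ck_cst k V (2^-1 : R))); apply: (CkD oV (Ck_cst k V (1 : R))).
by apply: (Ck_dotv oV); exact: (Ck_id k oV).
Qed.

Lemma open_stereo_inv_preimage Q : open Q -> open (stereo_inv @^-1` Q : set 'rV[R]_n).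
Proof using.
move=> oO; apply: open_comp oO => x _.
exact: (Ck_continuous (Ck_stereo_inv 0)).
Qed.

Lemma Ck_conf_factor : Ck 2 unit_ball conf_factor.
Proof using Crho.
apply: Ck_local => x Bx.
have [Q [h [oO Ox Ch hE]]] := Crho (stereo_inv_closed_hemisphere (unit_ballW Bx)).
pose V := unit_ball `&` (stereo_inv @^-1` Q : set 'rV[R]_n).
have oV : open V by apply: openI; [exact: open_unit_ball|exact: open_stereo_inv_preimage].
exists V; first by split.
have VO y : V y -> Q (stereo_inv y) by case.
apply: (Ck_ext oV _ (Ck_conf_extension oV oO VO Ch)) => y [/unit_ballW Dy Oy].
by rewrite /conf_factor -(hE _ Oy (stereo_inv_closed_hemisphere Dy)).
Qed.

(** At a boundary point the local extension of [rho] agrees with it only on the hemisphere side,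
    whence continuity within the closed ball; this is the only boundary regularity that the ball
    argument takes as input. *)
Lemma conf_factor_continuous : {within closed_unit_ball, continuous conf_factor}.
Proof using Crho.
apply/subspace_continuousP => x Dx.
have [Q [h [oO Ox Ch hE]]] := Crho (stereo_inv_closed_hemisphere Dx).
pose V := (stereo_inv @^-1` Q : set 'rV[R]_n).
have oV : open V by exact: open_stereo_inv_preimage.
have C := Ck_continuous (Ck_conf_extension oV oO (fun y Vy => Vy) Ch) (Ox : V x).
pose g (y : 'rV[R]_n) := expR (- h (stereo_inv y)) * ((1 + dotv y y) / 2).
have gE y : V y -> closed_unit_ball y -> g y = conf_factor y.
  by move=> Vy Dy; rewrite /g (hE _ Vy (stereo_inv_closed_hemisphere Dy)).
suff : conf_factor @ within closed_unit_ball (nbhs x) --> g x by rewrite (gE x Ox Dx).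
have nE : {near within closed_unit_ball (nbhs x), g =1 conf_factor}.
  have nV : nbhs x V by apply: open_nbhs_nbhs.
  by apply: filterS nV => y; exact: gE.
exact: cvg_trans (near_eq_cvg nE) (cvg_within_filter _ C).
Qed.

Lemma chart_metric_conf x :
  chart_metric (conformal_metric rho) x = ((conf_factor x)^-1 ^+ 2)%:M.
Proof using.
apply/matrixP => i j; rewrite !mxE /conformal_metric /round_metric stereo_invE.
rewrite (chart_conformal north_frame_orth south_pole_frame south_pole_unit).
rewrite -stereo_invE dotv_basis mxE eqxx /= -[RHS]mulr_natr mulrA [j == i]eq_sym; congr (_ * _).
rewrite /conf_factor invfM -expRN opprK invf_div [RHS]exprMn; congr (_ * _).
by rewrite expr2 -expRD; congr expR; ring.
Qed.

Lemma conf_factor_supersolution x : unit_ball x -> conf_supersolution f Gam conf_factor x.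
Proof using n3 Crho super.
move=> Bx; have [lam [E G1 G2]] := super (stereo_inv_hemisphere Bx).
exists lam; split => //; move: E; rewrite /schouten_operator stereo_invK.
by rewrite (schouten_conformally_flat open_unit_ball Ck_conf_factor
  (fun y _ => conf_factor_gt0 y) (fun y _ => chart_metric_conf y) n3 Bx).
Qed.

(** In the chart, [a + b.p] times (1 + |x|^2) / 2 is the quadratic a (1 + |x|^2) / 2 + b.x, so both
    the boundary hypothesis and the conclusion are those of [ball_rigidity]. *)
Lemma hemisphere_rigidity (a : R) (b : 'rV[R]_n) : 0 < a -> a ^+ 2 - dotv b b = 1 ->
  (forall p, equator p -> expR (- rho p) = a + dotv b (lsubmx p)) ->
  forall p, closed_hemisphere p -> expR (- rho p) = a + dotv b (lsubmx p).
Proof using n3 ed Crho super.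
move=> a0 ab bd p Hp; have n0 : (0 < n)%N by case: n n3.
have vbd x : dotv x x = 1 -> conf_factor x = quadr a (a / 2) b x.
  move=> x1; rewrite /conf_factor (bd _ (stereo_inv_equator x1)) lsubmx_stereo_inv.
  by rewrite /quadr x1 dotvZr; field.
have := ball_rigidity n0 ed Ck_conf_factor conf_factor_continuous
  (fun x _ => conf_factor_gt0 x) a0 ab conf_factor_supersolution vbd (stereo_closed_ball Hp).
have -> : lsubmx p = (2 / (1 + dotv (stereo p) (stereo p))) *: stereo p.
  by rewrite -{1}(stereoK Hp) lsubmx_stereo_inv.
move: (stereo p) (stereoK Hp) => y yK; have d0 := chart_den_gt0 y.
rewrite /conf_factor yK dotvZr /quadr.
move: (dotv y y) (dotv b y) d0 (expR _) => s t d0 w E.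
have s0 : 1 + s != 0 by rewrite gt_eqF.
apply: (mulIf (_ : (1 + s) / 2 != 0)); first by rewrite mulf_neq0 // invr_eq0 pnatr_eq0.
by rewrite E; field.
Qed.

End HemisphereRigidity.

(** * Conformal maps of flat space *)

Section VectorSchwarz.
Context {R : realType} {m N : nat}.
Implicit Types (F : 'rV[R]_m -> 'rV[R]_N).

Lemma derive_coord_row k U F u x j : open U -> Ck k.+1 U F -> U x ->
  ('D_u F x) 0 j = 'D_u (fun y => F y 0 j) x.
Proof. by move=> oU CF Ux; apply: derive_row; exact: Ck_row_differentiable oU CF Ux. Qed.

Lemma Ck_derive_row k U F u : open U -> Ck k.+1 U F -> Ck k U ('D_u F).
Proof.
move=> oU CF; apply/Ck_rowP => // j; have CFj := (Ck_rowP _ _ oU).1 CF j.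
refine (Ck_ext oU _ (Ck_derive u oU CFj)) => x Ux.
by rewrite (derive_coord_row u j oU CF Ux).
Qed.

Lemma derive_sym_row U F u v x : open U -> Ck 2 U F -> U x ->
  'D_v ('D_u F) x = 'D_u ('D_v F) x.
Proof.
move=> oU CF Ux; apply/rowP => j; have CFj := (Ck_rowP _ _ oU).1 CF j.
have key w z : ('D_w ('D_z F) x) 0 j = 'D_w ('D_z (fun y => F y 0 j)) x.
  rewrite (derive_coord_row w j oU (Ck_derive_row z oU CF) Ux).
  apply: near_eq_derive; apply: (open_near_eq oU Ux) => y Uy.
  exact: derive_coord_row oU CF Uy.
exact (etrans (key v u) (etrans (derive_sym u v oU CFj Ux) (esym (key u v)))).
Qed.

Lemma derive_dotv_row U (F G : 'rV[R]_m -> 'rV[R]_N) u x : open U -> Ck 1 U F -> Ck 1 U G -> U x ->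
  'D_u (fun y => dotv (F y) (G y)) x = dotv ('D_u F x) (G x) + dotv (F x) ('D_u G x).
Proof.
move=> oU CF CG Ux.
have dF := derivableP (diff_derivable (v := u) (Ck_row_differentiable oU CF Ux)).
have dG := derivableP (diff_derivable (v := u) (Ck_row_differentiable oU CG Ux)).
by have [_ ->] := is_derive_dotv dF dG.
Qed.

End VectorSchwarz.

(** The squared norm of the tensor of products of second and first derivatives of a conformal map,
    [g] being the gradient of its factor theta. *)
Lemma sum_cyclic_sq (R : realType) (m : nat) (g : 'I_m -> R) :
  \sum_i \sum_l \sum_k
    (2^-1 * ((i == k)%:R * g l + (l == k)%:R * g i - (i == l)%:R * g k)) ^+ 2 =
  (3 * m%:R - 2) / 4 * \sum_i g i ^+ 2.
Proof.
set G := \sum_i g i ^+ 2.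
have dd (P : bool) : (P%:R : R) * P%:R = P%:R by case: P; rewrite ?mulr1 ?mulr0.
have S1 i l : \sum_k (2^-1 * ((i == k)%:R * g l + (l == k)%:R * g i - (i == l)%:R * g k)) ^+ 2
   = 4^-1 * (g l ^+ 2 + g i ^+ 2 + (i == l)%:R * G - 2 * ((i == l)%:R * (g i * g l))).
  transitivity (\sum_k (4^-1 * ((k == i)%:R * (g l ^+ 2 + 2 * ((l == k)%:R * (g i * g l))
     - 2 * ((i == l)%:R * (g l * g k)))
     + (k == l)%:R * (g i ^+ 2 - 2 * ((i == l)%:R * (g i * g k)))
     + (i == l)%:R * g k ^+ 2))).
    apply: eq_bigr => k _; rewrite (eq_sym k i) (eq_sym k l).
    have := dd (i == k); have := dd (l == k); have := dd (i == l).
    move: ((i == l)%:R : R) ((l == k)%:R : R) ((i == k)%:R : R) (g i) (g l) (g k).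
    move=> p q r A B C pp qq rr.
    transitivity (4^-1 * (r * r * B ^+ 2 + q * q * A ^+ 2 + p * p * C ^+ 2
      + 2 * (r * q * A * B) - 2 * (r * p * B * C) - 2 * (q * p * A * C))); first by field.
    by rewrite pp qq rr; field.
  rewrite -mulr_sumr !big_split /= sum_delta sum_delta -mulr_sumr -/G.
  by rewrite (eq_sym l i); ring.
rewrite (eq_bigr (fun i => 4^-1 * (2 * G + (m%:R - 2) * g i ^+ 2))) => [|i _].
  rewrite -mulr_sumr big_split /= sumr_const card_ord -[_ *+ m]mulr_natl -mulr_sumr -/G.
  by field.
rewrite (eq_bigr (fun l => 4^-1 * (g l ^+ 2 + (g i ^+ 2
    + (l == i)%:R * (G - 2 * (g i * g l)))))) => [|l _].
  rewrite -mulr_sumr !big_split /= sumr_const card_ord -[_ *+ m]mulr_natl sum_delta -/G.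
  by ring.
by rewrite S1 (eq_sym l i); ring.
Qed.

(** [d i l] stands for the second derivatives of theta; the Kronecker symbol keeps only the
    diagonal, and the sum becomes a multiple of the Laplacian. *)
Lemma sum_trace_contract (R : realType) (m : nat) (c : 'I_m -> R) (d : 'I_m -> 'I_m -> R) :
  (forall i, d i i = c i) ->
  \sum_i \sum_l ((l == i)%:R * d i l - 2^-1 * c l - 2^-1 * c i) = (1 - m%:R) * \sum_i c i.
Proof.
move=> dc; set C := \sum_i c i.
rewrite (eq_bigr (fun i => (1 - m%:R / 2) * c i - 2^-1 * C)) => [|i _].
  by rewrite sumrB -mulr_sumr sumr_const card_ord -[_ *+ m]mulr_natl -/C; field.
rewrite !sumrB sum_delta dc -mulr_sumr sumr_const card_ord -[_ *+ m]mulr_natl -/C.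
by field.
Qed.

Lemma dotv_suml (R : realType) N (I : finType) (F : I -> 'rV[R]_N) w :
  dotv (\sum_i F i) w = \sum_i dotv (F i) w.
Proof. by rewrite dotvE mulmx_suml summxE; apply: eq_bigr => i _; rewrite dotvE. Qed.

Lemma sum_dotv_diag (R : realType) m N (h : 'I_m -> 'rV[R]_N) (g : 'I_m -> 'I_m -> R) :
  \sum_i \sum_l (dotv (h i) (h l) - g i l) =
  dotv (\sum_i h i) (\sum_i h i) - \sum_i \sum_l g i l.
Proof.
rewrite dotv_suml -sumrB; apply: eq_bigr => i _; rewrite sumrB; congr (_ - _).
by rewrite dotvC dotv_suml; apply: eq_bigr => l _; rewrite dotvC.
Qed.

Section FlatConformal.
Context {R : realType} {m : nat}.
Variables (Y : 'rV[R]_m -> 'rV[R]_m) (theta : 'rV[R]_m -> R).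
Hypotheses (CY : Ck 3 setT Y) (Ct : Ck 2 setT theta) (t0 : forall x, 0 < theta x).
Hypothesis conf : forall x i j,
  dotv ('D_(vbasis i) Y x) ('D_(vbasis j) Y x) = (i == j)%:R * theta x.
Implicit Types (x : 'rV[R]_m) (i j k l : 'I_m).

Let Yd i := 'D_(vbasis i) Y.
Let H i j := 'D_(vbasis j) (Yd i).
Let td i := 'D_(vbasis i) theta.
Let T i j k x := dotv (H i j x) (Yd k x).

Lemma Ck_frame i : Ck 2 setT (Yd i). Proof using CY. exact: Ck_derive_row openT CY. Qed.
Lemma Ck_frame2 i j : Ck 1 setT (H i j). Proof using CY. exact: Ck_derive_row openT (Ck_frame i). Qed.

Lemma frame2_sym i j x : H i j x = H j i x.
Proof using CY. exact: derive_sym_row openT (CkW CY) I. Qed.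

Lemma frame2_cyclic i j k x : T i j k x + T k j i x = (i == k)%:R * td j x.
Proof using CY Ct conf.
have -> : (i == k)%:R * td j x = 'D_(vbasis j) (fun y => dotv (Yd i y) (Yd k y)) x.
  have -> : (fun y => dotv (Yd i y) (Yd k y)) = (i == k)%:R *: theta.
    by apply/funext => y; rewrite conf.
  have dt := Ck_differentiable openT Ct (I : setT x).
  by rewrite (deriveZ _ (diff_derivable (v := vbasis j) dt)).
rewrite (derive_dotv_row _ openT (CkW (Ck_frame i)) (CkW (Ck_frame k)) I).
by rewrite -/(H i j) -/(H k j) /T (dotvC (Yd i x)).
Qed.

(** The argument of Koszul: [T] is symmetric in its first two indices, and differentiating the
    conformality relation gives three sums that determine it. *)
Lemma frame2_dotE i j k x : T i j k x =
  2^-1 * ((i == k)%:R * td j x + (j == k)%:R * td i x - (i == j)%:R * td k x).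
Proof using CY Ct conf.
have Tsym a b c : T a b c x = T b a c x by rewrite /T frame2_sym.
rewrite -(frame2_cyclic i j k) -(frame2_cyclic j i k) -(frame2_cyclic i k j).
rewrite (Tsym k j i) (Tsym k i j) (Tsym j i k) (Tsym i k j).
by move: (T i j k x) (T j k i x) (T k i j x) => A B C; field.
Qed.

Lemma derive_frame2_dot i j k l x :
  'D_(vbasis l) (T i j k) x = dotv ('D_(vbasis l) (H i j) x) (Yd k x) + dotv (H i j x) (H k l x).
Proof using CY. exact: derive_dotv_row openT (Ck_frame2 i j) (CkW (Ck_frame k)) I. Qed.

(** The vectors [Yd k x] form an orthogonal basis of squared length [theta x]: the Jacobian is
    square, so [J *m J^T] scalar makes [J^T *m J] the same scalar. *)
Lemma conf_frame (a b : 'rV[R]_m) x : theta x * dotv a b = \sum_k dotv a (Yd k x) * dotv b (Yd k x).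
Proof using t0 conf.
pose J : 'M[R]_m := \matrix_k Yd k x.
have aJ (c : 'rV[R]_m) k : (c *m J^T) 0 k = dotv c (Yd k x).
  by rewrite mxE; apply: eq_bigr => j _; rewrite !mxE.
have JJ : J *m J^T = (theta x)%:M.
  apply/matrixP => i j; rewrite !mxE -[RHS]mulr_natl -(conf x).
  by apply: eq_bigr => k _; rewrite !mxE.
have th0 : theta x != 0 by rewrite gt_eqF.
have JJ' : J^T *m J = (theta x)%:M.
  have e1 : J *m ((theta x)^-1 *: J^T) = 1%:M.
    by rewrite -scalemxAr JJ scale_scalar_mx mulVf.
  have e2 := mulmx1C e1; rewrite -scalemxAl in e2.
  by rewrite -[LHS]scale1r -(mulfV th0) -scalerA e2 scale_scalar_mx mulr1.
have -> : \sum_k dotv a (Yd k x) * dotv b (Yd k x) = dotv (a *m J^T) (b *m J^T).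
  by apply: eq_bigr => k _; rewrite !aJ.
rewrite [RHS]dotvE trmx_mul trmxK mulmxA -(mulmxA a) JJ' mul_mx_scalar -scalemxAl mxE.
by rewrite -dotvE.
Qed.

Lemma sum_frame2_diag k x : \sum_i T i i k x = (1 - m%:R / 2) * td k x.
Proof using CY Ct conf.
rewrite (eq_bigr (fun i => (i == k)%:R * td i x - 2^-1 * td k x)) => [|i _].
  rewrite sumrB sum_delta sumr_const card_ord -[_ *+ m]mulr_natl.
    by move: (td k x) => A; ring.
by rewrite frame2_dotE eqxx mul1r; move: (td i x) (td k x) => A B; field.
Qed.

Lemma sum_frame2_sq x : \sum_i \sum_l \sum_k T i l k x ^+ 2 = (3 * m%:R - 2) / 4 * gradsq theta x.
Proof using CY Ct conf.
rewrite -sum_cyclic_sq; apply: eq_bigr => i _; apply: eq_bigr => l _; apply: eq_bigr => k _.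
by rewrite frame2_dotE.
Qed.

(** Third derivatives cancel in the difference of D_l (Y_ii . Y_l) and D_i (Y_il . Y_l), leaving
    Y_ii . Y_ll - |Y_il|^2. Summed over i and l, the left side is (1 - m) Lap theta; theta times the
    right side is (1 - m/2)^2 - (3m - 2)/4 times |D theta|^2. This coefficient factors as (1 - m)(6
    - m)/4, and 1 - m is divided out. *)
Lemma flat_conformal_pde x : (1 < m)%N ->
  4 * (theta x * laplacian theta x) = (6 - m%:R) * gradsq theta x.
Proof using CY Ct t0 conf.
move=> m1.
have dtd i l := derivableP (diff_derivable (v := vbasis l)
   (Ck_differentiable openT (Ck_derive (vbasis i) openT Ct) (I : setT x))).
have L1 i l : 'D_(vbasis l) (T i i l) x =
   (l == i)%:R * 'D_(vbasis l) (td i) x - 2^-1 * 'D_(vbasis l) (td l) x.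
  have -> : T i i l = (l == i)%:R *: td i - 2^-1 *: td l.
    apply/funext => y; rewrite frame2_dotE eqxx mul1r (eq_sym i l) -[RHS]/((l == i)%:R * td i y - 2^-1 * td l y).
    by move: (td i y) (td l y) => A B; field.
  by have [_ ->] := is_deriveB (is_deriveZ (l == i)%:R (dtd i l)) (is_deriveZ 2^-1 (dtd l l)).
have L2 i l : 'D_(vbasis i) (T i l l) x = 2^-1 * 'D_(vbasis i) (td i) x.
  have -> : T i l l = 2^-1 *: td i.
    apply/funext => y; rewrite frame2_dotE eqxx mul1r -[RHS]/(2^-1 * td i y).
    by move: (td i y) (td l y) => A B; ring.
  by have [_ ->] := is_deriveZ 2^-1 (dtd i i).
have third i l : 'D_(vbasis l) (H i i) x = 'D_(vbasis i) (H i l) x.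
  exact: derive_sym_row openT (Ck_frame i) I.
have E : \sum_i \sum_l ('D_(vbasis l) (T i i l) x - 'D_(vbasis i) (T i l l) x) =
   \sum_i \sum_l (dotv (H i i x) (H l l x) - dotv (H i l x) (H i l x)).
  apply: eq_bigr => i _; apply: eq_bigr => l _.
  have e1 := derive_frame2_dot i i l l x; rewrite third in e1.
  have e2 := derive_frame2_dot i l l i x.
  have aux (A B D D' : R) : D = D' -> (A + B) - (A + D) = B - D' by move=> ->; ring.
  exact (etrans (congr2 (fun a b => a - b) e1 e2) (aux _ _ _ _ (congr1 (dotv _) (frame2_sym l i x)))).
have EL : \sum_i \sum_l ('D_(vbasis l) (T i i l) x - 'D_(vbasis i) (T i l l) x) =
   (1 - m%:R) * laplacian theta x.
  pose c i := 'D_(vbasis i) (td i) x; pose d i l := 'D_(vbasis l) (td i) x.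
  apply: etrans _ (@sum_trace_contract R m c d (fun i => erefl _)).
  apply: eq_bigr => i _; apply: eq_bigr => l _.
  exact (congr2 (fun a b => a - b) (L1 i l) (L2 i l)).
have ER : theta x * \sum_i \sum_l (dotv (H i i x) (H l l x) - dotv (H i l x) (H i l x)) =
   ((1 - m%:R / 2) ^+ 2 - (3 * m%:R - 2) / 4) * gradsq theta x.
  rewrite (sum_dotv_diag (fun i => H i i x) (fun i l => dotv (H i l x) (H i l x))).
  have dsk k : dotv (\sum_i H i i x) (Yd k x) = (1 - m%:R / 2) * td k x.
    exact (etrans (dotv_suml (fun i => H i i x) (Yd k x)) (sum_frame2_diag k x)).
  have e1 : theta x * dotv (\sum_i H i i x) (\sum_i H i i x) = (1 - m%:R / 2) ^+ 2 * gradsq theta x.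
    apply: etrans (conf_frame _ _ x) _; apply: etrans _ (esym (mulr_sumr _ _ _ _)).
    apply: eq_bigr => k _; apply: etrans (congr2 *%R (dsk k) (dsk k)) _.
    by rewrite -[td k x]/('D_(vbasis k) theta x); move: ('D_(vbasis k) theta x) => A; ring.
  have e2 : theta x * (\sum_i \sum_l dotv (H i l x) (H i l x)) = (3 * m%:R - 2) / 4 * gradsq theta x.
    apply: etrans (sum_frame2_sq x); apply: etrans (mulr_sumr _ _ _ _) _.
    apply: eq_bigr => i _; apply: etrans (mulr_sumr _ _ _ _) _; apply: eq_bigr => l _.
    apply: etrans (conf_frame _ _ x) _; apply: eq_bigr => k _; exact: (esym (expr2 _)).
  apply: etrans (mulrBr _ _ _) _; apply: etrans (congr2 (fun a b => a - b) e1 e2) _.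
  exact: (esym (mulrBl _ _ _)).
have main : theta x * ((1 - m%:R) * laplacian theta x) =
   ((1 - m%:R / 2) ^+ 2 - (3 * m%:R - 2) / 4) * gradsq theta x.
  by apply: etrans ER; congr (_ * _); exact: etrans (esym EL) E.
have m1' : 1 - m%:R != 0 :> R by rewrite subr_eq0 eq_sym pnatr_eq1; case: m m1 => [|[|]].
apply: (mulfI m1'); move: main.
move: (theta x) (laplacian theta x) (gradsq theta x) (m%:R : R) => t A g M main.
transitivity (4 * (t * ((1 - M) * A))); first by ring.
by rewrite main; field.
Qed.

End FlatConformal.

(** * Positive solutions with a limit at infinity are constant *)

Section Liouville.
Context {R : realType} {m : nat}.

Lemma compact_dotv_ball (r : R) : compact [set x : 'rV[R]_m | dotv x x <= r].
Proof.
apply: bounded_closed_compact.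
  exists (1 + `|r|); split => // M M1 x /= x1; apply: le_trans (ltW M1).
  have xr : `|x| ^+ 2 <= `|r| by rewrite (le_trans (norm_le_dotv x)) // (le_trans x1) // ler_norm.
  have := normr_ge0 x; have := normr_ge0 r; move: `|x| `|r| xr => s t st t00 s0; nra.
have -> : [set x : 'rV[R]_m | dotv x x <= r] = ~` [set x | r < dotv x x].
  by apply/seteqP; split=> x /=; rewrite leNgt => /negP.
apply: open_closedC; apply: open_lt_fun => x; last exact: continuous_dotvv.
by apply: differentiable_continuous.
Qed.

(* Weak maximum principle for s theta + d |x|^2 on a large ball, s = 1 or -1. *)
Lemma entire_limit_const (theta : 'rV[R]_m -> R) (L : R) : (0 < m)%N ->
  Ck 2 setT theta -> (forall x, 0 < theta x) ->
  (forall x, 4 * (theta x * laplacian theta x) = (6 - m%:R) * gradsq theta x) ->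
  (forall e, 0 < e -> exists r, forall x, r <= dotv x x -> `|theta x - L| <= e) ->
  forall x, theta x = L.
Proof.
move=> m0 Ct t0 pde lim x0.
suff main s : s ^+ 2 = 1 -> s * (theta x0 - L) <= 0.
  apply/eqP; rewrite eq_le -subr_le0 -[X in _ && X]subr_le0.
  have := main 1; have := main (-1); rewrite sqrrN expr1n mul1r mulN1r opprB.
  by move=> /(_ erefl) -> /(_ erefl) ->.
move=> s1; rewrite leNgt; apply/negP => gt.
pose e := s * (theta x0 - L) / 2; have e0 : 0 < e by rewrite divr_gt0.
have [r0 far] := lim e e0.
pose r := 1 + `|r0| + dotv x0 x0.
have rr : r0 <= r by rewrite /r -addrA addrCA (le_trans (ler_norm _)) // lerDl addr_ge0 // dotv_ge0.
have xr : dotv x0 x0 <= r by rewrite /r lerDr addr_ge0.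
have rp : 0 < r by rewrite /r -addrA ltr_pwDl // addr_ge0 // dotv_ge0.
have cB : compact [set x : 'rV[R]_m | dotv x x <= r] := @compact_dotv_ball r.
have [c c0 tc] : exists2 c, 0 < c & forall x, dotv x x <= r -> c <= theta x.
  apply: (compact_pos (f := theta) cB) => // x _.
  exact: Ck_continuous Ct I.
(* [d * r <= e / 2] keeps the maximum off the boundary: there [g] is at most s L + 3 e / 2, while
   [g x0] is at least s L + 2 e. [d * r <= c / 4] will contradict [c <= theta] at an interior
   maximum. *)
pose d := Num.min (c / 4) (e / 2) / r.
have d0 : 0 < d by rewrite divr_gt0 // lt_min !divr_gt0.
have dr : d * r <= c / 4 /\ d * r <= e / 2 by rewrite divfK ?gt_eqF // !ge_min !lexx orbT.
pose g x := s * theta x + quadr (2 * d) 0 0 x.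
have gE x : g x = s * theta x + d * dotv x x by rewrite /g /quadr dot0v !addr0; congr (_ + _); field.
have Cg : Ck 2 setT g by exact: CkD openT (CkZ s openT Ct) (Ck_quadr 2 _ _ _ openT).
have [p pB mx] := compact_max cB (ex_intro _ x0 xr)
   (within_continuous (fun x _ => Ck_continuous Cg (I : setT x))).
have pr : dotv p p < r.
  rewrite lt_def pB andbT; apply/eqP => E.
  have := mx x0 xr; rewrite !gE -E leNgt => /negP; apply.
  have h1 : s * (theta p - L) <= e.
    apply: le_trans (ler_norm _) _; rewrite normrM.
    have -> : `|s| = 1 by apply/eqP; rewrite -sqrp_eq1 // real_normK ?num_real // s1.
    by rewrite mul1r; apply: far; rewrite -E.
  have h2 : 0 <= d * dotv x0 x0 by rewrite mulr_ge0 ?dotv_ge0 // ltW.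
  have h3 : s * (theta x0 - L) = 2 * e by rewrite /e; field.
  move: h1 h3; rewrite !mulrBr; move: dr => [_]; move: (s * theta p) (s * theta x0) (s * L) (d * r) => A B C D.
  by lra.
have oB : open [set x : 'rV[R]_m | dotv x x < r].
  apply: open_lt_fun => x; first exact: continuous_dotvv.
  by apply: differentiable_continuous.
have CgB := Ck_sub (@subsetT _ [set x : 'rV[R]_m | dotv x x < r]) Cg.
have test i := local_max_test (vbasis i) oB CgB pr (fun y yr => mx y (ltW yr)).
have dt u := derivableP (diff_derivable (v := u) (Ck_differentiable openT Ct (I : setT p))).
have D1 u y : 'D_u g y = s * 'D_u theta y + 2 * d * dotv y u.
  have dty := derivableP (diff_derivable (v := u) (Ck_differentiable openT Ct (I : setT y))).
  have [_ ->] := is_deriveD (is_deriveZ s dty) (is_derive_quadr (2 * d) 0 0 y u).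
  by rewrite dot0v addr0.
have D2 u : 'D_u ('D_u g) p = s * 'D_u ('D_u theta) p + 2 * d * dotv u u.
  have -> : 'D_u g = s *: 'D_u theta + quadr 0 0 ((2 * d) *: u).
    apply/funext => y; rewrite D1 -[RHS]/(s * 'D_u theta y + _) /quadr dotvZl (dotvC u).
    by congr (_ + _); field.
  have dD := derivableP (diff_derivable (v := u)
     (Ck_differentiable openT (Ck_derive u openT Ct) (I : setT p))).
  have [_ ->] := is_deriveD (is_deriveZ s dD) (is_derive_quadr 0 0 ((2 * d) *: u) p u).
  by rewrite mul0r add0r dotvZl.
have grad : gradsq theta p = 4 * d ^+ 2 * dotv p p.
  rewrite /dotv mulr_sumr; apply: eq_bigr => i _.
  have [E _] := test i; rewrite D1 dotv_basis in E.
  have -> : 'D_(vbasis i) theta p = - (s * (2 * d * p 0 i)).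
    have := s1; rewrite expr2; move: ('D_(vbasis i) theta p) (p 0 i) E => A B E ss.
    have sA : s * A = - (2 * d * B) by lra.
    by rewrite -mulrN -sA mulrA ss mul1r.
  by rewrite sqrrN exprMn s1; ring.
have lap : s * laplacian theta p <= - (2 * d * m%:R).
  rewrite mulr_sumr; apply: le_trans (_ : \sum_(i < m) - (2 * d) <= _).
    apply: ler_sum => i _; have [_] := test i; rewrite D2 dotv_basis mxE !eqxx mulr1.
    by move: (s * _) => A; lra.
  by rewrite sumr_const card_ord -[_ *+ m]mulr_natr mulNr.
have tp := tc p (ltW pr); have tp0 := t0 p.
have := congr1 (fun t => s * t) (pde p); rewrite grad.
move: lap tp tp0 pr (dotv_ge0 p) dr.
have m1 : 1 <= m%:R :> R by rewrite ler1n.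
have sb : -1 <= s <= 1 by rewrite -ler_norml -(@ler_pXn2r _ 2) ?nnegrE // expr1n real_normK ?num_real // s1.
move: (laplacian theta p) (theta p) (dotv p p) (m%:R : R) m1 sb => A t q M m1 /andP[sl su].
move=> lap tp tp0 pr q0 [dr _] E.
have h1 : 4 * t * (s * A) <= 4 * t * - (2 * d * M).
  by apply: ler_wpM2l lap; rewrite mulr_ge0 // ltW.
(* The crude bound |6 - m| <= 7 m, for m >= 1. The equation at [p] then yields 2 theta <= 7 d |p|^2
   < 7 c / 4, against theta >= c. *)
have h2 : - (7 * M) <= s * (6 - M) by nra.
have q4 : 0 <= 4 * d ^+ 2 * q by exact: mulr_ge0 (mulr_ge0 (ler0n _ 4) (sqr_ge0 d)) q0.
have h3 := ler_wpM2l q4 h2.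
have h4 : 4 * (d * M) * (2 * t) <= 4 * (d * M) * (7 * (d * q)).
  have E' : s * (4 * (t * A)) = 4 * t * (s * A) by ring.
  move: h1; rewrite -E' E => h1.
  have : 4 * d ^+ 2 * q * (s * (6 - M)) = s * ((6 - M) * (4 * d ^+ 2 * q)) by ring.
  move: h3 => /[swap] ->; move: h1; move: (s * ((6 - M) * (4 * d ^+ 2 * q))) => Z h1 h3.
  have := le_trans h3 h1; nra.
have dM : 0 < 4 * (d * M) by rewrite mulr_gt0 // mulr_gt0 // (lt_le_trans _ m1).
move: h4; rewrite ler_pM2l // => h4.
have : d * q < d * r by rewrite ltr_pM2l.
by move: dr tp h4 tp0; move: (d * q) (d * r) => u w; lra.
Qed.

End Liouville.

(** * The equator *)

Section EquatorFrame.
Context {R : realType}.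

(* The Householder reflection exchanging q and the first basis vector. *)
Lemma orthogonal_first_row m (q : 'rV[R]_(1 + m)) : dotv q q = 1 ->
  exists E : 'M[R]_(m, 1 + m), [/\ E *m E^T = 1%:M, q *m E^T = 0 &
    q^T *m q + E^T *m E = 1%:M].
Proof.
move=> qq; pose e0 : 'rV[R]_(1 + m) := row_mx 1%:M 0.
have [H HH Hq] : exists2 H : 'M[R]_(1 + m), H *m H^T = 1%:M & e0 *m H = q.
  have [->|qe] := eqVneq q e0; first by exists 1%:M; rewrite ?trmx1 mulmx1.
  pose u := q - e0; have uu : 0 < dotv u u by rewrite dotv_gt0 subr_eq0.
  have e00 : dotv e0 e0 = 1.
    by rewrite dotv_row_mx dot0v addr0 /dotv big_ord1 mxE eqxx mulr1.
  pose c := 2 / dotv u u; pose P := u^T *m u.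
  have PP : P *m P = dotv u u *: P.
    rewrite /P mulmxA -(mulmxA u^T) [u *m u^T]mx11_scalar -dotvE.
    by rewrite mul_mx_scalar -scalemxAl.
  have PT : P^T = P by rewrite trmx_mul trmxK.
  exists (1%:M - c *: P).
    have -> : (1%:M - c *: P)^T = 1%:M - c *: P.
      have tZ : (c *: P)^T = c *: P^T by apply/matrixP => i j; rewrite !mxE.
      by rewrite raddfB /= trmx1 tZ PT.
    rewrite mulmxBl mul1mx mulmxBr mulmx1.
    rewrite -scalemxAl -scalemxAr PP !scalerA.
    have -> : c * c * dotv u u = c + c by rewrite /c; field; rewrite gt_eqF.
    by rewrite scalerDl opprB addrK subrK.
  rewrite mulmxBr mulmx1 -scalemxAr /P mulmxA [e0 *m u^T]mx11_scalar -dotvE.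
  rewrite mul_scalar_mx scalerA.
  have E1 : dotv u u = - (2 * dotv e0 u).
    by rewrite /u dotvDl !dotvDr !dotvNr !dotvNl qq e00 (dotvC q e0); ring.
  have eu : dotv e0 u != 0 by apply/eqP => z; move: uu; rewrite E1 z mulr0 oppr0 ltxx.
  have -> : c * dotv e0 u = -1 by rewrite /c E1; field.
  by rewrite scaleN1r opprK /u addrCA subrr addr0.
have Hqd : H = col_mx q (dsubmx H).
  rewrite -{1}[H]vsubmxK; congr col_mx.
  by rewrite -Hq /e0 -{2}[H]vsubmxK mul_row_col mul1mx mul0mx addr0.
have HH' := mulmx1C HH; exists (dsubmx H).
move: HH HH'; rewrite Hqd tr_col_mx mul_col_row mul_row_col col_mxKd.
rewrite scalar_mx_block => /eq_block_mx [_ qE _ EE] QE.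
by split => //; rewrite QE -scalar_mx_block.
Qed.

(** The rows of [E] are an orthonormal basis of the complement of [q] in the equatorial hyperplane;
    the last clause is completeness. *)
Lemma equator_frame m (q : 'rV[R]_((1 + m) + 1)) : equator q ->
  exists E : 'M[R]_(m, (1 + m) + 1), [/\ E *m E^T = 1%:M, q *m E^T = 0,
    forall x, height (x *m E : 'rV[R]_((1 + m) + 1)) = 0 &
    forall p, height p = 0 -> p = dotv p q *: q + (p *m E^T) *m E].
Proof.
move=> [qq hq]; rewrite /sphere /= dotv_submx hq mulr0 addr0 in qq.
have [E [EE qE QE]] := orthogonal_first_row qq.
have q0 p : height p = 0 -> p = row_mx (lsubmx p) 0 :> 'rV[R]_((1 + m) + 1).
  by move=> hp; rewrite {1}[p]row_mx_height hp raddf0.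
exists (row_mx E 0); split.
- by rewrite tr_row_mx mul_row_col EE trmx0 mulmx0 addr0.
- by rewrite (q0 q hq) tr_row_mx mul_row_col qE trmx0 mulmx0 addr0.
- by move=> x; rewrite /height mul_mx_row row_mxKr mulmx0 mxE.
- move=> p hp; rewrite (q0 p hp) (q0 q hq).
  rewrite tr_row_mx mul_row_col trmx0 mul0mx addr0 dotv_row_mx dot0v addr0.
  rewrite mul_mx_row mulmx0 scale_row_mx scaler0 add_row_mx addr0; congr row_mx.
  rewrite -{1}[lsubmx p]mulmx1 -QE mulmxDr !mulmxA; congr (_ + _).
  by rewrite [_ *m (lsubmx q)^T]mx11_scalar -dotvE mul_scalar_mx.
Qed.

End EquatorFrame.

Section SphereDifferential.
Context {R : realType} {n : nat}.
Local Notation point := 'rV[R]_(n + 1).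
Implicit Types (p u : point).

(** On the equator, [F \o unitize] is controlled only along tangent lines, not on a neighbourhood in
    the ambient space, so agreement near the point cannot be required. *)
Lemma derive_line_eq m (W : normedModType R) (f g : 'rV[R]_m -> W) (x u : 'rV[R]_m) :
  (\forall t \near (0 : R), f (t *: u + x) = g (t *: u + x)) -> 'D_u f x = 'D_u g x.
Proof.
move=> fg; have fgx : f x = g x.
  by have := nbhs_singleton fg; rewrite /= scale0r add0r.
rewrite /derive; congr (lim _).
have E (a b : 'rV[R]_m -> W) : a x = b x -> (\forall t \near (0 : R), a (t *: u + x) = b (t *: u + x)) ->
  (fun h : R => h^-1 *: ((b \o shift x) (h *: u) - b x)) @ 0^' `=>`
  (fun h : R => h^-1 *: ((a \o shift x) (h *: u) - a x)) @ 0^'.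
  move=> abx ab; apply: near_eq_cvg; apply: cvg_within.
  by apply: filterS ab => t /= ->; rewrite abx.
rewrite eqEsubset; split; first exact: E.
by apply: E => //; apply: filterS fg => t ->.
Qed.

Lemma is_derive_unitize p u : dotv p p = 1 -> dotv p u = 0 -> is_derive p u (@unitize R n) u.
Proof.
move=> pp pu.
pose g (y : point) := dotv y y.
have hg : is_derive p u g (2 * dotv p u) by exact: is_derive_dotvv.
have dg : differentiable g p.
  apply: (Ck_differentiable (k := 0) openT _ I).
  by apply: (Ck_dotv openT); exact: (Ck_id 1 openT).
have gp : 0 < g p by rewrite /g pp.
have ds : differentiable (Num.sqrt : R -> R) (g p).
  by apply/derivable1_diffP; case: (is_derive1_sqrt gp).
have dsg : differentiable (Num.sqrt \o g) p by exact: differentiable_comp.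
have hs : is_derive p u (Num.sqrt \o g) 0.
  apply: DeriveDef; first exact: diff_derivable.
  rewrite (deriveE u dsg) (diff_comp dg ds) /= -(deriveE u dg).
  by case: hg => _ ->; rewrite pu mulr0 linear0.
have s1 : (Num.sqrt \o g) p = 1 by rewrite /= /g pp sqrtr1.
have s0 : (Num.sqrt \o g) p != 0 by rewrite s1 oner_eq0.
have hV : is_derive p u (fun y => ((Num.sqrt \o g) y)^-1) 0.
  case: hs => d e; apply: DeriveDef; first exact (derivableV (f := Num.sqrt \o g) s0 d).
  by rewrite (deriveV (f := Num.sqrt \o g) s0 d) e scaler0.
apply: is_derive_eq (is_derive_scale hV (is_derive_id p u)) _.
by rewrite s1 invr1 scale0r add0r scale1r.
Qed.

Lemma unitize_sphere p : p != 0 -> sphere (unitize p).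
Proof.
move=> p0; rewrite /sphere /= /unitize dotvZl dotvZr mulrA -expr2 exprVn.
by rewrite sqr_sqrtr ?dotv_ge0 // mulVf // dotv_eq0.
Qed.

Lemma unitize_id p : sphere p -> unitize p = p.
Proof. by rewrite /sphere /unitize /= => ->; rewrite sqrtr1 invr1 scale1r. Qed.

Lemma differentiable_unitize p : p != 0 -> differentiable (@unitize R n) p.
Proof.
move=> p0; pose g (y : point) := dotv y y.
have dg : differentiable g p.
  apply: (Ck_differentiable (k := 0) openT _ I).
  by apply: (Ck_dotv openT); exact: (Ck_id 1 openT).
have gp : 0 < g p by rewrite dotv_gt0.
have ds : differentiable (Num.sqrt : R -> R) (g p).
  by apply/derivable1_diffP; case: (is_derive1_sqrt gp).
have dsg : differentiable (Num.sqrt \o g) p by exact: differentiable_comp.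
have s0 : (Num.sqrt \o g) p != 0 by rewrite /= gt_eqF // sqrtr_gt0.
apply/differentiable_rowP => j.
have -> : (fun y => unitize y 0 j) = (fun y => ((Num.sqrt \o g) y)^-1) * (fun y : point => y 0 j : R).
  by apply/funext => y; rewrite mxE.
apply: differentiableM; last exact: differentiable_coord.
exact (differentiableV (f := Num.sqrt \o g) dsg s0).
Qed.

(* Only the values of F on the set A, which contains the curve
   t |-> (p + t u) / |p + t u|, matter for the differential at p. *)
Lemma sphere_diff_extension (A Q : set point) (F h : point -> point) p u :
  open Q -> Ck 1 Q h -> Q p -> sphere p -> tangent p u ->
  (forall t : R, A (unitize (t *: u + p))) ->
  (forall y, Q y -> A y -> h y = F y) -> sphere_diff F p u = 'D_u h p.
Proof.
move=> oQ Ch Qp pp pu hA hF; rewrite /sphere_diff.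
have pu' : dotv p u = 0 by [].
have pp' : dotv p p = 1 by [].
have p0 : p != 0 by rewrite -dotv_gt0 pp' ltr01.
have du := differentiable_unitize p0.
have dh : differentiable h (unitize p).
  by rewrite unitize_id //; exact: Ck_row_differentiable oQ Ch Qp.
have -> : 'D_u (F \o unitize) p = 'D_u (h \o unitize) p.
  apply: derive_line_eq.
  have nQ : nbhs (unitize ((0 : R) *: u + p)) Q.
    by rewrite scale0r add0r unitize_id //; apply: open_nbhs_nbhs.
  have c1 : {for (0 : R), continuous (fun t : R => t *: u + p)}.
    apply: continuousD; last exact: cst_continuous.
    exact: scalel_continuous.
  have c2 : {for ((0 : R) *: u + p), continuous (@unitize R n)}.
    by rewrite scale0r add0r; exact: differentiable_continuous.
  have c := continuous_comp c1 c2.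
  have H : \forall t \near (0 : R), Q (unitize (t *: u + p)) := c _ nQ.
  by apply: filterS H => t Qt; rewrite /= (hF _ Qt (hA t)).
rewrite (derive_comp u du dh) (unitize_id pp).
by case: (is_derive_unitize pp' pu') => _ ->.
Qed.

End SphereDifferential.

Section EquatorCharts.
Context {R : realType} {n : nat}.
Local Notation point := 'rV[R]_(n + 1).
Implicit Types (p : point).

Lemma heightD p (u : point) : height (p + u) = height p + height u.
Proof. by rewrite /height linearD mxE. Qed.

Lemma heightZ a p : height (a *: p) = a * height p.
Proof. by rewrite /height linearZ mxE. Qed.

Lemma heightN p : height (- p) = - height p.
Proof. by rewrite -scaleN1r heightZ mulN1r. Qed.

Lemma equator_sub_closed_hemisphere p : equator p -> closed_hemisphere p.
Proof. by move=> [pp hp]; split; rewrite ?hp. Qed.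

Lemma unit_dotv_lt1 m (p q : 'rV[R]_m) : dotv p p = 1 -> dotv q q = 1 -> p != q -> dotv p q < 1.
Proof.
move=> pp qq pq; have : 0 < dotv (p - q) (p - q) by rewrite dotv_gt0 subr_eq0.
by rewrite dotvDl !dotvDr !dotvNl !dotvNr pp qq (dotvC q p); lra.
Qed.

Lemma unit_dist_sq m (p q : 'rV[R]_m) : dotv p p = 1 -> dotv q q = 1 ->
  dotv (p - q) (p - q) = 2 * (1 - dotv p q).
Proof.
move=> pp qq.
by rewrite dotvDl !dotvDr !dotvNl !dotvNr pp qq (dotvC q p); ring.
Qed.

Section Chart.
Variables (m : nat) (E : 'M[R]_(m, n + 1)) (q : point).
Hypotheses (EE : E *m E^T = 1%:M) (qE : q *m E^T = 0) (Eq : equator q)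
  (hE : forall x : 'rV[R]_m, height (x *m E : point) = 0).

Lemma chart_equator x : equator (chart E q x).
Proof using EE qE Eq hE.
case: Eq => qq hq; split; first exact: (chart_sphere EE qE qq).
by rewrite /chart heightZ heightD !heightZ hE hq !mulr0 addr0 mulr0.
Qed.

Lemma derive_chart_equator_tangent x u : equator_tangent (chart E q x) ('D_u (chart E q) x).
Proof using EE qE Eq hE.
have [_ hc] := chart_equator x.
case: (Eq) => qq hq; split; first exact: (chart_tangent EE qE qq).
rewrite derive_chart; move: (chart E q x) hc => c hc.
by rewrite heightZ !heightD heightN !heightZ hE hq hc !mulr0 oppr0 !addr0 mulr0.
Qed.

Variables (F : point -> point) (rho : point -> R).
Hypothesis SF : smooth_on equator F.
Hypothesis Fconf : forall p u v, equator p -> equator_tangent p u -> equator_tangent p v ->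
  pullback F round_metric p u v = conformal_metric rho p u v.

Lemma smooth_comp_chart k : Ck k setT (F \o chart E q).
Proof using EE qE Eq hE SF.
apply: Ck_local => x _.
have [Q [h [oQ Qx Ch hF]]] := SF (chart_equator x).
pose V := chart E q @^-1` Q.
have oV : open V.
  by apply: open_comp oQ => y _; exact: (Ck_continuous (Ck_chart E q 0) I).
exists V => //; refine (Ck_ext (f := h \o chart E q) oV _ _) => [y Vy|].
  by rewrite /= (hF _ Vy (chart_equator y)).
exact: (Ck_comp_row oV oQ (fun y Vy => Vy) (Ck_sub (@subsetT _ V) (Ck_chart E q k)) (Ch k)).
Qed.

Lemma derive_comp_chart x u :
  'D_u (F \o chart E q) x = sphere_diff F (chart E q x) ('D_u (chart E q) x).
Proof using EE qE Eq hE SF.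
have Ec := chart_equator x; have [cc hc] := Ec.
have [Q [h [oQ Qx Ch hF]]] := SF Ec.
have oV : open (chart E q @^-1` Q).
  by apply: open_comp oQ => y _; exact: (Ck_continuous (Ck_chart E q 0) I).
have -> : 'D_u (F \o chart E q) x = 'D_u (h \o chart E q) x.
  apply: near_eq_derive; apply: (open_near_eq oV Qx) => y Vy.
  by rewrite /= (hF _ Vy (chart_equator y)).
have [ct ht] := derive_chart_equator_tangent x u.
have dh : differentiable h (chart E q x) by exact: Ck_row_differentiable oQ (Ch 1%N) Qx.
rewrite (derive_comp u (differentiable_chart E q x) dh).
move: ('D_u (chart E q) x) ct ht => t ct ht.
apply/esym; apply: (sphere_diff_extension oQ (Ch 1%N) Qx cc ct _ hF) => a.
have pp : dotv (chart E q x) (chart E q x) = 1 by [].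
have pt : dotv (chart E q x) t = 0 by [].
move: (chart E q x) pp pt hc => p pp pt hp.
split; last by rewrite /unitize heightZ heightD heightZ ht hp mulr0 addr0 mulr0.
apply: unitize_sphere; rewrite -dotv_gt0 dotvDl !dotvDr !dotvZl !dotvZr pp (dotvC t p) pt.
rewrite !mulr0 addr0 add0r mulrA -expr2; apply: ltr_wpDl => //.
by apply: mulr_ge0; [exact: sqr_ge0|exact: dotv_ge0].
Qed.

Lemma comp_chart_conformal x u w :
  dotv ('D_u (F \o chart E q) x) ('D_w (F \o chart E q) x) =
  expR (2 * rho (chart E q x)) * ((2 / (1 + dotv x x)) ^+ 2 * dotv u w).
Proof using EE qE Eq hE SF Fconf.
rewrite !derive_comp_chart.
have := Fconf (chart_equator x) (derive_chart_equator_tangent x u)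
  (derive_chart_equator_tangent x w).
rewrite /pullback /conformal_metric /round_metric => ->.
by case: Eq => qq _; rewrite (chart_conformal EE qE qq).
Qed.

Hypothesis full : forall p, height p = 0 -> p = dotv p q *: q + (p *m E^T) *m E.

(** The preimage is the stereographic projection of [p] from [q]; [full] ensures that [p] is
    recovered from its components along [q] and the frame. *)
Lemma chart_surj p : equator p -> p != q ->
  chart E q ((1 - dotv p q)^-1 *: (p *m E^T)) = p.
Proof using EE qE Eq full.
case: (Eq) => qq hq [pp hp] pq.
have t1 : dotv p q < 1 by exact: unit_dotv_lt1.
have yy : dotv (p *m E^T) (p *m E^T) = 1 - dotv p q ^+ 2.
  have := pp; rewrite /sphere /= {2}(full hp) dotvDr dotvZr.
  have -> : dotv p (p *m E^T *m E) = dotv (p *m E^T) (p *m E^T).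
    by rewrite !dotvE !trmx_mul trmxK !mulmxA.
  by move=> <-; rewrite expr2 addrAC subrr add0r.
rewrite /chart dotvZl dotvZr yy -scalemxAl scalerDr !scalerA [RHS](full hp) addrC.
move: (dotv p q) t1 => t t1; have t0 : 1 - t != 0 by rewrite gt_eqF // subr_gt0.
have d : 1 + (1 - t)^-1 * ((1 - t)^-1 * (1 - t ^+ 2)) = 2 / (1 - t) by field.
rewrite d; congr (_ + _).
  by congr (_ *: _); field.
by rewrite -[RHS]scale1r; congr (_ *: _); field.
Qed.

End Chart.

(** Passing to the antipodal pole is the inversion x / |x|^2, so infinity in one chart is the origin
    of the other. *)
Lemma chart_inversion m (E : 'M[R]_(m, n + 1)) (q : point) (x : 'rV[R]_m) : x != 0 ->
  chart E q x = chart E (- q) ((dotv x x)^-1 *: x).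
Proof.
rewrite -dotv_gt0 => s0; rewrite /chart dotvZl dotvZr -scalemxAl scalerN -scaleNr.
rewrite !scalerDr !scalerA; move: (dotv x x) s0 => s s0.
have h1 : s != 0 by rewrite gt_eqF.
have h2 : 1 + s != 0 by rewrite gt_eqF // addr_gt0.
have h3 : s + 1 != 0 by rewrite addrC.
by congr (_ *: _ + _ *: _); field; rewrite ?h1 ?h2 ?h3.
Qed.

End EquatorCharts.

Section ConformalRatio.
Context {R : realType} {m N : nat}.

(** For B y - B 0 = (linear part) + (remainder), [l], [d], [r] are the squared length of the first,
    their product, and the squared length of the second. Cauchy-Schwarz and the inequality of means
    for [e * l] and [N * e * t] bound [d]; the factor [N] comes from measuring the remainder in the
    sup norm. *)
Lemma conformal_ratio_bound (e k t l r d : R) : 0 < e -> e <= 1 -> 0 <= k -> 0 < t ->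
  l = 4 * k * t -> 0 <= r -> r <= N%:R * e ^+ 2 * t -> d ^+ 2 <= l * r ->
  `|k - (l + 2 * d + r) / (4 * t)| <= (k + N%:R) * e.
Proof.
move=> e0 e1 k0 t0 lE r0 rle dle.
have N0 : 0 <= N%:R :> R by rewrite ler0n.
have l0 : 0 <= l by rewrite lE !mulr_ge0 // ltW.
have -> : k - (l + 2 * d + r) / (4 * t) = - ((2 * d + r) / (4 * t)).
  by rewrite lE; field; rewrite gt_eqF.
rewrite normrN normrM [`|(4 * t)^-1|]gtr0_norm ?invr_gt0 ?mulr_gt0 // ler_pdivrMr ?mulr_gt0 //.
have dn : `|d| <= (e * l + N%:R * e * t) / 2.
  have h0 : 0 <= (e * l + N%:R * e * t) / 2.
    by rewrite divr_ge0 // addr_ge0 // !mulr_ge0 // ltW.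
  rewrite -(@ler_pXn2r _ 2) ?nnegrE // real_normK ?num_real //.
  apply: le_trans dle _; apply: (@le_trans _ _ (l * (N%:R * e ^+ 2 * t))).
    by rewrite ler_wpM2l.
  have -> : ((e * l + N%:R * e * t) / 2) ^+ 2 =
     l * (N%:R * e ^+ 2 * t) + ((e * l - N%:R * e * t) / 2) ^+ 2 by field.
  by rewrite lerDl sqr_ge0.
apply: le_trans (ler_normD _ _) _; rewrite normrM (ger0_norm r0) ger0_norm //.
have ee : N%:R * e ^+ 2 * t <= N%:R * e * t.
  by rewrite ler_wpM2r ?(ltW t0) // ler_wpM2l // expr2 ger_pMr.
have net : 0 <= N%:R * e * t by rewrite !mulr_ge0 // ltW.
move: dn; rewrite lE => dn.
have -> : (k + N%:R) * e * (4 * t) = e * (4 * k * t) + 4 * (N%:R * e * t) by ring.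
move: rle ee net dn; move: (N%:R * e ^+ 2 * t) (N%:R * e * t) (e * (4 * k * t)) `|d| => A B C D.
by lra.
Qed.

Lemma conformal_ratio_limit (B : 'rV[R]_m -> 'rV[R]_N) (k : R) : 0 <= k ->
  differentiable B 0 -> (forall u, dotv ('D_u B 0) ('D_u B 0) = 4 * k * dotv u u) ->
  dotv (B y - B 0) (B y - B 0) / (4 * dotv y y) @[y --> (0 : 'rV[R]_m)^'] --> k.
Proof.
move=> k0 dB cB; apply/cvgrPdist_le => e e0.
have kN : 0 < k + N%:R + 1 by rewrite ltr_wpDl // addr_ge0.
pose d := Num.min 1 (e / (k + N%:R + 1)).
have d0 : 0 < d by rewrite lt_min ltr01 divr_gt0.
have d1 : d <= 1 by rewrite ge_min lexx.
have de : (k + N%:R) * d <= e.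
  apply: (@le_trans _ _ ((k + N%:R + 1) * d)); first by rewrite ler_wpM2r ?lerDl // ltW.
  by rewrite mulrC -ler_pdivlMr // ge_min lexx orbT.
have near0 : \forall y \near (0 : 'rV[R]_m), `|B y - B 0 - 'D_y B 0| <= d * `|y|.
  have /diff_locallyP [_ /eqaddoP H] := dB.
  apply: filterS (H d d0) => y; rewrite -[X in `|X| <= _ -> _]/(B (y + 0) - (B 0 + 'd B 0 y)).
  by rewrite addr0 opprD addrA -(deriveE y dB).
have near0' : \forall y \near (0 : 'rV[R]_m)^', `|B y - B 0 - 'D_y B 0| <= d * `|y|.
  by apply: cvg_within near0.
near=> y.
have y0 : y != 0 by near: y; exact: nbhs_dnbhs_neq.
have Hy : `|B y - B 0 - 'D_y B 0| <= d * `|y| by near: y.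
have t0 : 0 < dotv y y by rewrite dotv_gt0.
apply: le_trans de; move: Hy.
have -> : B y - B 0 = 'D_y B 0 + (B y - B 0 - 'D_y B 0) by rewrite [RHS]addrC subrK.
move: (B y - B 0 - 'D_y B 0) => r; rewrite addrAC subrr add0r => rle.
have -> : dotv ('D_y B 0 + r) ('D_y B 0 + r) =
   dotv ('D_y B 0) ('D_y B 0) + 2 * dotv ('D_y B 0) r + dotv r r.
  by rewrite dotvDl !dotvDr (dotvC r ('D_y B 0)); ring.
apply: (conformal_ratio_bound d0 d1 k0 t0 (cB y) (dotv_ge0 r)).
  apply: le_trans (dotv_le_norm r) _; rewrite -mulrA ler_wpM2l //.
  apply: (@le_trans _ _ ((d * `|y|) ^+ 2)); first by apply: lerXn2r; rewrite ?nnegrE // mulr_ge0 // ltW.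
  by rewrite exprMn ler_wpM2l ?sqr_ge0 // norm_le_dotv.
exact: CauchySchwarz_dotv.
Unshelve. all: by end_near. Qed.

End ConformalRatio.

(** * The boundary isometry and the form of the conformal factor *)

Section EquatorLiouville.
Context {R : realType} {m : nat}.
Local Notation point := 'rV[R]_((1 + m) + 1).
Variables (F : point -> point) (rho : point -> R).
Hypotheses (m1 : (1 < m)%N) (Crho : Ck_on 2 closed_hemisphere rho).
Hypotheses (SF : smooth_on equator F) (FE : forall p, equator p -> equator (F p)).
Hypothesis Finj : forall p q, equator p -> equator q -> F p = F q -> p = q.
Hypothesis Fconf : forall p u v, equator p -> equator_tangent p u -> equator_tangent p v ->
  pullback F round_metric p u v = conformal_metric rho p u v.
Implicit Types (p q : point).

Let m0 : (0 < m)%N := ltnW m1.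

Section FixedPole.
Variables (q : point) (E E' : 'M[R]_(m, (1 + m) + 1)).
Hypotheses (Eq : equator q) (EE : E *m E^T = 1%:M) (qE : q *m E^T = 0)
  (hE : forall x : 'rV[R]_m, height (x *m E : point) = 0)
  (full : forall p, height p = 0 -> p = dotv p q *: q + (p *m E^T) *m E).
Hypotheses (EE' : E' *m E'^T = 1%:M) (qE' : F q *m E'^T = 0)
  (hE' : forall x : 'rV[R]_m, height (x *m E' : point) = 0)
  (full' : forall p, height p = 0 -> p = dotv p (F q) *: F q + (p *m E'^T) *m E').

Let A := F \o chart E q.
Let den x := 1 - dotv (A x) (F q).
(* F read in the stereographic charts of poles q and F q. *)
Let Y x : 'rV[R]_m := (den x)^-1 *: (A x *m E'^T).
(** The conformal factor of [Y] by the chain rule: that of the source chart, times exp(2 rho) for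
    [F], divided by that of the target chart, which is [den x ^+ 2]. *)
Let theta x : R :=
  (den x)^-1 ^+ 2 * (expR (2 * rho (chart E q x)) * (2 / (1 + dotv x x)) ^+ 2).

Lemma chart_neq_pole x : chart E q x != q.
Proof using Eq EE qE.
case: Eq => qq _; apply/eqP => e; have := one_sub_chart_dotq qE qq x.
rewrite e qq subrr => /eqP; rewrite eq_sym mulf_eq0 pnatr_eq0 invr_eq0 /=.
by rewrite gt_eqF // chart_den_gt0.
Qed.

Lemma image_equator x : equator (A x).
Proof using Eq EE qE hE FE. by apply: FE; exact: chart_equator. Qed.

Lemma image_neq_pole x : A x != F q.
Proof using Eq EE qE hE FE Finj.
apply/eqP => /(Finj (chart_equator EE qE Eq hE x) Eq) e.
by have := chart_neq_pole x; rewrite e eqxx.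
Qed.

Lemma image_den_gt0 x : 0 < den x.
Proof using Eq EE qE hE FE Finj.
rewrite subr_gt0; apply: unit_dotv_lt1; last exact: image_neq_pole.
  by case: (image_equator x).
by case: (FE Eq).
Qed.

Lemma chart_image x : chart E' (F q) (Y x) = A x.
Proof using Eq EE qE hE FE Finj EE' qE' hE' full'.
exact: (chart_surj EE' qE' (FE Eq) full' (image_equator x) (image_neq_pole x)).
Qed.

Lemma image_denE x : 2 / (1 + dotv (Y x) (Y x)) = den x.
Proof using Eq EE qE hE FE Finj EE' qE' hE' full'.
case: (FE Eq) => qq' _.
by rewrite -(one_sub_chart_dotq qE' qq') chart_image.
Qed.

Lemma Ck_image k : Ck k setT A.
Proof using Eq EE qE hE SF. exact: smooth_comp_chart. Qed.

Lemma Ck_chart_map k : Ck k setT Y.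
Proof using Eq EE qE hE SF FE Finj.
apply: (Ck_scale openT); last exact: (Ck_mulmx _ openT (Ck_image k)).
apply: (CkV openT) => [x _|]; first by rewrite gt_eqF // image_den_gt0.
apply: (CkB openT (Ck_cst k setT (1 : R))).
exact (Ck_dotv openT (Ck_image k) (Ck_cst k setT (F q))).
Qed.

Lemma chart_map_conformal x u w : dotv ('D_u Y x) ('D_w Y x) = dotv u w * theta x.
Proof using Eq EE qE hE SF FE Finj Fconf EE' qE' hE' full'.
have dA z : 'D_z A x = 'D_('D_z Y x) (chart E' (F q)) (Y x).
  have -> : 'D_z A x = 'D_z (chart E' (F q) \o Y) x.
    by congr ('D_z _ x); apply/funext => y; rewrite /= chart_image.
  apply: derive_comp; last exact: differentiable_chart.
  exact: Ck_row_differentiable openT (Ck_chart_map 1) I.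
case: (FE Eq) => qq' _.
have := comp_chart_conformal EE qE Eq hE SF Fconf x u w.
rewrite -/A !dA (chart_conformal EE' qE' qq') image_denE => e.
have d0 : den x != 0 by rewrite gt_eqF // image_den_gt0.
apply: (mulfI (expf_neq0 2 d0)); rewrite e /theta.
by move: (den x) d0 (2 / _) => d d0 s; field.
Qed.

Lemma theta_gt0 x : 0 < theta x.
Proof using Eq EE qE hE FE Finj.
rewrite mulr_gt0 ?exprn_gt0 ?invr_gt0 ?image_den_gt0 //.
by rewrite mulr_gt0 ?expR_gt0 ?exprn_gt0 // divr_gt0 // chart_den_gt0.
Qed.

Lemma Ck_theta : Ck 2 setT theta.
Proof using m1 Eq EE qE hE SF FE Finj Fconf EE' qE' hE' full'.
pose i := Ordinal m0; have C : Ck 2 setT ('D_(vbasis i) Y) := Ck_derive_row (vbasis i) openT (Ck_chart_map 3).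
refine (Ck_ext openT _ (Ck_dotv openT C C)) => x _.
by rewrite chart_map_conformal dotv_basis mxE !eqxx mul1r.
Qed.

Lemma theta_pde x : 4 * (theta x * laplacian theta x) = (6 - m%:R) * gradsq theta x.
Proof using m1 Eq EE qE hE SF FE Finj Fconf EE' qE' hE' full'.
apply: (flat_conformal_pde (Ck_chart_map 3) Ck_theta theta_gt0) => // y i j.
by rewrite chart_map_conformal dotv_basis mxE eqxx /= eq_sym.
Qed.

(** This chart sends 0 to [q], so [B] describes [F] near the point that the chart of pole [q] puts
    at infinity. *)
Let B := F \o chart E (- q).

Lemma oppq_frame : - q *m E^T = 0. Proof using qE. by rewrite mulNmx qE oppr0. Qed.
Lemma oppq_equator : equator (- q).
Proof using Eq.
case: Eq => qq hq; split; last by rewrite heightN hq oppr0.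
by rewrite /sphere /= dotvNl dotvNr opprK.
Qed.

Lemma chart_opp0 : chart E (- q) 0 = q.
Proof using.
by rewrite /chart dot0v mul0mx scaler0 add0r addr0 invr1 scale1r sub0r scaleN1r opprK.
Qed.

Lemma rho_chart_opp_continuous : {for 0, continuous (fun y => expR (2 * rho (chart E (- q) y)))}.
Proof using Crho Eq EE qE hE.
have Ec y := chart_equator EE oppq_frame oppq_equator hE y.
have [Q [h [oQ Q0 Ch hF]]] := Crho (equator_sub_closed_hemisphere (Ec 0)).
pose V := chart E (- q) @^-1` Q.
have oV : open V.
  by apply: open_comp oQ => y _; exact: (Ck_continuous (Ck_chart E (- q) 0) I).
apply: (Ck_continuous (k := 0) (U := V)) => //.
have C : Ck 2 V (h \o chart E (- q)).
  exact: (Ck_comp oV oQ (fun y Vy => Vy) (Ck_sub (@subsetT _ V) (Ck_chart E (- q) 2)) Ch).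
refine (Ck_ext oV _ (Ck_leq (leq0n 2) (Ck_expR oV (CkZ 2 oV C)))) => y Vy.
by rewrite /= (hF _ Vy (equator_sub_closed_hemisphere (Ec y))).
Qed.

Lemma theta_inversion x : x != 0 -> let y := (dotv x x)^-1 *: x in
  theta x = ((1 + dotv y y) * (dotv (B y - B 0) (B y - B 0) / (4 * dotv y y)))^-1 ^+ 2
     * expR (2 * rho (chart E (- q) y)).
Proof using Eq EE qE hE FE Finj.
move=> x0 y; have s0 : 0 < dotv x x by rewrite dotv_gt0.
have Bd : dotv (B y - B 0) (B y - B 0) = 2 * den x.
  rewrite /B /= chart_opp0 /y -(chart_inversion E q x0) unit_dist_sq //.
    by case: (image_equator x).
  by case: (FE Eq).
rewrite Bd /theta (chart_inversion E q x0) -/y.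
have -> : dotv y y = (dotv x x)^-1.
  by rewrite /y dotvZl dotvZr mulVf ?mulr1 // gt_eqF.
have d0 := image_den_gt0 x; move: (den x) (dotv x x) (expR _) d0 s0 => d s w d0 s0.
have h : s + 1 != 0 by rewrite gt_eqF // addr_gt0.
have h' : 1 + s != 0 by rewrite gt_eqF // addr_gt0.
by field; rewrite ?h ?h' ?gt_eqF.
Qed.

Lemma theta_limit (e : R) : 0 < e -> exists r, forall x, r <= dotv x x ->
  `|theta x - expR (- (2 * rho q))| <= e.
Proof using Crho SF FE Finj Fconf Eq EE qE hE.
move=> e0; pose mu := expR (2 * rho q).
have dB : differentiable B 0.
  exact: Ck_row_differentiable openT (smooth_comp_chart EE oppq_frame oppq_equator hE SF 1) I.
have cB u : dotv ('D_u B 0) ('D_u B 0) = 4 * mu * dotv u u.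
  rewrite (comp_chart_conformal EE oppq_frame oppq_equator hE SF Fconf) chart_opp0 dot0v /mu.
  by move: (expR _) (dotv u u) => k t; field.
have mu0 : 0 < mu by exact: expR_gt0.
have l1 := conformal_ratio_limit (ltW mu0) dB cB.
have l2 : 1 + dotv y y @[y --> (0 : 'rV[R]_m)^'] --> (1 : R).
  have C : Ck 0 setT (fun y : 'rV[R]_m => 1 + dotv y y).
    apply: (CkD openT (Ck_cst 0 setT (1 : R))).
    by apply: (Ck_dotv openT); exact: (Ck_id 0 openT).
  have := Ck_continuous C (I : setT (0 : 'rV[R]_m)).
  by rewrite /prop_for /continuous_at dot0v addr0 => H; exact (cvg_within_filter _ H).
have l3 : expR (2 * rho (chart E (- q) y)) @[y --> (0 : 'rV[R]_m)^'] --> mu.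
  have := rho_chart_opp_continuous; rewrite /prop_for /continuous_at chart_opp0 => H.
  exact (cvg_within_filter _ H).
have FF : Filter (dnbhs (0 : 'rV[R]_m)) by exact: _.
have l4 := cvgM l2 l1; have {}l4 := l4 FF; rewrite mul1r in l4.
have l5 := cvgV (lt0r_neq0 mu0) l4; have {}l5 := l5 FF.
have l6 := cvgM l5 l5; have {}l6 := l6 FF.
have l7 := cvgM l6 l3; have {}l7 := l7 FF.
(* The ratio tends to [mu] and enters with exponent -2, while exp(2 rho) contributes one more factor
   [mu]. *)
have muE : mu^-1 * mu^-1 * mu = expR (- (2 * rho q)).
  by rewrite expRN -/mu mulfVK // gt_eqF.
rewrite muE in l7.
move/cvgrPdist_le : l7 => /(_ e e0); rewrite near_withinE => /nbhs_ballP [d /= d0 H].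
(* |y|^2 = 1 / |x|^2 has to be less than d^2; the summand 1 makes this strict. *)
exists (1 + d ^- 2) => x xr.
have s0 : 0 < dotv x x.
  by apply: lt_le_trans xr; rewrite ltr_wpDr // invr_ge0 exprn_ge0 // ltW.
have x0 : x != 0 by rewrite -dotv_gt0.
rewrite (theta_inversion x0) distrC expr2; apply: H; last first.
  by rewrite scaler_eq0 invr_eq0 negb_or gt_eqF.
rewrite -ball_normE /= sub0r normrN -(@ltr_pXn2r _ 2) ?nnegrE ?(ltW d0) //.
apply: le_lt_trans (norm_le_dotv _) _.
rewrite dotvZl dotvZr mulVf ?gt_eqF // mulr1.
have d2 : 0 < d ^+ 2 by rewrite exprn_gt0.
rewrite -[ltRHS]invrK ltf_pV2 ?posrE ?invr_gt0 //.
by apply: lt_le_trans xr; rewrite ltrDr.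
Qed.

Lemma theta_const x : theta x = expR (- (2 * rho q)).
Proof using Crho m1 SF FE Finj Fconf Eq EE qE hE EE' qE' hE' full'.
exact: (entire_limit_const m0 Ck_theta theta_gt0 theta_pde theta_limit x).
Qed.

(** Evaluated at the chart point of [p], the constancy of theta is the square of this identity; both
    sides are nonnegative, so the root can be taken. *)
Lemma two_point_pole p : equator p ->
  expR (- rho p) * expR (- rho q) * (1 - dotv (F p) (F q)) = 1 - dotv p q.
Proof using Crho m1 SF FE Finj Fconf Eq EE qE hE full EE' qE' hE' full'.
move=> Ep; have [->|pq] := eqVneq p q.
  by case: (FE Eq) (Eq) => qq' _ [qq _]; rewrite qq' qq subrr mulr0.
have := theta_const ((1 - dotv p q)^-1 *: (p *m E^T)).
rewrite /theta /den /A /= (chart_surj EE qE Eq full Ep pq).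
case: (Eq) => qq _; rewrite -(one_sub_chart_dotq qE qq) (chart_surj EE qE Eq full Ep pq).
have D0 : 0 < 1 - dotv (F p) (F q).
  have := image_den_gt0 ((1 - dotv p q)^-1 *: (p *m E^T)).
  by rewrite /den /A /= (chart_surj EE qE Eq full Ep pq).
have t0 : 0 < 1 - dotv p q.
  by rewrite subr_gt0; apply: unit_dotv_lt1 => //; case: Ep.
have wE (r : R) : expR (2 * r) = (expR (- r))^-1 ^+ 2.
  by rewrite -expRN opprK expr2 -expRD; congr expR; ring.
have wE' (r : R) : expR (- (2 * r)) = expR (- r) ^+ 2.
  by rewrite expr2 -expRD; congr expR; ring.
rewrite wE wE'; have := expR_gt0 (- rho p); have := expR_gt0 (- rho q).
move: (expR (- rho p)) (expR (- rho q)) (1 - dotv (F p) (F q)) (1 - dotv p q) D0 t0.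
move=> w w' D t D0 t0 w'0 w0 e.
apply/eqP; rewrite -(@eqrXn2 _ 2) ?(ltW t0) //; last by rewrite !mulr_ge0 // ltW.
rewrite 2!exprMn -e; apply/eqP; field; rewrite !gt_eqF //.
Qed.

End FixedPole.

Lemma two_point p q : equator p -> equator q ->
  expR (- rho p) * expR (- rho q) * (1 - dotv (F p) (F q)) = 1 - dotv p q.
Proof using Crho m1 SF FE Finj Fconf.
move=> Ep Eq; have [E [EE qE hE full]] := equator_frame Eq.
have [E' [EE' qE' hE' full']] := equator_frame (FE Eq).
exact: (two_point_pole Eq EE qE hE full EE' qE' hE' full' Ep).
Qed.

Hypothesis Fsurj : forall p, equator p -> exists2 q, equator q & F q = p.

(* Adding the two-point identities at q and at the preimage q' of - F q
   eliminates F. *)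
Lemma equator_affine : exists (a : R) (b : point),
  [/\ 0 < a, height b = 0, a ^+ 2 - dotv b b = 1 &
    forall p, equator p -> expR (- rho p) = a + dotv b p].
Proof using Crho m1 SF FE Finj Fconf Fsurj.
have [q Eq] : exists q : point, equator q.
  exists (row_mx (delta_mx 0 0) 0); split.
    by rewrite /sphere /= dotv_row_mx dot0v addr0 dotv_basis mxE !eqxx.
  by rewrite /height row_mxKr mxE.
have [qq hq] := Eq; have [qq' hq'] := FE Eq.
have EFq : equator (- F q).
  by split; [rewrite /sphere /= dotvNl dotvNr opprK|rewrite heightN hq' oppr0].
have [r Er Fr] := Fsurj EFq; have [rr hr] := Er.
have t := two_point Er Eq; rewrite Fr dotvNl qq' opprK in t.
pose w p := expR (- rho p); have w0 p : 0 < w p by exact: expR_gt0.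
(* With F r = - F q, the identities for (p, q) and (p, r), divided by [w q] and [w r], add up to 2 w
   p = 1 / w q + 1 / w r - p.(q / w q + r / w r). The normalisation is the identity for (r, q),
   namely 2 w r w q = 1 - r.q. *)
exists (((w q)^-1 + (w r)^-1) / 2), (- (2^-1 *: ((w q)^-1 *: q + (w r)^-1 *: r))).
have wq0 := w0 q; have wr0 := w0 r.
split.
- by rewrite divr_gt0 // addr_gt0 // invr_gt0.
- by rewrite heightN heightZ heightD !heightZ hq hr !mulr0 addr0 mulr0 oppr0.
- have -> : dotv (- (2^-1 *: ((w q)^-1 *: q + (w r)^-1 *: r)))
      (- (2^-1 *: ((w q)^-1 *: q + (w r)^-1 *: r))) =
      4^-1 * ((w q)^-1 ^+ 2 + (w r)^-1 ^+ 2 + 2 * ((w q)^-1 * (w r)^-1 * dotv r q)).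
    rewrite dotvNl dotvNr opprK !dotvZl !dotvZr !dotvDl !dotvDr !dotvZl !dotvZr.
    by rewrite qq rr (dotvC q r); move: ((w q)^-1) ((w r)^-1) => A B; field.
  have -> : dotv r q = 1 - w r * w q * 2 by rewrite -[LHS](subKr 1) -t /w; ring.
  by field; rewrite !gt_eqF.
move=> p Ep; have t1 := two_point Ep Eq; have t2 := two_point Ep Er.
rewrite Fr dotvNr opprK in t2.
rewrite dotvNl dotvZl dotvDl !dotvZl (dotvC q) (dotvC r) -/(w p).
have -> : dotv p q = 1 - w p * w q * (1 - dotv (F p) (F q)) by rewrite -[LHS](subKr 1) -t1 /w; ring.
have -> : dotv p r = 1 - w p * w r * (1 + dotv (F p) (F q)) by rewrite -[LHS](subKr 1) -t2 /w; ring.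
by field; rewrite !gt_eqF.
Qed.

End EquatorLiouville.

(** * Lorentz boosts *)

Section Boost.
Context {R : realType} {n : nat}.
Local Notation point := 'rV[R]_(n + 1).
Implicit Types (p : point) (b : point) (a : R).

(* The action on the sphere of the Lorentz boost taking (1, p) to
   (a + b.p, p + (1 + b.p / (a + 1)) b). *)
Definition boost a b p : point :=
  (a + dotv b p)^-1 *: (p + (1 + dotv b p / (a + 1)) *: b).

Section Fixed.
Variables (a : R) (b : point).
Hypotheses (a0 : 0 < a) (ab : a ^+ 2 - dotv b b = 1).

Let bb : dotv b b = a ^+ 2 - 1.
Proof. by rewrite -ab; ring. Qed.

Lemma boost_den_gt0 p : sphere p -> 0 < a + dotv b p.
Proof using a0 ab.
move=> pp; have := CauchySchwarz_dotv b p; rewrite (pp : dotv p p = 1) bb mulr1.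
move: (dotv b p) => t t2; rewrite ltNge; apply/negP => le.
have h : a <= - t by rewrite -subr_le0 opprK.
have : a ^+ 2 <= (- t) ^+ 2.
  have h0 := le_trans (ltW a0) h.
  by apply: lerXn2r => //; rewrite nnegrE //; exact: ltW.
rewrite sqrrN => /le_trans /(_ t2); rewrite leNgt => /negP; apply.
by rewrite gtrBl.
Qed.

Lemma boost_sphere p : sphere p -> sphere (boost a b p).
Proof using a0 ab.
move=> pp; have d0 := boost_den_gt0 pp.
rewrite /sphere /= /boost dotvZl dotvZr dotvDl !dotvDr !dotvZl !dotvZr (dotvC p b) bb.
rewrite (pp : dotv p p = 1); move: (dotv b p) d0 => t d0.
have h1 : a + 1 != 0 by rewrite gt_eqF // addr_gt0.
by field; rewrite h1 gt_eqF.
Qed.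

Lemma dotv_boost p : sphere p ->
  dotv b (boost a b p) = (a ^+ 2 - 1 + a * dotv b p) / (a + dotv b p).
Proof using a0 ab.
move=> pp; have d0 := boost_den_gt0 pp; rewrite /boost dotvZr dotvDr dotvZr bb.
move: (dotv b p) d0 => t d0; have h1 : a + 1 != 0 by rewrite gt_eqF // addr_gt0.
by field; rewrite h1 gt_eqF.
Qed.

Lemma boostK p : sphere p -> boost a (- b) (boost a b p) = p.
Proof using a0 ab.
move=> pp; have d0 := boost_den_gt0 pp; have h1 : a + 1 != 0 by rewrite gt_eqF // addr_gt0.
rewrite {1}/boost dotvNl (dotv_boost pp) /boost scalerN -scaleNr.
move: (dotv b p) d0 => t d0; have h2 : a + t != 0 by rewrite gt_eqF.
have -> : (a - (a ^+ 2 - 1 + a * t) / (a + t))^-1 = a + t.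
  have -> : a - (a ^+ 2 - 1 + a * t) / (a + t) = (a + t)^-1 by field.
  by rewrite invrK.
apply/rowP => j; rewrite !mxE; move: (p 0 j) (b 0 j) => x y.
by field; rewrite h1 h2.
Qed.

Lemma height_boost p : height b = 0 -> height (boost a b p) = (a + dotv b p)^-1 * height p.
Proof using. by move=> hb; rewrite /boost heightZ heightD heightZ hb mulr0 addr0. Qed.

Definition boost_dom : set point := [set p | 0 < a + dotv b p].

Lemma Ck_boost_den k : Ck k setT (fun p => a + dotv b p).
Proof using.
apply: (CkD openT (Ck_cst k setT (a : R))).
by apply: (Ck_dotv openT (Ck_cst k setT b)); exact: Ck_id openT.
Qed.

Lemma open_boost_dom : open boost_dom.
Proof using.
apply: open_lt_fun => p; last exact: (Ck_continuous (Ck_boost_den 0) I).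
by apply: differentiable_continuous.
Qed.

Lemma Ck_boost k : Ck k boost_dom (boost a b).
Proof using.
have oU := open_boost_dom; have Cd := Ck_sub (@subsetT _ boost_dom) (Ck_boost_den k).
have Cb : Ck k boost_dom (dotv b).
  by apply: (Ck_dotv oU (Ck_cst k boost_dom b)); exact: Ck_id oU.
apply: (Ck_scale oU).
  by apply: (CkV oU) => // p pU; rewrite gt_eqF.
apply: (Ck_addv oU (Ck_id k oU)); apply: (Ck_scale oU _ (Ck_cst k boost_dom b)).
exact (CkD oU (Ck_cst k boost_dom (1 : R)) (CkM oU Cb (Ck_cst k boost_dom ((a + 1)^-1 : R)))).
Qed.

Lemma smooth_boost : smooth_on sphere (boost a b).
Proof using a0 ab.
move=> p /boost_den_gt0 pU; exists boost_dom, (boost a b).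
by split=> // [|k]; [exact: open_boost_dom|exact: Ck_boost].
Qed.

Lemma derive_boost p u : sphere p ->
  'D_u (boost a b) p =
  (a + dotv b p)^-1 *: (u + (dotv b u / (a + 1)) *: b - dotv b u *: boost a b p).
Proof using a0 ab.
move=> /boost_den_gt0 d0.
have d0' : a + dotv b p != 0 by rewrite gt_eqF.
have hb := is_derive_dotvl b p u.
pose g (y : point) : R := a + dotv b y.
have hg : is_derive p u g (dotv b u).
  by apply: is_derive_eq (is_deriveD (is_derive_cst a p u) hb) _; rewrite add0r.
have hV : is_derive p u (fun y => (g y)^-1) (- (a + dotv b p) ^- 2 * dotv b u).
  case: hg => dd de; apply: DeriveDef; first exact (derivableV (f := g) d0' dd).
  by rewrite (deriveV (f := g) d0' dd) de.
pose l (y : point) : R := 1 + dotv b y / (a + 1).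
have hl : is_derive p u l (dotv b u / (a + 1)).
  have le : l = cst 1 + (a + 1)^-1 *: dotv b.
    by apply/funext => y; rewrite /l mulrC.
  rewrite le; apply: is_derive_eq (is_deriveD (is_derive_cst (1 : R) p u) (is_deriveZ _ hb)) _.
  by rewrite add0r mulrC.
have [_ ->] := is_derive_scale hV (is_deriveD (is_derive_id p u)
  (is_derive_scale hl (is_derive_cst b p u))).
rewrite /boost /cst /l /g; apply/rowP => j; rewrite !mxE.
have h1 : a + 1 != 0 by rewrite gt_eqF // addr_gt0.
move: (dotv b p) (dotv b u) (p 0 j) (u 0 j) (b 0 j) d0' => s t x y z d0'.
by field; rewrite h1 d0'.
Qed.

(** The boost preserves the Lorentz form, for which (1, p) is null. Normalising the image to have
    first coordinate 1 divides by [a + b.p]; the derivative of this factor only adds a multiple of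
    the null image vector, which does not affect the products. *)
Lemma pullback_boost p u v : sphere p -> tangent p u -> tangent p v ->
  pullback (boost a b) round_metric p u v = (a + dotv b p)^-1 ^+ 2 * dotv u v.
Proof using a0 ab.
move=> pp pu pv; have d0 := boost_den_gt0 pp.
have sd w : tangent p w -> sphere_diff (boost a b) p w = 'D_w (boost a b) p.
  move=> pw; apply: (sphere_diff_extension (A := sphere) open_boost_dom (Ck_boost 1) d0 pp pw) => // t.
  have pw' : dotv p w = 0 by [].
  apply: unitize_sphere; rewrite -dotv_gt0 dotvDl !dotvDr !dotvZl !dotvZr (pp : dotv p p = 1).
  rewrite (dotvC w p) pw' !mulr0 addr0 add0r mulrA -expr2; apply: ltr_wpDl => //.
  by apply: mulr_ge0; [exact: sqr_ge0|exact: dotv_ge0].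
rewrite /pullback /round_metric !sd // !derive_boost // dotvZl dotvZr mulrA -expr2; congr (_ * _).
have qq := boost_sphere pp; have bq := dotv_boost pp.
have wq w : tangent p w -> dotv w (boost a b p) = (1 + dotv b p / (a + 1)) * dotv b w / (a + dotv b p).
  move=> pw; have pw' : dotv p w = 0 by [].
  by rewrite /boost dotvZr dotvDr dotvZr (dotvC w p) pw' add0r (dotvC w b) mulrC.
have uq := wq u pu; have vq := wq v pv.
move: (boost a b p) qq bq uq vq => q qq bq uq vq.
rewrite !dotvDl !dotvDr !dotvNl !dotvNr !dotvZl !dotvZr bb (qq : dotv q q = 1).
rewrite (dotvC u b) (dotvC q v) (dotvC q b) bq uq vq.
have h1 : a + 1 != 0 by rewrite gt_eqF // addr_gt0.
have h2 : a + dotv b p != 0 by rewrite gt_eqF.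
move: (dotv b p) (dotv b u) (dotv b v) (dotv u v) h2 => s t r y h2.
by field; rewrite h1 h2.
Qed.

Lemma boost_closed_hemisphere p : height b = 0 -> closed_hemisphere p ->
  closed_hemisphere (boost a b p).
Proof using a0 ab.
move=> hb [pp hp]; split; first exact: boost_sphere.
by rewrite height_boost // mulr_ge0 // invr_ge0 ltW // boost_den_gt0.
Qed.

End Fixed.

Variables (a : R) (b : point).
Hypotheses (a0 : 0 < a) (ab : a ^+ 2 - dotv b b = 1).

Let ab' : a ^+ 2 - dotv (- b) (- b) = 1.
Proof. by rewrite dotvNl dotvNr opprK. Qed.

Lemma boostNK p : sphere p -> boost a b (boost a (- b) p) = p.
Proof using a0 ab. by move=> pp; rewrite -{1}[b]opprK boostK. Qed.

Lemma conformal_diffeo_boost : conformal_diffeo (boost a b).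
Proof using a0 ab.
split.
  split; first exact: smooth_boost.
  exists (boost a (- b)); split.
  - exact: smooth_boost.
  - by split=> p; exact: boost_sphere.
  - by move=> p; exact: boostK.
  - by move=> p; exact: boostNK.
exists (fun p => - ln (a + dotv b p)) => p u v pp pu pv.
rewrite (pullback_boost a0 ab pp pu pv) /conformal_metric /round_metric; congr (_ * _).
have d0 := boost_den_gt0 a0 ab pp.
by rewrite -{1}(lnK d0) -expRN expr2 -expRD; congr expR; ring.
Qed.

Lemma boost_image_closed_hemisphere : height b = 0 ->
  boost a b @` closed_hemisphere = closed_hemisphere.
Proof using a0 ab.
move=> hb; apply/seteqP; split=> [_ [p Hp <-]|p Hp].
  exact: boost_closed_hemisphere.
exists (boost a (- b) p).
  by apply: boost_closed_hemisphere => //; rewrite heightN hb oppr0.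
by case: Hp => pp _; exact: boostNK.
Qed.

End Boost.

Theorem theorem3p1 (R : realType) (n : nat) (f : 'rV[R]_n -> R)
    (Gam : set 'rV[R]_n) (rho : 'rV[R]_(n + 1) -> R) :
  (3 <= n)%N ->
  elliptic_data f Gam ->
  Ck_on 2 closed_hemisphere rho ->
  supersolution f Gam (conformal_metric rho) ->
  equator_isometric (conformal_metric rho) round_metric ->
  exists Phi : 'rV[R]_(n + 1) -> 'rV[R]_(n + 1),
    [/\ conformal_diffeo Phi,
        Phi @` closed_hemisphere = closed_hemisphere
      & forall p u v, closed_hemisphere p -> tangent p u -> tangent p v ->
          conformal_metric rho p u v = pullback Phi round_metric p u v].
Proof.
move=> n3 ed Crho super [F [[SF [G [_ [FE GE] GF FG]]] Fconf]].
have [a [b [a0 hb ab bd]]] : exists (a : R) (b : 'rV[R]_(n + 1)),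
  [/\ 0 < a, height b = 0, a ^+ 2 - dotv b b = 1 &
    forall p, equator p -> expR (- rho p) = a + dotv b p].
  (* Everything depending on [n] is generalised so that [n] can be replaced by [1 + m], the shape
     used on the equator; the bound on [n] becomes [1 < m]. *)
  move: (f) (Gam) ed super => f' Gam' ed super; clear f Gam.
  case: n n3 rho Crho F SF G FE GE GF FG Fconf f' Gam' ed super => [|m] //.
  move=> m2 rho Crho F SF G FE GE GF FG Fconf _ _ _ _.
  have Finj p q : equator p -> equator q -> F p = F q -> p = q.
    by move=> Ep Eq e; rewrite -(GF p Ep) e GF.
  have Fsurj p : equator p -> exists2 q, equator q & F q = p.
    by move=> Ep; exists (G p); [exact: GE|exact: FG].
  exact: (@equator_affine R m F rho m2 Crho SF FE Finj Fconf Fsurj).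
have bE p : dotv b p = dotv (lsubmx b) (lsubmx p).
  by rewrite dotv_submx hb mul0r addr0.
have ab' : a ^+ 2 - dotv (lsubmx b) (lsubmx b) = 1 by rewrite -bE.
have w p : closed_hemisphere p -> expR (- rho p) = a + dotv b p.
  move=> Hp; rewrite bE; apply: (hemisphere_rigidity n3 ed Crho super a0 ab' _ Hp).
  by move=> q Eq; rewrite -bE bd.
exists (boost a b); split.
- exact: conformal_diffeo_boost.
- exact: boost_image_closed_hemisphere.
move=> p u v Hp pu pv; have [pp _] := Hp.
rewrite (pullback_boost a0 ab pp pu pv) -(w p Hp) -expRN opprK /conformal_metric.
by rewrite expr2 -expRD; congr (expR _ * _); ring.
Qed.
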